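(* Suppose the adjustment costs satisfy $\mathcal{D}_p<\mathcal{C}_+/\alpha$ and $\mathcal{I}_p\ge\mathcal{C}_-/\alpha$. Then there exists a threshold $U$ such that the optimal policy is given by $$\dot P(t)=\begin{cases}0, & \text{if } P(t)-D(t)\le U,\\ \theta_\ell, & \text{if } P(t)-D(t)>U.\end{cases}$$ Moreover, the value of $U$ is characterized by $$U=\begin{cases}\frac{1}{-r_2}\ln\left[\frac{(\mathcal{C}_++\mathcal{C}_-)r_1}{(\mathcal{C}_+-\alpha\mathcal{D}_p)(r_1-t_2)}\right]\ge 0, & \text{if } J_1\le J_3,\\[2mm] \frac{1}{t_1}\ln\left[\frac{(\alpha\mathcal{D}_p+\mathcal{C}_-)(r_1-t_2)}{(\mathcal{C}_++\mathcal{C}_-)(-t_2)}\right]<0, & \text{if } J_1>J_3.\end{cases}$$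
   Context: Parameters: discount rate $\alpha>0$; $b\in\mathbb{R}$; $\sigma>0$; finite rate bounds $\theta_\ell<0<\theta_u$; per-unit adjustment costs $\mathcal{I}_p\ge 0$ (increase) and $\mathcal{D}_p\ge 0$ (decrease); per-unit reward and cost $\mathcal{R}_p>\mathcal{C}_p\ge 0$ of the primary resource, and $\mathcal{R}_s>\mathcal{C}_s\ge 0$ of the secondary resource. Put $\mathcal{N}_p=\mathcal{R}_p-\mathcal{C}_p$, $\mathcal{N}_s=\mathcal{R}_s-\mathcal{C}_s$, $\mathcal{C}_+=\mathcal{C}_p$, $\mathcal{C}_-=\mathcal{N}_p-\mathcal{N}_s$. The primary resource has higher net-benefit than the secondary resource, $\mathcal{N}_p>\mathcal{N}_s$ (so $\mathcal{C}_->0$). Notation: $x^+=\max\{x,0\}$, $x^-=-\min\{x,0\}$. Demand is $dD(t)=b\,dt+\sigma\,dW(t)$, with $W$ a one-dimensional standard Brownian motion. A control policy is a process $P$ (primary capacity) with absolutely continuous paths, adapted to the filtration generated by $\{D(s):s\le t\}$, with given $P(0)$, and with $\theta_\ell\le\dot P(t)\le\theta_u$ for $t\ge 0$. Let $X(t)=P(t)-D(t)$, $X(0)=x$, so $dX(t)=dP(t)-b\,dt-\sigma\,dW(t)$. The stochastic control problem is to minimize over control policies $$\mathbb{E}_x\left[\int_0^\infty e^{-\alpha t}\left\{\left(\mathcal{C}_+X(t)^++\mathcal{C}_-X(t)^-\right)dt+\left(\mathcal{I}_p\mathbf{1}_{\{\dot P(t)>0\}}-\mathcal{D}_p\mathbf{1}_{\{\dot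 P(t)<0\}}\right)dP(t)\right\}\right],$$ where $\mathbb{E}_x$ is expectation given $X(0)=x$. A policy is optimal if it attains the minimum, for every initial $x$. Constants: $r_{1}=\frac{b+\sqrt{b^2+2\alpha\sigma^2}}{\sigma^2}>0$, $r_2=\frac{b-\sqrt{b^2+2\alpha\sigma^2}}{\sigma^2}<0$; $t_1=\frac{b-\theta_\ell+\sqrt{(b-\theta_\ell)^2+2\alpha\sigma^2}}{\sigma^2}>0$, $t_2=\frac{b-\theta_\ell-\sqrt{(b-\theta_\ell)^2+2\alpha\sigma^2}}{\sigma^2}<0$; $J_1=(\mathcal{C}_+-\alpha\mathcal{D}_p)(r_1-t_2)$, $J_3=(\mathcal{C}_++\mathcal{C}_-)r_1$. *)

(* Defs.v *)
From HB Require Import structures.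
From mathcomp Require Import all_boot all_order all_algebra.
From mathcomp Require Import all_classical all_reals all_analysis.

Set Implicit Arguments.
Unset Strict Implicit.
Unset Printing Implicit Defensive.

Import Order.TTheory GRing.Theory Num.Theory.
Import numFieldNormedType.Exports.

Local Open Scope classical_set_scope.
Local Open Scope ring_scope.

(* A real-valued process is a function
   R -> T -> R, of which only the values at times t >= 0 matter. *)

Section Processes.
Context {R : realType} {d : measure_display} {T : measurableType d}.
Implicit Types (Y P : R -> T -> R).

Definition natural_filtration Y (t : R) : set (set T) :=
  <<s \bigcup_(s in `[0, t]) preimage_set_system setT (Y s) measurable >>.

Definition adapted Y (F : R -> set (set T)) : Prop :=
  forall t : R, 0 <= t -> forall B : set R, measurable B -> F t (Y t @^-1` B).

Definition increment Y (s t : R) : T -> R := fun w => Y t w - Y s w.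

(* The second parameter of normal_prob is the standard deviation. *)
Record standard_brownian_motion (Pr : probability T R) (W : R -> T -> R) :
    Prop := StandardBrownianMotion {
  bm_measurable : forall t : R, 0 <= t -> measurable_fun setT (W t) ;
  bm_start : forall w, W 0 w = 0 ;
  bm_continuous : forall w, {within `[0, +oo[, continuous (W^~ w)} ;
  bm_gaussian : forall s t : R, 0 <= s -> s < t ->
    forall B : set R, measurable B ->
    Pr (increment W s t @^-1` B)
      = normal_prob 0 (Num.sqrt (t - s)) B ;
  bm_independent : forall s t : R, 0 <= s -> s < t ->
    forall (A : set T) (B : set R), natural_filtration W s A -> measurable B ->
    Pr (A `&` increment W s t @^-1` B)
      = (Pr A * Pr (increment W s t @^-1` B))%E }.

(* dD(t) = b dt + sigma dW(t), D(0) = d0 *)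
Definition demand (b sigma d0 : R) (W : R -> T -> R) : R -> T -> R :=
  fun t w => d0 + b * t + sigma * W t w.

Definition absolutely_continuous_on (a b : R) (f : R -> R) : Prop :=
  forall e : R, 0 < e -> exists2 delta : R, 0 < delta &
    forall (n : nat) (u v : 'I_n -> R),
      (forall i, [/\ a <= u i, u i <= v i & v i <= b]) ->
      trivIset setT (fun i => `]u i, v i[%classic) ->
      \sum_(i < n) (v i - u i) < delta ->
      \sum_(i < n) `|f (v i) - f (u i)| < e.

Definition rate P (w : T) (t : R) : R := derive1 (P^~ w) t.

(* An absolutely continuous path need only have a derivative at almost every
   time, so conditions on the rate are imposed almost surely, for almost every
   t >= 0. *)
Definition ae_rate (Pr : probability T R) P (C : T -> R -> Prop) : Prop :=
  {ae Pr, forall w, {ae lebesgue_measure, forall t : R, 0 <= t ->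
    derivable (P^~ w) t 1 /\ C w t}}.

Definition control_policy (Pr : probability T R) (thl thu p0 : R)
    (D P : R -> T -> R) : Prop :=
  [/\ forall w, P 0 w = p0,
      adapted P (natural_filtration D),
      forall w (t : R), 0 <= t -> absolutely_continuous_on 0 t (P^~ w)
    & ae_rate Pr P (fun w t => thl <= rate P w t <= thu)].

Definition threshold_rule (Pr : probability T R) (thl U : R)
    (D P : R -> T -> R) : Prop :=
  ae_rate Pr P (fun w t =>
    rate P w t = if P t w - D t w <= U then 0 else thl).

(* Along an absolutely continuous path dP(t) is (rate P t) dt.  When Cplus,
   Cminus, Ip and Dp are nonnegative so is the integrand, and the cost is
   well defined in [0, +oo]. *)
Definition expected_cost (Pr : probability T R) (alpha Cplus Cminus Ip Dp : R)
    (D P : R -> T -> R) : \bar R :=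
  (\int[Pr]_w \int[lebesgue_measure]_(t in `[0%R, +oo[)
    (expR (- alpha * t) *
      (Cplus * Num.max (P t w - D t w) 0
       + Cminus * (- Num.min (P t w - D t w) 0)
       + (Ip * (0 < rate P w t)%R%:R - Dp * (rate P w t < 0)%R%:R)
         * rate P w t))%:E)%E.

Definition optimal_policy (Pr : probability T R)
    (alpha Cplus Cminus Ip Dp thl thu p0 : R) (D P : R -> T -> R) : Prop :=
  control_policy Pr thl thu p0 D P /\
  forall Q, control_policy Pr thl thu p0 D Q ->
    (expected_cost Pr alpha Cplus Cminus Ip Dp D P
       <= expected_cost Pr alpha Cplus Cminus Ip Dp D Q)%E.

End Processes.

(* The roots of sigma^2 / 2 * z^2 - c * z - alpha = 0. *)
Definition pos_root {R : realType} (alpha c sigma : R) : R :=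
  (c + Num.sqrt (c ^+ 2 + 2 * alpha * sigma ^+ 2)) / sigma ^+ 2.

Definition neg_root {R : realType} (alpha c sigma : R) : R :=
  (c - Num.sqrt (c ^+ 2 + 2 * alpha * sigma ^+ 2)) / sigma ^+ 2.

(* Main.v *)
(* Verification with an explicit value function.  The Hamilton-Jacobi-Bellman
   equation
     sigma^2/2 w - b v - alpha V + h + thl (v - Dp)^+ = 0,  v = V', w = V'',
   h(x) = C_+ x^+ + C_- x^-, is solved by three exponential pieces glued with
   continuous second derivative at 0 and at U, with v >= - Ip everywhere and
   v <= Dp exactly to the left of U; these gluing conditions give the two formulas
   for U.

   There is no stochastic calculus here.  A third-order Taylor expansion of V over
   a time step k, with Gaussian moments and independence of increments, shows that
   phi(t) = E V(X_t) satisfies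
     phi(t+k) - phi(t) >= alpha k phi(t) - E int_t^(t+k) running cost - O(k^(3/2))
   for every policy, with <= and + O(k^(3/2)) for the threshold policy.  Over a
   horizon T there are T/k steps, so the errors add up to O(k^(1/2)); telescoping with
   the discount factor, then k -> 0 and T -> oo, give cost >= V(p0 - d0), with equality
   for the threshold policy.

   The threshold policy itself is a limit of Euler schemes, which converge pathwise
   because the feedback is monotone; at a fixed time the state has no atom at U, so
   almost surely the feedback is continuous along the path at almost every time. *)
Require Import Defs.
From HB Require Import structures.
From mathcomp Require Import all_boot all_order all_algebra.
From mathcomp Require Import all_classical all_reals all_analysis.
From mathcomp Require Import measurable_realfun.
From mathcomp Require Import ring lra.

Set Implicit Arguments.
Unset Strict Implicit.
Unset Printing Implicit Defensive.

Import Order.TTheory GRing.Theory Num.Theory.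
Import numFieldNormedType.Exports.

Local Open Scope classical_set_scope.
Local Open Scope ring_scope.

(** * Integrals of real functions *)

(** The obstacle inside a time step is that the control may react to the noise of that very step, so
    its contribution cannot be factored by independence. Independence serves only for functions of
    X_t times powers of the Brownian increment.

    The error k^(3/2) is the size of E |X_(t+k) - X_t|^3, which requires a Lipschitz second
    derivative; a jump of V'' at a gluing point would leave errors of order k, whose sum over T/k
    steps need not vanish.

    A second obstacle is measurability. The rate of a policy is given path by path, almost
    everywhere, and the cost is an iterated integral whose integrand is not assumed jointly
    measurable. It is replaced by a jointly measurable version, and nonnegative integrals are
    compared as suprema over simple functions, which needs no measurability. *)

Section RealIntegrable.
Context d (T : measurableType d) (R : realType) (mu : {measure set T -> \bar R}).
Variable D : set T.
Hypothesis mD : measurable D.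
Implicit Types f g : T -> R.

Lemma integrableZ_EFin (k : R) f : mu.-integrable D (EFin \o f) ->
  mu.-integrable D (EFin \o (fun x => k * f x)).
Proof. by move=> fi; have := @integrableZl _ _ _ mu D mD k _ fi; apply: eq_integrable. Qed.

Lemma integrableD_EFin f g : mu.-integrable D (EFin \o f) ->
  mu.-integrable D (EFin \o g) -> mu.-integrable D (EFin \o (fun x => f x + g x)).
Proof. by move=> fi gi; have := integrableD mD fi gi; apply: eq_integrable. Qed.

Lemma integrableB_EFin f g : mu.-integrable D (EFin \o f) ->
  mu.-integrable D (EFin \o g) -> mu.-integrable D (EFin \o (fun x => f x - g x)).
Proof. by move=> fi gi; have := integrableB mD fi gi; apply: eq_integrable. Qed.

End RealIntegrable.

Section BoundedIntegrable.
Context d (T : measurableType d) (R : realType) (P : probability T R).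

Lemma bounded_probability_integrable (f : T -> R) (K : R) : measurable_fun setT f ->
  (forall x, `|f x| <= K) -> P.-integrable setT (EFin \o f).
Proof.
move=> mf fK; apply: measurable_bounded_integrable => //.
  exact: (le_lt_trans (probability_le1 P measurableT) (ltry _)).
exists K; split; first by rewrite num_real.
by move=> M KM x _; rewrite /= (le_trans (fK _))// ltW.
Qed.

Lemma probability_cst_integrable (c : R) : P.-integrable setT (EFin \o (fun=> c)).
Proof. exact: (@bounded_probability_integrable _ `|c|). Qed.

Lemma Rintegral_probability_cst (c : R) : \int[P]_x c = c.
Proof. by rewrite Rintegral_cst//= probability_setT/= mulr1. Qed.

End BoundedIntegrable.

Ltac integrability := repeat first
  [ assumption | apply: integrableB_EFin | apply: integrableD_EFin
  | apply: integrableZ_EFin | exact: measurableT | exact: measurable_itv ].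

(** * Absolutely continuous paths *)

Section AlmostEverywhere.
Context d (T : measurableType d) (R : realType) (mu : {measure set T -> \bar R}).
Implicit Types P Q : T -> Prop.

Lemma ae_imp P Q : {ae mu, forall x, P x} -> (forall x, P x -> Q x) ->
  {ae mu, forall x, Q x}.
Proof. by move=> aeP PQ; apply: (@filterS _ _ (ae_filter_ringOfSetsType mu) P). Qed.

Lemma ae_imp2 P1 P2 Q : {ae mu, forall x, P1 x} -> {ae mu, forall x, P2 x} ->
  (forall x, P1 x -> P2 x -> Q x) -> {ae mu, forall x, Q x}.
Proof.
by move=> ae1 ae2 PQ; apply: (@filterS2 _ _ (ae_filter_ringOfSetsType mu) P1 P2).
Qed.

End AlmostEverywhere.

Section AbsCont.
Variable R : realType.
Implicit Types (a b M : R) (f : R -> R).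
Notation mu := (@lebesgue_measure R).

(** A Cousin-type argument: at the supremum of the points satisfying [Q], the step carries [Q] from
    some point just before it to a point beyond it. [Q] may fail in between, so the step only speaks
    of pairs on either side of s. *)
Lemma real_induction a b (Q : R -> Prop) : a <= b -> Q a ->
  (forall s, a <= s <= b -> exists2 e : R, 0 < e &
     forall y z, a <= y -> y <= s -> s <= z -> z <= b -> s - y < e -> z - s < e ->
       Q y -> Q z) ->
  Q b.
Proof.
move=> ab Qa step.
pose S := [set x | a <= x <= b /\ Q x].
have Sa : S a by split => //; rewrite lexx.
have hS : has_sup S.
  by split; [exists a | exists b => x [/andP[]]].
have /andP[as_ sb] : a <= sup S <= b.
  apply/andP; split; first exact: sup_upper_bound.
  by apply: ge_sup => [|x [/andP[]//]]; exists a.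
have [|e e0 he] := step (sup S); first by rewrite as_.
have [y [/andP[ay yb] Qy] ys] := sup_adherent e0 hS.
have yS : y <= sup S by apply: sup_upper_bound => //; split => //; rewrite ay.
have h z : sup S <= z -> z <= b -> z - sup S < e -> Q z.
  by move=> sz zb zs; apply: (he y) => //; rewrite ltrBlDl -ltrBlDr.
have [sbE|sb'] := eqVneq (sup S) b.
  by apply: h; rewrite ?sbE ?subrr.
pose z := Num.min b (sup S + e / 2).
have sz : sup S < z by rewrite lt_min lt_neqAle sb' sb ltrDl divr_gt0.
have zb : z <= b by rewrite ge_min lexx.
have Qz : Q z.
  apply: h => //; first exact: ltW.
  rewrite ltrBlDl gt_min; apply/orP; right; lra.
have : z <= sup S.
  by apply: sup_upper_bound => //; split => //; rewrite zb (le_trans as_ (ltW sz)).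
by rewrite leNgt sz.
Qed.

(** Differentiability at s controls f only relative to f s; with y and z on either side of s the two
    estimates add up with nonnegative weights s - y and z - s. *)
Lemma derivable_straddle f s M (e : R) : 0 < e -> derivable f s 1 ->
  derive1 f s <= M ->
  exists2 dl : R, 0 < dl & forall y z, y <= s -> s <= z -> s - y < dl -> z - s < dl ->
    f z - f y <= (M + e) * (z - y).
Proof.
move=> e0 df fM.
have /cvgrPdist_lt /(_ e e0) : (h^-1 *: (f (h + s) - f s)) @[h --> 0^'] --> derive1 f s.
  by rewrite derive1E; have := df; rewrite /derivable /derive;
     under eq_fun do rewrite /GRing.scale/= mulr1.
case=> /= dl dl0 hdl; exists dl => // y z ys sz sy zs.
have right_ : f z - f s <= (M + e) * (z - s).
  have [->|zs'] := eqVneq z s; first by rewrite !subrr mulr0.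
  have zs0 : 0 < z - s by rewrite subr_gt0 lt_neqAle eq_sym zs'.
  have := hdl (z - s); rewrite /= sub0r normrN gtr0_norm// gt_eqF// subrK.
  move=> /(_ zs isT); rewrite ltr_distlC => /andP[_].
  rewrite /GRing.scale/= ltr_pdivrMl// => h.
  by apply: (le_trans (ltW h)); rewrite mulrC ler_wpM2r ?(ltW zs0)// lerD2r.
have left_ : f s - f y <= (M + e) * (s - y).
  have [->|ys'] := eqVneq y s; first by rewrite !subrr mulr0.
  have zs0 : 0 < s - y by rewrite subr_gt0 lt_neqAle ys'.
  have := hdl (y - s); rewrite /= sub0r normrN distrC gtr0_norm// subr_eq0 ys' subrK.
  move=> /(_ sy isT); rewrite ltr_distlC => /andP[_].
  rewrite /GRing.scale/= -(opprB s y) -(opprB (f s)) invrN mulrNN.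
  rewrite ltr_pdivrMl// => h.
  by apply: (le_trans (ltW h)); rewrite mulrC ler_wpM2r ?(ltW zs0)// lerD2r.
have -> : f z - f y = (f z - f s) + (f s - f y) by ring.
have -> : (M + e) * (z - y) = (M + e) * (z - s) + (M + e) * (s - y) by ring.
exact: lerD.
Qed.

Lemma null_set_open_cover (N : set R) (e : R) : 0 < e -> measurable N -> mu N = 0%E ->
  exists O : set R, [/\ open O, N `<=` O & (mu O < e%:E)%E].
Proof.
move=> e0 mN N0.
have [|O [oO NO Oe]] := lebesgue_regularity_outer mN _ e0.
  by rewrite [X in (X < _)%E](N0).
exists O; split => //.
have mO : measurable O by exact: open_measurable.
apply: le_lt_trans Oe; rewrite -{1}(setDUK NO).
rewrite (le_trans (measureU2 _ _ _))//; first exact: measurableD.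
by rewrite [X in (X + _)%E](N0) add0e.
Qed.

Lemma le_mu (A B : set R) : measurable A -> measurable B -> A `<=` B -> (mu A <= mu B)%E.
Proof. by move=> mA mB AB; apply: le_measure; rewrite ?inE. Qed.

Lemma mu_itvco (y z : R) : y <= z -> mu `[y, z[%classic = (z - y)%:E.
Proof.
move=> yz; rewrite lebesgue_measure_itv/= lte_fin; case: ltP => // zy.
by have -> : z = y by [apply/le_anti; rewrite zy yz]; rewrite subrr.
Qed.

(** The open set covers the exceptional points: near those the interval is swallowed by [O], and its
    increment is left to absolute continuity. *)
Lemma straddle_step (O : set R) f a b M (e : R) s : open O -> 0 < e ->
  O s \/ (derivable f s 1 /\ derive1 f s <= M) ->
  exists2 dl : R, 0 < dl & forall y z, a <= y -> y <= s -> s <= z -> z <= b ->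
    s - y < dl -> z - s < dl ->
    f z - f y <= (M + e) * (z - y) \/ `[y, z] `<=` O.
Proof.
move=> oO e0 [Os|[df fM]]; last first.
  have [dl dl0 h] := derivable_straddle e0 df fM.
  by exists dl => // y z _ ys sz _ sy zs; left; exact: h.
move: oO; rewrite openE => /(_ s Os); rewrite /interior -nbhs_ballE.
move=> [dl /= dl0 hdl]; exists dl => // y z _ ys sz _ sy zs; right => x /=.
rewrite in_itv/= => /andP[yx xz]; apply: hdl.
rewrite /ball/= ltr_distlC; apply/andP; split; lra.
Qed.

(** Real induction replaces a Vitali covering. Where the derivative is bounded by M the increment is
    estimated directly; the remaining intervals lie in an open set of small measure, where absolute
    continuity bounds the total variation by e. *)
Lemma absolutely_continuous_slope_le f a b M : a <= b ->
  absolutely_continuous_on a b f ->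
  {ae mu, forall t : R, a <= t -> t <= b -> derivable f t 1 /\ derive1 f t <= M} ->
  f b - f a <= M * (b - a).
Proof.
move=> ab acf [N [mN N0 hN]].
suff H e : 0 < e -> f b - f a <= (M + e) * (b - a) + (e + e).
  apply/ler_addgt0Pr => e e0.
  have d0 : 0 < b - a + 2 by lra.
  have := H (e / (b - a + 2)) (divr_gt0 e0 d0).
  move/le_trans; apply; rewrite mulrDl -addrA lerD2l.
  have -> : e / (b - a + 2) * (b - a) + (e / (b - a + 2) + e / (b - a + 2)) = e.
    by field; rewrite gt_eqF.
  by [].
move=> e0; have [dl dl0 hdl] := acf e e0.
have k0 : 0 < `|M + e| + 1 by rewrite ltr_wpDl.
(* The first bound feeds absolute continuity; the second makes [|M + e|] times the total length of
   the bad intervals at most e. *)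
pose dl2 := Num.min dl (e / (`|M + e| + 1)).
have dl2_gt0 : 0 < dl2 by rewrite lt_min dl0 divr_gt0.
have [G [oG NG Gdl']] := null_set_open_cover dl2_gt0 mN N0.
have Gdl : (mu G < dl%:E)%E.
  by apply: (lt_le_trans Gdl'); rewrite lee_fin ge_min lexx.

have mG : measurable G by exact: open_measurable.
(* The invariant records the bad intervals met so far, in increasing order and hence disjoint. Their
   length is charged to the part of [G] below x; taking [[a, x[] half-open makes the next charge
   [[y, z[] disjoint from it. *)
pose Q x := exists n (u v : nat -> R),
  [/\ (forall i, (i < n)%N -> [/\ a <= u i, u i <= v i & v i <= x]),
      (forall i j, (i < j)%N -> (j < n)%N -> v i <= u j),
      ((\sum_(i < n) (v i - u i))%:E <= mu (G `&` `[a, x[))%E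
    & f x - f a <= (M + e) * (x - a) +
        (\sum_(i < n) `|f (v i) - f (u i)| + `|M + e| * \sum_(i < n) (v i - u i))].
suff [n [u [v [uv vu lenuv fba]]]] : Q b.
  have lenG : (((\sum_(i < n) (v i - u i)))%:E <= mu G)%E.
    apply: (le_trans lenuv); by apply: le_mu => //; exact: measurableI.
  apply: (le_trans fba); rewrite lerD2l lerD//; last first.
    have : \sum_(i < n) (v i - u i) <= e / (`|M + e| + 1).
      rewrite -lee_fin; apply: (le_trans lenG); apply: (le_trans (ltW Gdl')).
      by rewrite lee_fin ge_min lexx orbT.
    rewrite ler_pdivlMr// mulrC; apply: le_trans; apply: ler_wpM2r.
      by apply: sumr_ge0 => i _; rewrite subr_ge0; have [] := uv _ (ltn_ord i).
    by rewrite lerDl.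
  apply/ltW; apply: (hdl n (fun i => u i) (fun i => v i)).
  - by move=> i; exact: uv.
  - move=> i j _ _ [x [/=]]; rewrite !in_itv/= => /andP[ui vi] /andP[uj vj].
    apply/val_inj/eqP; rewrite eqn_leq; apply/andP; split; rewrite leqNgt; apply/negP => ij.
      by have := vu _ _ ij (ltn_ord i); lra.
    by have := vu _ _ ij (ltn_ord j); lra.
  - by rewrite -lte_fin; apply: (le_lt_trans lenG).
apply: (@real_induction a b Q) => //.
  exists 0%N, (fun=> 0), (fun=> 0); split => //; first by rewrite big_ord0.
  by rewrite !big_ord0 !subrr !mulr0 !addr0.
move=> s /andP[as_ sb].
have : G s \/ (derivable f s 1 /\ derive1 f s <= M).
  have [Os|nGs] := pselect (G s); [by left|right].
  have [//|nd] := pselect (derivable f s 1 /\ derive1 f s <= M).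
  by exfalso; apply/nGs/NG/hN => /(_ as_ sb).
move=> /(@straddle_step G f a b M e s oG e0) [dl' dl'0 hs].
exists dl' => // y z ay ys sz zb sy zs [n [u [v [uv vu lenuv fya]]]].
have yz : y <= z by exact: le_trans sz.
have [fzy|Oyz] := hs y z ay ys sz zb sy zs.
  exists n, u, v; split => //.
  - by move=> i /uv[? ? ?]; split => //; apply: le_trans yz.
  - apply: (le_trans lenuv); apply: le_mu; [exact: measurableI..|].
    by apply: setIS => x /=; rewrite !in_itv/= => /andP[-> /= /lt_le_trans]; apply.
  - have -> : f z - f a = (f z - f y) + (f y - f a) by ring.
    have -> : (M + e) * (z - a) = (M + e) * (z - y) + (M + e) * (y - a) by ring.
    by rewrite -[leRHS]addrA lerD.
exists n.+1, (fun i => if (i < n)%N then u i else y),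
  (fun i => if (i < n)%N then v i else z); split.
- move=> i; rewrite ltnS; case: ifPn => [ i_n _|_ _]; last by split.
  by have [? ? ?] := uv i i_n; split => //; apply: le_trans yz.
- move=> i j ij; rewrite ltnS => jn; rewrite (leq_trans ij jn).
  case: ifPn => [j_n|_]; first exact: vu.
  by have [_ _] := uv i (leq_trans ij jn).
- rewrite big_ord_recr/= ltnn; under eq_bigr do rewrite ltn_ord.
  have yz_disj : G `&` `[a, y[ `&` `[y, z[ = set0.
    rewrite -subset0 => x [[_ /=]]; rewrite !in_itv/= => /andP[_ xy] /andP[yx _].
    by move: xy; rewrite ltNge yx.
  apply: (@le_trans _ _ (mu ((G `&` `[a, y[) `|` `[y, z[))).
    have -> : mu ((G `&` `[a, y[) `|` `[y, z[) = (mu (G `&` `[a, y[) + mu `[y, z[)%E.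
      by rewrite measureU//; exact: measurableI.
    by rewrite mu_itvco// EFinD leeD.
  apply: le_mu; [by apply: measurableU => //; exact: measurableI|exact: measurableI|].
  move=> x [[Ox]|]/=; rewrite !in_itv/=.
    by move=> /andP[-> /= /lt_le_trans] => h; split => //; exact: h.
  move=> /andP[yx xz]; rewrite (le_trans ay yx) xz; split => //; apply: Oyz.
  by rewrite /= in_itv/= yx (ltW xz).
- rewrite !big_ord_recr/= ltnn; under eq_bigr do rewrite ltn_ord.
  under [X in `|_| * (X + _)]eq_bigr do rewrite ltn_ord.
  have h : f z - f y <= `|f z - f y| by exact: ler_norm.
  (* A bad interval is also credited with the slope M + e, which may be negative; the term with
     [|M + e|] in the invariant compensates for this. *)
  have h2 : 0 <= (M + e) * (z - y) + `|M + e| * (z - y).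
    rewrite -mulrDl mulr_ge0 ?subr_ge0// addrC -lerBlDr sub0r.
    by rewrite -normrN ler_norm.
  have alg : forall S1 S2 k K A p q r x1 x2 x3 : R,
      q - r <= k * (x2 - x3) + (S2 + K * S1) -> p - q <= A ->
      0 <= k * (x1 - x2) + K * (x1 - x2) ->
      p - r <= k * (x1 - x3) + (S2 + A + K * (S1 + (x1 - x2))).
    by clear=> *; lra.
  exact: alg fya h h2.
Qed.

Lemma absolutely_continuousN a b f :
  absolutely_continuous_on a b f -> absolutely_continuous_on a b (\- f).
Proof.
move=> acf e /acf[dl dl0 h]; exists dl => // n u v uv tI uvdl.
have := h n u v uv tI uvdl; congr (_ < _); apply: eq_bigr => i _.
by rewrite -normrN; congr (`|_|) ; rewrite /= ; lra.
Qed.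

Lemma absolutely_continuousD a b f g :
  absolutely_continuous_on a b f -> absolutely_continuous_on a b g ->
  absolutely_continuous_on a b (f \+ g).
Proof.
move=> acf acg e e0; have e2 : 0 < e / 2 by lra.
have [d1 d10 h1] := acf _ e2; have [d2 d20 h2] := acg _ e2.
exists (Num.min d1 d2); first by rewrite lt_min d10.
move=> n u v uv tI; rewrite lt_min => /andP[l1 l2].
have k1 := h1 n u v uv tI l1; have k2 := h2 n u v uv tI l2.
apply: (@le_lt_trans _ _ (\sum_(i < n) `|f (v i) - f (u i)| + \sum_(i < n) `|g (v i) - g (u i)|)).
  rewrite -big_split/=; apply: ler_sum => i _.
  by rewrite opprD addrACA ler_normD.
by rewrite (splitr e) ltrD.
Qed.

Lemma lipschitz_absolutely_continuous a b f (K : R) : 0 <= K ->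
  (forall x y, a <= x -> x <= y -> y <= b -> `|f y - f x| <= K * (y - x)) ->
  absolutely_continuous_on a b f.
Proof.
move=> K0 lf e e0; exists (e / (K + 1)); first by rewrite divr_gt0// ltr_wpDl.
move=> n u v uv tI; rewrite ltr_pdivlMr ?ltr_wpDl// => h.
apply: (@le_lt_trans _ _ (\sum_(i < n) K * (v i - u i))).
  by apply: ler_sum => i _; have [? ? ?] := uv i; exact: lf.
rewrite -mulr_sumr; apply: le_lt_trans h; rewrite mulrC ler_wpM2l//; last by rewrite lerDl.
by apply: sumr_ge0 => i _; rewrite subr_ge0; have [] := uv i.
Qed.

Lemma absolutely_continuous_sub a b c d0 f : a <= c -> d0 <= b ->
  absolutely_continuous_on a b f -> absolutely_continuous_on c d0 f.
Proof.
move=> ac db acf e /acf[dl dl0 h]; exists dl => // n u v uv; apply: h => i.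
by have [? ? ?] := uv i; split => //; [exact: le_trans ac _|exact: le_trans db].
Qed.

Lemma bounded_integrable a b (p : R -> R) (K : R) : measurable_fun setT p ->
  (forall x, `|p x| <= K) -> mu.-integrable `[a, b] (EFin \o p).
Proof.
move=> mp pK; apply: measurable_bounded_integrable => //.
- by rewrite [X in (X < _)%E](lebesgue_measure_itv `[a, b])/=; case: ifP => _; rewrite ?ltry//
  -EFinB ltry.
- exact: measurable_funTS.
- exists K; split; first by rewrite num_real.
  by move=> M KM x _; rewrite /= (le_trans (pK x))// ltW.
Qed.

Lemma lipschitz_primitive (p : R -> R) (K : R) x y : measurable_fun setT p ->
  (forall x, `|p x| <= K) -> 0 <= x -> x <= y ->
  (\int[mu]_(u in `[0, y]) p u)%R - (\int[mu]_(u in `[0, x]) p u)%R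
   = (\int[mu]_(u in `[x, y]) p u)%R /\
  `|(\int[mu]_(u in `[x, y]) p u)%R| <= K * (y - x).
Proof.
move=> mp pK x0 xy; split.
  rewrite Rintegral_itvB ?bnd_simp//; last exact: bounded_integrable pK.
  rewrite Rintegral_itv_obnd_cbnd//.
  apply: integrableS (bounded_integrable x y mp pK) => //.
  by apply: subset_itvr; rewrite bnd_simp.
have [ip inp] : mu.-integrable `[x, y] (EFin \o p) /\ mu.-integrable `[x, y] (EFin \o (fun u =>
  `|p u|)).
  split; first exact: bounded_integrable pK.
  apply: (@bounded_integrable _ _ _ K) => [|z]; first exact: measurableT_comp.
  by rewrite normr_id.
apply: (le_trans (le_normr_Rintegral _ ip)) => //.
apply: (@le_trans _ _ (\int[mu]_(u in `[x, y]) K)%R).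
  apply: le_Rintegral => //.
  apply: (@bounded_integrable _ _ _ `|K|) => // z.
rewrite Rintegral_cst//= lebesgue_measure_itv/= lte_fin.
case: ltP => //= h; have -> : y = x by apply/le_anti; rewrite h.
by rewrite subrr.
Qed.

Lemma bounded_locally_integrable (p : R -> R) (K : R) : measurable_fun setT p ->
  (forall x, `|p x| <= K) -> locally_integrable setT p.
Proof.
move=> mp pK; split => //; first exact: openT.
move=> A _ cA.
have mA : measurable A.
  apply: closed_measurable.
  by apply: compact_closed => //; exact: Rhausdorff.
have [A0 [_ hA]] := compact_bounded cA.
have {}hA x : A x -> `|x| <= A0 + 1 by move=> Ax; apply: hA; rewrite ?ltrDl.
apply: (@le_lt_trans _ _ (\int[mu]_(x in A) K%:E)%E).
  apply: ge0_le_integral => //.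
  - by apply/measurable_EFinP/measurableT_comp => //; exact: measurable_funTS.
  - by move=> x _; rewrite lee_fin (le_trans _ (pK x)).
rewrite integral_cst//.
have muA : (mu A < +oo)%E.
  apply: (@le_lt_trans _ _ (mu `[- (A0 + 1), A0 + 1]%classic)).
    by apply: le_mu => // x Ax /=; rewrite in_itv/= -ler_norml hA.
  by rewrite lebesgue_measure_itv/=; case: ifP => _; rewrite ?ltry// -EFinB ltry.
move: muA (measure_ge0 mu A) => /=; case: (mu A) => [r| |]//= _ _.
by rewrite -EFinM ltry.
Qed.

Lemma ae_neq (c : R) : {ae mu, forall t : R, t != c}.
Proof.
exists [set c]; split; [exact: measurable_set1|exact: lebesgue_measure_set1|].
by move=> x /= /negP; rewrite negbK => /eqP.
Qed.

(** The difference of f and the primitive of p is absolutely continuous with derivative 0 almost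
    everywhere. The slope bound with M = 0, applied to it and to its opposite, makes it constant. *)
Theorem absolutely_continuous_FTC f (p : R -> R) (K : R) :
  (forall t, 0 <= t -> absolutely_continuous_on 0 t f) ->
  measurable_fun setT p -> (forall x, `|p x| <= K) ->
  {ae mu, forall t : R, 0 <= t -> derivable f t 1 /\ derive1 f t = p t} ->
  forall x y, 0 <= x -> x <= y -> f y - f x = (\int[mu]_(u in `[x, y]) p u)%R.
Proof.
move=> acf mp pK aef x y x0 xy.
have y0 := le_trans x0 xy.
pose F y := (\int[mu]_(t in `[0%R, y]) p t)%R.
have K0 : 0 <= K by apply: le_trans (pK 0).
have FE a b : 0 <= a -> a <= b -> F b - F a = (\int[mu]_(u in `[a, b]) p u)%R /\
    `|(\int[mu]_(u in `[a, b]) p u)%R| <= K * (b - a).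
  by move=> a0 ab; exact: lipschitz_primitive.
have acF : absolutely_continuous_on 0 y F.
  apply: (lipschitz_absolutely_continuous K0) => a b a0 ab _.
  by have [-> ] := FE a b a0 ab.
have aeF : {ae mu, forall t : R, 0 < t -> derivable F t 1 /\ derive1 F t = p t}.
  have := @FTC1 R p (BLeft 0) _ (bounded_locally_integrable mp pK).
  move=> /(_ (fun y => bounded_integrable 0 y mp pK)).
  move=> /ae_imp; apply => t h t0; apply: h.
  by rewrite (@lte_fin R).
have aeg : {ae mu, forall t : R, 0 <= t ->
    (derivable (f \- F) t 1 /\ derive1 (f \- F) t = 0) /\
    (derivable (F \- f) t 1 /\ derive1 (F \- f) t = 0)}.
  apply: (ae_imp2 aef (ae_imp2 aeF (ae_neq 0) (fun _ => @conj _ _))) => t h1 [h2 tn0] t0.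
  have {}t0 : 0 < t by rewrite lt_neqAle eq_sym tn0.
  have {}h1 := h1 (ltW t0).
  have [df fp] := h1; have [dF Fp] := h2 t0.
  split; split; [exact: derivableB| |exact: derivableB|];
    by rewrite derive1E deriveB// -!derive1E fp Fp subrr.
have acN g : absolutely_continuous_on 0 y g -> absolutely_continuous_on x y g.
  exact: absolutely_continuous_sub.
have [<- _] := FE x y x0 xy.
have h1 : (f \- F) y - (f \- F) x <= 0 * (y - x).
  apply: absolutely_continuous_slope_le => //.
    apply: absolutely_continuousD; first exact/acN/acf.
    exact/acN/absolutely_continuousN.
  by apply: (ae_imp aeg) => t h xt ty; have [[? ->] _] := h (le_trans x0 xt).
have h2 : (F \- f) y - (F \- f) x <= 0 * (y - x).
  apply: absolutely_continuous_slope_le => //.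
    apply: absolutely_continuousD; first exact/acN.
    exact/acN/absolutely_continuousN/acf.
  by apply: (ae_imp aeg) => t h xt ty; have [_ [? ->]] := h (le_trans x0 xt).
by move: h1 h2; rewrite /= !mul0r => h1 h2; apply/eqP; rewrite eq_le; apply/andP; split; lra.
Qed.
End AbsCont.

(** * Gaussian moments *)

Section NormalIntegral.
Import HBNNSimple.
Context {R : realType}.
Variable s : R.
Notation mu := (@lebesgue_measure R).
Notation nu := (normal_prob 0 s).
Notation pdf := (normal_pdf 0 s).
Local Open Scope ereal_scope.

Lemma measurable_EFin_pdf (D : set R) : measurable_fun D (fun x => (pdf x)%:E).
Proof. by apply/measurable_EFinP/measurable_funTS; exact: measurable_normal_pdf. Qed.

Lemma integral_normal_indic E : measurable E ->
  \int[nu]_x (\1_E x)%:E = \int[mu]_x ((\1_E x)%:E * (pdf x)%:E).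
Proof.
move=> mE; rewrite integral_indic//= setIT /normal_prob [LHS]integral_mkcond/=.
apply: eq_integral => x _; rewrite patchE indicE; case: ifPn => xE.
  by rewrite mul1e.
by rewrite mul0e.
Qed.

Lemma integral_normal_nnsfun (f : {nnsfun (measurableTypeR R) >-> R}) :
  \int[nu]_x (f x)%:E = \int[mu]_x ((f x)%:E * (pdf x)%:E).
Proof.
under [LHS]eq_integral do rewrite fimfunE -fsumEFin//.
rewrite [LHS]ge0_integral_fsum//; last 2 first.
  - by move=> r; apply/measurable_EFinP/measurable_funM => //; exact: measurable_indic.
  - by move=> n x _; rewrite EFinM nnfun_muleindic_ge0.
under [RHS]eq_integral.
  move=> x xD; rewrite fimfunE -fsumEFin// ge0_mule_fsuml; last first.
    by move=> r; rewrite EFinM nnfun_muleindic_ge0.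
  over.
rewrite [RHS]ge0_integral_fsum//; last 2 first.
  - move=> r; apply: emeasurable_funM; last exact: measurable_EFin_pdf.
    by apply/measurable_EFinP/measurable_funM => //; exact: measurable_indic.
  - move=> n x _; rewrite EFinM mule_ge0//; first by rewrite nnfun_muleindic_ge0.
    by rewrite lee_fin normal_pdf_ge0.
apply: eq_fsbigr => r rf.
have r0 : (0 <= r)%R by move: rf; rewrite inE/= => -[x _ <-].
rewrite integralZl_indic_nnsfun//= integral_normal_indic//.
under [RHS]eq_integral do rewrite EFinM -muleA.
rewrite ge0_integralZl//.
- apply: emeasurable_funM; last exact: measurable_EFin_pdf.
  exact/measurable_EFinP/measurable_indic.
- by move=> x _; rewrite mule_ge0// lee_fin// normal_pdf_ge0.
Qed.

(** Since [normal_prob] integrates its density over sets, the formula holds for simple functions and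
    passes to the limit by monotone convergence. *)
Lemma ge0_integral_normal_prob (f : measurableTypeR R -> \bar R) :
  measurable_fun setT f -> (forall x, 0 <= f x) ->
  \int[nu]_x f x = \int[mu]_x (f x * (pdf x)%:E).
Proof.
move=> mf f0.
pose f_ := nnsfun_approx measurableT mf.
transitivity (lim (\int[nu]_x (f_ n x)%:E @[n --> \oo])).
  rewrite -monotone_convergence//=.
  - apply: eq_integral => ? /[!inE] xD; apply/esym/cvg_lim => //=.
    exact: cvg_nnsfun_approx.
  - by move=> n; exact/measurable_EFinP.
  - by move=> n ? _; rewrite lee_fin.
  - by move=> ? _ ? ? mn; rewrite lee_fin; exact/lefP/nd_nnsfun_approx.
transitivity (lim (\int[mu]_x ((f_ n x)%:E * (pdf x)%:E) @[n --> \oo])); last first.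
  rewrite -monotone_convergence//=.
  - apply: eq_integral => x /[!inE] xD; apply/cvg_lim => //.
    apply: cvgeZr => //; exact: cvg_nnsfun_approx.
  - move=> n; apply: emeasurable_funM; last exact: measurable_EFin_pdf.
    exact/measurable_EFinP.
  - by move=> n x _; rewrite mule_ge0// lee_fin// normal_pdf_ge0.
  - move=> x _ ? ? mn; apply: lee_wpmul2r; first by rewrite lee_fin normal_pdf_ge0.
    by rewrite lee_fin; exact/lefP/nd_nnsfun_approx.
by apply: congr_lim; apply/funext => n /=; exact: integral_normal_nnsfun.
Qed.

Lemma integrable_normal_prob (f : R -> R) : measurable_fun setT f ->
  mu.-integrable setT (fun x => (f x * pdf x)%:E) ->
  nu.-integrable setT (EFin \o f).
Proof.
move=> mf /integrableP[_ fi]; apply/integrableP; split; first exact/measurable_EFinP.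
rewrite ge0_integral_normal_prob//; last first.
  by apply: measurableT_comp => //; exact/measurable_EFinP.
apply: le_lt_trans fi; apply: ge0_le_integral => //.
- by move=> x _; rewrite mule_ge0// lee_fin normal_pdf_ge0.
- apply: emeasurable_funM; last exact: measurable_EFin_pdf.
  by apply: measurableT_comp => //; exact/measurable_EFinP.
- apply: measurableT_comp => //; apply/measurable_EFinP; apply: measurable_funM => //.
  exact: measurable_normal_pdf.
- by move=> x _; rewrite /= normrM (ger0_norm (normal_pdf_ge0 _ _ _)) EFinM.
Qed.

Lemma Rintegral_normal_prob (f : R -> R) : measurable_fun setT f ->
  mu.-integrable setT (fun x => (f x * pdf x)%:E) ->
  (\int[nu]_x f x = \int[mu]_x (f x * pdf x))%R.
Proof.
move=> mf fi; rewrite /Rintegral; congr fine.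
rewrite [LHS]integralE [RHS]integralE.
have mEf : measurable_fun setT (EFin \o f) by exact/measurable_EFinP.
congr (_ - _).
  rewrite ge0_integral_normal_prob//; last exact: measurable_funepos.
  apply: eq_integral => x _; rewrite !funeposE/= -!EFin_max -EFinM maxr_pMl ?normal_pdf_ge0//.
  by rewrite mul0r.
rewrite ge0_integral_normal_prob//; last exact: measurable_funeneg.
apply: eq_integral => x _; rewrite !funenegE/=.
by rewrite -!EFin_max -EFinM maxr_pMl ?normal_pdf_ge0// mul0r mulNr.
Qed.

End NormalIntegral.

Section VanishingIntegral.
Context {R : realType}.
Notation mu := (@lebesgue_measure R).

(** The fundamental theorem on [-n, n] followed by dominated convergence. The Gaussian moments below
    are obtained by exhibiting integrands as exact derivatives. *)
Lemma Rintegral_derive_vanishing (G g : R -> R) :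
  (forall x : R, is_derive x (1:R) G (g x)) -> continuous g ->
  mu.-integrable setT (EFin \o g) ->
  (fun n : nat => G n%:R - G (- n%:R)) @ \oo --> (0 : R) ->
  (\int[mu]_x g x = 0)%R.
Proof.
move=> dG cg ig G0.
pose gn (n : nat) := ((EFin \o g) \_ `[- n%:R, n%:R]).
have mg : measurable_fun setT (EFin \o g) by exact: measurable_int ig.
have [] := @dominated_convergence _ _ _ mu setT measurableT gn (EFin \o g) (abse \o (EFin \o g)).
- by move=> n; apply/(measurable_restrictT _ _).1 => //; exact: measurable_funTS.
- by [].
- apply: aeW => x _; apply: cvg_near_cst.
  near=> n; rewrite /gn patchE mem_set//= in_itv/= -ler_norml.
  near: n; exact: nbhs_infty_ger.
- exact: integrable_abse.
- by apply: aeW => x n _; rewrite /gn patchE; case: ifP => //=; rewrite normr0 lee_fin.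
move=> _ _ cvgI.
have : (fun n => \int[mu]_x gn n x)%E @ \oo --> (0%R)%:E.
  apply: (@cvg_trans _ ((fun n : nat => (G n%:R - G (- n%:R))%:E) @ \oo)).
    apply: near_eq_cvg; near=> n.
    rewrite /gn -integral_mkcond (@continuous_FTC2 _ _ G)// ?EFinB//.
    - suff : (0 < n%:R :> R) by lra.
      by rewrite ltr0n; near: n; exact: nbhs_infty_gt.
    - exact: continuous_subspaceT.
    - have cG x : {for x, continuous G}.
        by apply: differentiable_continuous; apply/derivable1_diffP; case: (dG x).
      split.
      + by move=> x _; case: (dG x).
      + by apply: cvg_at_right_filter; exact: cG.
      + by apply: cvg_at_left_filter; exact: cG.
    - by move=> x _; rewrite derive1E; case: (dG x).
  by apply: cvg_EFin => //; exact: nearW.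
move/(cvg_unique (@ereal_hausdorff R))/(_ cvgI) => H.
by rewrite /Rintegral -[X in fine X]H.
Unshelve. all: by end_near.
Qed.
End VanishingIntegral.

Section NormalMoments.
Context {R : realType}.
Variable s : R.
Hypothesis s0 : 0 < s.
Notation mu := (@lebesgue_measure R).
Notation nu := (normal_prob 0 s).
Notation pdf := (normal_pdf 0 s).

Let mX k : measurable_fun setT (fun x : R => x ^+ k).
Proof. exact: measurable_funX. Qed.

Let sn0 : s != 0. Proof. by rewrite gt_eqF. Qed.

Lemma sqr_le_expR (u : R) : 0 <= u -> u ^+ 2 / 4 <= expR u.
Proof.
move=> u0; have -> : expR u = expR (u / 2) ^+ 2.
  by rewrite -expRM_natl -mulr_natl; congr expR; field.
have h := expR_ge1Dx (u / 2).
have -> : u ^+ 2 / 4 = (u / 2) ^+ 2 by field.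
by rewrite ler_sqr ?nnegrE ?divr_ge0 ?expR_ge0//; lra.
Qed.

(** With u = x^2 / (4 s^2), one factor exp (- u) absorbs x^4 and the other is, up to sqrt 2, the
    density of standard deviation sqrt 2 s. The constant is 16 · 4 · 2, from x^4 = 16 s^4 u^2, u^2
    exp (- u) <= 4 and sqrt 2 <= 2. *)
Lemma normal_pdf_pow4_le (x : R) :
  x ^+ 4 * pdf x <= 128 * s ^+ 4 * normal_pdf 0 (Num.sqrt 2 * s) x.
Proof.
have q0 : 0 < Num.sqrt 2 :> R by rewrite sqrtr_gt0.
have qq : Num.sqrt 2 ^+ 2 = 2 :> R by rewrite sqr_sqrtr.
have q2 : Num.sqrt 2 <= 2 :> R.
  by rewrite -(@ler_sqr R) ?nnegrE ?ltW// qq; lra.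
rewrite !normal_pdfE ?mulf_neq0 ?gt_eqF//.
have pk : normal_peak s = Num.sqrt 2 * normal_peak (Num.sqrt 2 * s).
  rewrite /normal_peak exprMn qq.
  have -> : 2 * s ^+ 2 * pi *+ 2 = 2 * (s ^+ 2 * pi *+ 2) :> R by ring.
  by rewrite [in RHS]sqrtrM// invfM mulrA divff ?mul1r// gt_eqF.
rewrite pk; set p := normal_peak (Num.sqrt 2 * s).
have p0 : 0 <= p by exact: normal_peak_ge0.
rewrite /normal_fun !subr0.
set u : R := x ^+ 2 / (4 * s ^+ 2).
have u0 : 0 <= u by rewrite divr_ge0 ?sqr_ge0// mulr_ge0 ?sqr_ge0.
have -> : - x ^+ 2 / (s ^+ 2 *+ 2) = - u + - u by rewrite /u; field.
have -> : - x ^+ 2 / ((Num.sqrt 2 * s) ^+ 2 *+ 2) = - u.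
  by rewrite exprMn qq /u; field.
have x4 : x ^+ 4 = 16 * s ^+ 4 * u ^+ 2 by rewrite /u; field.
rewrite expRD expRN x4.
have := sqr_le_expR u0.
have E0 : 0 < expR u by exact: expR_gt0.
have Ei : 0 < (expR u)^-1 by rewrite invr_gt0.
set E := expR u in E0 Ei *.
move=> h.
have h2 : u ^+ 2 / E <= 4 by rewrite ler_pdivrMr// mulrC; lra.
have -> : 16 * s ^+ 4 * u ^+ 2 * (Num.sqrt 2 * p * (E^-1 / E)) =
  (16 * s ^+ 4 * (p / E)) * (Num.sqrt 2 * (u ^+ 2 / E)) by ring.
have -> : 128 * s ^+ 4 * (p / E) = (16 * s ^+ 4 * (p / E)) * (2 * 4) by ring.
apply: ler_wpM2l.
  apply: mulr_ge0; first by rewrite mulr_ge0// exprn_ge0// ltW.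
  by rewrite mulr_ge0// ltW.
apply: ler_pM => //.
by rewrite divr_ge0 ?sqr_ge0// ltW.
Qed.

Lemma integrable_pow4_pdf : mu.-integrable setT (fun x => (x ^+ 4 * pdf x)%:E).
Proof.
apply: (@le_integrable _ _ _ mu setT _ _
  (fun x => (128 * s ^+ 4)%:E * (normal_pdf 0 (Num.sqrt 2 * s) x)%:E)%E) => //.
- apply/measurable_EFinP; apply: measurable_funM; last exact: measurable_normal_pdf.
  exact: measurable_funX.
- move=> x _; rewrite /= !ger0_norm ?lee_fin ?normal_pdf_pow4_le//.
    by rewrite mulr_ge0 ?normal_pdf_ge0// mulr_ge0// exprn_ge0// ltW.
  by rewrite mulr_ge0 ?normal_pdf_ge0// exprn_even_ge0.
- by apply: integrableZl => //; exact: integrable_normal_pdf.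
Qed.

Lemma integrable_growth_pdf (g : R -> R) (A : R) : measurable_fun setT g ->
  (forall x, `|g x| <= A * (1 + x ^+ 4)) ->
  mu.-integrable setT (fun x => (g x * pdf x)%:E).
Proof.
move=> mg gA.
apply: (@le_integrable _ _ _ mu setT _ _
  (fun x => A%:E * ((pdf x)%:E + (x ^+ 4 * pdf x)%:E))%E) => //.
- apply/measurable_EFinP; apply: measurable_funM => //; exact: measurable_normal_pdf.
- move=> x _; rewrite -EFinD -EFinM /= lee_fin.
  apply: le_trans (ler_norm _).
  rewrite normrM (ger0_norm (normal_pdf_ge0 _ _ _)).
  have -> : A * (pdf x + x ^+ 4 * pdf x) = A * (1 + x ^+ 4) * pdf x by ring.
  by apply: ler_wpM2r; rewrite ?normal_pdf_ge0.
- apply: integrableZl => //; apply: integrableD => //; first exact: integrable_normal_pdf.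
  exact: integrable_pow4_pdf.
Qed.

Lemma normal_integrable (g : R -> R) (A : R) : measurable_fun setT g ->
  (forall x, `|g x| <= A * (1 + x ^+ 4)) -> nu.-integrable setT (EFin \o g).
Proof.
by move=> mg gA; apply: integrable_normal_prob => //; exact: integrable_growth_pdf gA.
Qed.

Lemma normal_pow4_le : \int[nu]_x (x ^+ 4) <= 128 * s ^+ 4.
Proof.
have ip := integrable_normal_pdf (0:R) (Num.sqrt 2 * s).
rewrite (@Rintegral_normal_prob _ s _ (mX 4))//; last exact: integrable_pow4_pdf.
apply: (@le_trans _ _ (\int[mu]_x (128 * s ^+ 4 * normal_pdf 0 (Num.sqrt 2 * s) x))).
  apply: le_Rintegral => //; first exact: integrable_pow4_pdf.
    exact: integrableZ_EFin.
  by move=> x _; exact: normal_pdf_pow4_le.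
rewrite RintegralZl// /Rintegral integral_normal_pdf/= mulr1//.
Qed.

Lemma pow2_le_pow4 (x : R) : x ^+ 2 <= 1 + x ^+ 4.
Proof. by have := sqr_ge0 (x ^+ 2 - 1); rewrite -subr_ge0 => h; have := sqr_ge0 (x^+2); nra. Qed.

Lemma abs_le_pow4 (x : R) : `|x| <= 1 + x ^+ 4.
Proof.
have := pow2_le_pow4 x; have := sqr_ge0 (`|x| - 1); have := sqr_ge0 (x ^+ 2 - 1).
by rewrite -(real_normK (num_real x)); nra.
Qed.

Lemma is_derive_normal_pdf (x : R) : is_derive x (1:R) pdf (- (x / s ^+ 2) * pdf x).
Proof.
rewrite normal_pdfE//.
have h : is_derive x (1 : R) (fun y : R => - (y - 0) ^+ 2 / (s ^+ 2 *+ 2)) (- (x / s ^+ 2)).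
  apply: is_derive_eq.
  rewrite /GRing.scale/=; by field.
rewrite /normal_fun; apply: is_derive_eq.
by rewrite /GRing.scale/=; ring.
Qed.

(** As n^4 times the density at n is bounded and n (n + 1) <= 2 n^4, the sequence is O(1/n). *)
Lemma normal_pdf_vanish (c : R) : (fun n : nat => c * (n%:R * pdf n%:R)) @ \oo --> (0:R).
Proof.
have r0 : Num.sqrt 2 * s != 0 by rewrite gt_eqF// mulr_gt0// sqrtr_gt0.
pose K := 128 * s ^+ 4 * normal_peak (Num.sqrt 2 * s).
apply/norm_cvg0P.
apply: (@squeeze_cvgr _ _ _ _ (fun=> 0) (fun n => `|c| * (2 * K) * harmonic n)).
- apply: nearW => n; rewrite normr_ge0/= normrM -mulrA; apply: ler_wpM2l => //.
  rewrite ger0_norm ?mulr_ge0 ?normal_pdf_ge0// /harmonic/=.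
  rewrite ler_pdivlMr//.
  have p0 := normal_pdf_ge0 0 s (n%:R : R).
  have : n%:R ^+ 4 * pdf n%:R <= K.
    apply: (le_trans (normal_pdf_pow4_le _)); apply: ler_wpM2l.
      by rewrite mulr_ge0// exprn_ge0// ltW.
    exact: normal_pdf_ub.
  have : (n%:R * (n.+1)%:R : R) <= 2 * n%:R ^+ 4.
    case: n {p0} => [|n]; first by rewrite mul0r expr0n/= mulr0.
    have n1 : (1 : R) <= n.+1%:R by rewrite ler1n.
    rewrite -(natr1 n.+1); move: (n.+1%:R : R) n1 => a a1.
    have a3 : 1 <= a ^+ 3 by rewrite exprn_ege1.
    have -> : 2 * a ^+ 4 = a * (2 * a ^+ 3) by ring.
    have a4 : a <= a ^+ 3 by rewrite -[leLHS]expr1 ler_weXn2l.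
    by apply: ler_wpM2l; lra.
  move=> h1 h2.
  have -> : n%:R * pdf n%:R * n.+1%:R = (n%:R * n.+1%:R) * pdf n%:R by ring.
  by apply: (le_trans (ler_wpM2r p0 h1)); rewrite -mulrA ler_wpM2l.
- exact: cvg_cst.
- rewrite -[X in _ --> X](mulr0 (`|c| * (2 * K))); apply: cvgM; first exact: cvg_cst.
  exact: cvg_harmonic.
Qed.

(** x times the density is the derivative of - s^2 times the density. *)
Lemma normal_mean : \int[nu]_x x = 0.
Proof.
rewrite Rintegral_normal_prob//; last first.
  apply: (@integrable_growth_pdf _ 1) => // x; rewrite mul1r; exact: abs_le_pow4.
apply: (@Rintegral_derive_vanishing _ (fun x => - s ^+ 2 * pdf x)) => //.
- move=> x; have := is_derive_normal_pdf x => h; apply: is_derive_eq.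
  by rewrite /GRing.scale/=; field.
- by move=> x; apply: cvgM; [exact: cvg_id|exact: continuous_normal_pdf].
- apply: (@integrable_growth_pdf _ 1) => // x; rewrite mul1r; exact: abs_le_pow4.
- have pe x : pdf (- x) = pdf x by rewrite !normal_pdfE// /normal_fun !subr0 sqrrN.
  under eq_fun do rewrite pe subrr.
  exact: cvg_cst.
Qed.

(** (x^2 - s^2) times the density is the derivative of - s^2 x times the density. *)
Lemma normal_variance : \int[nu]_x (x ^+ 2) = s ^+ 2.
Proof.
have ig : mu.-integrable setT (fun x => (x ^+ 2 * pdf x)%:E).
  apply: (@integrable_growth_pdf (fun x => x ^+ 2) 1) => [|x]; first exact: measurable_funX.
  by rewrite mul1r ger0_norm ?sqr_ge0// pow2_le_pow4.
have ip := integrable_normal_pdf (0:R) s.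
rewrite (@Rintegral_normal_prob _ s _ (mX 2))//.
have : \int[mu]_x (x ^+ 2 * pdf x - s ^+ 2 * pdf x) = 0.
  apply: (@Rintegral_derive_vanishing _ (fun x => - s ^+ 2 * (x * pdf x))) => //.
  - move=> x; have := is_derive_normal_pdf x => h; apply: is_derive_eq.
    by rewrite /GRing.scale/=; field.
  - move=> x; have cp := @continuous_normal_pdf R 0 s sn0 x.
    apply: cvgB; apply: cvgM => //; [|exact: cvg_cst].
    by apply: cvgM; exact: cvg_id.
  - by apply: integrableB_EFin => //; exact: integrableZ_EFin.
  - have pe x : pdf (- x) = pdf x by rewrite !normal_pdfE// /normal_fun !subr0 sqrrN.
    have := normal_pdf_vanish (- 2 * s ^+ 2).
    apply: cvg_trans; apply: near_eq_cvg; apply: nearW => n.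
    by rewrite /= pe; ring.
rewrite RintegralB//; last exact: integrableZ_EFin.
rewrite RintegralZl// {2}/Rintegral integral_normal_pdf/= mulr1.
by move/eqP; rewrite subr_eq0 => /eqP.
Qed.

End NormalMoments.

(** * Integrals of almost everywhere equal functions and joint measurability *)

Section LowerIntegral.
Import HBNNSimple.
Context d (T : measurableType d) (R : realType) (mu : {measure set T -> \bar R}).
Local Open Scope ereal_scope.

(** The integral of a nonnegative function is a supremum over simple functions below it, so f and g
    may be non-measurable. A simple function below f is cut to 0 on the null set, which keeps its
    integral and puts it below g. *)
Lemma ae_le_lower_integral (D : set T) (f g : T -> \bar R) :
  (forall x, D x -> 0 <= f x) -> (forall x, D x -> 0 <= g x) ->
  {ae mu, forall x, D x -> f x <= g x} ->
  \int[mu]_(x in D) f x <= \int[mu]_(x in D) g x.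
Proof.
move=> f0 g0 [N [mN N0 fgN]].
rewrite integral_mkcond [leRHS]integral_mkcond.
have f0' x : 0 <= (f \_ D) x.
  by rewrite patchE; case: ifPn => // /set_mem; exact: f0.
have g0' x : 0 <= (g \_ D) x.
  by rewrite patchE; case: ifPn => // /set_mem; exact: g0.
rewrite !ge0_integralTE//; apply: ge_ereal_sup => _ [h /= hf <-].
pose h' := proj_nnsfun h (measurableC mN).
have h'E x : h' x = (h x * \1_(~` N) x)%R by rewrite /h'/= mindicE indicE.
have -> : sintegral mu h = sintegral mu h'.
  rewrite -!integralT_nnsfun; apply: ge0_ae_eq_integral => //.
  - exact/measurable_EFinP.
  - exact/measurable_EFinP.
  - by move=> x _; rewrite lee_fin.
  - by move=> x _; rewrite lee_fin.
  - exists N; split => // x /= /not_implyP[_ hx]; apply: contrapT => Nx; apply: hx.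
    by have := h'E x; rewrite indicE mem_set// mulr1 /= => ->.
apply: ereal_sup_ubound; exists h' => // x.
rewrite [X in X%:E]h'E indicE.
have [xN|xN] := boolP (x \in ~` N); last by rewrite mulr0.
rewrite mulr1; apply: (le_trans (hf x)).
rewrite /patch; case: ifPn => // /set_mem Dx.
apply: contrapT => fg; move/set_mem: xN => /= xN; apply: xN; apply: fgN => /=.
by move=> /(_ Dx).
Qed.

Lemma ae_eq_lower_integral (D : set T) (f g : T -> \bar R) :
  (forall x, D x -> 0 <= f x) -> (forall x, D x -> 0 <= g x) ->
  {ae mu, forall x, D x -> f x = g x} ->
  \int[mu]_(x in D) f x = \int[mu]_(x in D) g x.
Proof.
move=> f0 g0 fg; apply/eqP; rewrite eq_le.
by rewrite !ae_le_lower_integral//; apply: (ae_imp fg) => x xD /xD ->.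
Qed.

End LowerIntegral.

Section JointMeasurability.
Context d (T : measurableType d) (R : realType).

Lemma within_continuousP (f : R -> R) : {within `[0, +oo[, continuous f} <->
  forall t, 0 <= t -> forall e, 0 < e -> exists2 dl, 0 < dl &
    forall s, 0 <= s -> `|s - t| < dl -> `|f s - f t| < e.
Proof.
split=> [/subspace_continuousP cf t t0 e e0|cf].
  have At : `[0, +oo[%classic t by rewrite /= in_itv/= t0.
  have /cvgrPdist_lt/(_ e e0) := cf t At.
  rewrite near_withinE -nbhs_ballE => -[dl /= dl0 h]; exists dl => // s s0 st.
  rewrite distrC; apply: h; rewrite /ball/= ?in_itv/= ?s0//.
  by rewrite distrC.
apply/subspace_continuousP => t; rewrite /= in_itv/= andbT => t0.
apply/cvgrPdist_lt => e e0; have [dl dl0 h] := cf t t0 e e0.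
rewrite near_withinE -nbhs_ballE; exists dl => //= s; rewrite /ball/= => st.
by rewrite in_itv/= andbT => s0; rewrite distrC; apply: h => //; rewrite distrC.
Qed.
Lemma measurable_truncn_fiber (c : R) (k : nat) : 0 < c ->
  measurable [set t : R | Num.truncn (t * c) = k].
Proof.
move=> c0.
have mle j : measurable [set t : R | (Num.truncn (t * c) <= j)%N].
  rewrite (_ : [set _ | _] = `]-oo, (j.+1%:R / c)[%classic).
    exact: measurable_itv.
  by apply/seteqP; split => t /=; rewrite in_itv/= ltr_pdivlMr// truncn_le_nat.
case: k => [|k].
  rewrite (_ : [set _ | _] = [set t : R | (Num.truncn (t * c) <= 0)%N]); first exact: mle.
  by apply/seteqP; split => t /=; rewrite leqn0 => /eqP.
rewrite (_ : [set _ | _] = [set t : R | (Num.truncn (t * c) <= k.+1)%N] `\`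
   [set t : R | (Num.truncn (t * c) <= k)%N]); first by apply: measurableD; exact: mle.
apply/seteqP; split => t /=; first by move=> ->; split; rewrite ?ltnn.
by move=> [h1 /negP]; rewrite -ltnNge => h2; apply/eqP; rewrite eqn_leq h1.
Qed.

Lemma truncn_div_dist (t c : R) : 0 <= t -> 0 < c ->
  `|(Num.truncn (t * c))%:R / c - t| <= c^-1.
Proof.
move=> t0 c0; have /truncn_itv/andP[] : 0 <= t * c by rewrite mulr_ge0// ltW.
rewrite -natr1; move: (Num.truncn (t * c)) => k h1 h2.
rewrite distrC ger0_norm ?subr_ge0 ?ler_pdivrMr//.
rewrite -[leRHS]mul1r ler_pdivlMr// mulrBl divfK ?gt_eqF//.
by rewrite lerBlDl ltW.
Qed.

(** Freezing time at the grid point below turns Y into a countable gluing of measurable sections,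
    and continuity of the paths passes to the limit. Time is clamped at 0 because nothing is known
    of Y at negative times. *)
Lemma measurable_fun_caratheodory (Y : R -> T -> R) :
  (forall t, 0 <= t -> measurable_fun setT (Y t)) ->
  (forall w, {within `[0, +oo[, continuous (Y^~ w)}) ->
  measurable_fun setT (fun z : measurableTypeR R * T => Y (Num.max z.1 0) z.2).
Proof.
move=> mY cY.
pose tn (n : nat) (t : R) : R := (Num.truncn (t * n.+1%:R))%:R / n.+1%:R.
have tn0 n t : 0 <= tn n t by rewrite divr_ge0.
pose Yn n (z : measurableTypeR R * T) := Y (tn n z.1) z.2.
apply: (@measurable_fun_cvg _ _ _ _ Yn).
- move=> n _ B mB; rewrite setTI.
  rewrite (_ : _ @^-1` B = \bigcup_k ([set t : R | Num.truncn (t * n.+1%:R) = k] `*`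
     (Y (k%:R / n.+1%:R) @^-1` B))).
    apply: bigcup_measurable => k _; apply: measurableX; first exact: measurable_truncn_fiber.
    rewrite -[X in measurable X]setTI; apply: mY => //; exact: divr_ge0.
  apply/seteqP; split => [[t w]/= BY|[t w]/= [k _ [/= <-]]//].
  by exists (Num.truncn (t * n.+1%:R)).
- move=> [t w] _ /=; set s := Num.max t 0.
  have s0 : 0 <= s by rewrite le_max lexx orbT.
  apply/cvgrPdist_lt => e e0.
  have [dl dl0 h] := (within_continuousP _).1 (cY w) s s0 e e0.
  near=> n; rewrite distrC /Yn/=; apply: h => //.
  have n0 : (0 : R) < n.+1%:R by [].
  have dn : n.+1%:R^-1 < dl.
    by near: n; have /cvgrPdist_lt/(_ _ dl0) := @cvg_harmonic R;
       apply: filterS => n; rewrite sub0r normrN ger0_norm// /harmonic/= invr_ge0.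
  apply: le_lt_trans dn; rewrite /tn/=.
  have [t0|t0] := leP t 0.
    have -> : Num.truncn (t * n.+1%:R) = 0%N.
      by apply/eqP; rewrite -leqn0 truncn_le_nat (le_lt_trans _ (ltr01))// mulr_le0_ge0.
    by rewrite /s (max_idPr t0) mul0r subrr normr0 invr_ge0.
  rewrite /s (max_idPl (ltW t0)).
  exact: truncn_div_dist (ltW t0) n0.
Unshelve. all: by end_near.
Qed.

End JointMeasurability.

(** * Independence and Brownian increments *)

Section MfunPack.
Context d d' (T : measurableType d) (T' : measurableType d').

Definition mfun_of (f : T -> T') (mf : measurable_fun setT f) : {mfun T >-> T'} :=
  MeasurableFun.Pack (MeasurableFun.Class (isMeasurableFun.Build _ _ _ _ _ mf)).

End MfunPack.

Section Independence.
Context d (T : measurableType d) (R : realType) (Pr : probability T R).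
Variables (xi eta : T -> measurableTypeR R) (nu : probability (measurableTypeR R) R).
Hypothesis mxi : measurable_fun setT xi.
Hypothesis meta : measurable_fun setT eta.
Hypothesis indep : forall A B, measurable A -> measurable B ->
  Pr (xi @^-1` A `&` eta @^-1` B) = (Pr (xi @^-1` A) * nu B)%E.
Local Open Scope ereal_scope.

Let law : probability (measurableTypeR R) R := distribution Pr (mfun_of mxi).

Let mpair : measurable_fun setT (fun w => (xi w, eta w)).
Proof. exact: measurable_fun_pair. Qed.

Let joint := distribution Pr (mfun_of mpair).

(** Independence gives the equality on rectangles, and these determine the product measure. *)
Lemma joint_lawE (X : set (measurableTypeR R * measurableTypeR R)) :
  measurable X -> (law \x nu) X = joint X.
Proof.
move=> mX; by apply: product_measure_unique => // A B mA mB; exact: indep.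
Qed.

Lemma indep_ge0_integral (f : measurableTypeR R * measurableTypeR R -> \bar R) :
  measurable_fun setT f -> (forall z, 0 <= f z) ->
  \int[Pr]_w f (xi w, eta w) = \int[Pr]_w \int[nu]_y f (xi w, y).
Proof.
move=> mf f0.
have -> : \int[Pr]_w f (xi w, eta w) = \int[joint]_z f z.
  by rewrite [RHS](ge0_integral_pushforward mpair).
have -> : \int[joint]_z f z = \int[law \x nu]_z f z.
  by apply: eq_measure_integral => A mA _; exact/esym/joint_lawE.
rewrite fubini_tonelli1// (ge0_integral_pushforward mxi)//.
  exact: measurable_fun_fubini_tonelli_F.
by move=> x _; exact: integral_ge0.
Qed.

Lemma indep_Rintegral (g phi : measurableTypeR R -> R) (K : R) :
  measurable_fun setT g -> measurable_fun setT phi -> (forall x, `|g x| <= K)%R ->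
  nu.-integrable setT (EFin \o phi) ->
  Pr.-integrable setT (EFin \o (fun w => g (xi w) * phi (eta w))%R) /\
  (\int[Pr]_w (g (xi w) * phi (eta w)) = (\int[Pr]_w g (xi w)) * \int[nu]_y phi y)%R.
Proof.
move=> mg mphi gK phi_i.
pose f (z : measurableTypeR R * measurableTypeR R) := (g z.1 * phi z.2)%:E.
have mf : measurable_fun setT f.
  apply/measurable_EFinP; apply: measurable_funM; apply: measurableT_comp => //.
have /integrableP[_ philty] := phi_i.
have lti : \int[law]_x \int[nu]_y `|f (x, y)| < +oo.
  apply: (@le_lt_trans _ _ (\int[law]_x (K%:E * \int[nu]_y `|(phi y)%:E|))).
    apply: ge0_le_integral => //.
    - by move=> x _; exact: integral_ge0.
    - apply: (@measurable_fun_fubini_tonelli_F _ _ _ _ _ nu (abse \o f)).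
        exact: measurableT_comp.
      by move=> z; exact: abse_ge0.
    - move=> x _; rewrite -ge0_integralZl//; last 2 first.
      + by apply: measurableT_comp => //; exact/measurable_EFinP.
      + by rewrite lee_fin (le_trans _ (gK x)).
      apply: ge0_le_integral => //.
      + apply: measurableT_comp => //; apply/measurable_EFinP.
        exact: (measurable_funM (@measurable_cst _ _ _ _ setT (g x)) mphi).
      + apply: emeasurable_funM => //.
        by apply: measurableT_comp => //; exact/measurable_EFinP.
      + by move=> y _; rewrite /f/= normrM -EFinM lee_fin; exact: ler_wpM2r.
  rewrite integral_cst//= probability_setT mule1.
  have I0 : 0 <= \int[nu]_y `|(EFin \o phi) y| by exact: integral_ge0.
  move: philty I0 => /=; case: (\int[nu]_y _) => [r| |]//= _ _.
  by rewrite -EFinM ltry.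
have fi : (law \x nu).-integrable setT f by exact/integrable12ltyP.
have jointi : Pr.-integrable setT (f \o (fun w => (xi w, eta w))).
  apply/integrableP; split; first exact: measurableT_comp.
  rewrite (@indep_ge0_integral (abse \o f)); last 2 first.
  - exact: measurableT_comp.
  - by move=> z; exact: abse_ge0.
  move: lti; rewrite (ge0_integral_pushforward mxi)//.
    apply: (@measurable_fun_fubini_tonelli_F _ _ _ _ _ nu (abse \o f)).
      exact: measurableT_comp.
    by move=> z; exact: abse_ge0.
  by move=> x _; exact: integral_ge0.
split; first by [].
rewrite /Rintegral.
have -> : \int[Pr]_w (g (xi w) * phi (eta w))%:E = \int[joint]_z f z.
  by rewrite [RHS](integral_pushforward mpair).
have -> : \int[joint]_z f z = \int[law \x nu]_z f z.
  by apply: eq_measure_integral => A mA _; exact/esym/joint_lawE.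
rewrite -integral12_prod_meas1//.
have gint : law.-integrable setT (EFin \o g).
  exact: bounded_probability_integrable gK.
have phin : \int[nu]_y (phi y)%:E \is a fin_num by exact: integrable_fin_num.
rewrite (eq_integral (fun x => (g x)%:E * \int[nu]_y (phi y)%:E)); last first.
  by move=> x _; rewrite /fubini_F /f/= -integralZl.
rewrite -(fineK phin) integralZr// fineM//; last exact: integrable_fin_num.
congr (_ * _)%R.
rewrite (integral_pushforward mxi)//; first exact/measurable_EFinP.
apply: (@bounded_probability_integrable _ _ _ _ _ K) => //; exact: measurableT_comp.
Qed.
End Independence.

Section AeReal.
Context d (T : measurableType d) (R : realType) (mu : {measure set T -> \bar R}).
Implicit Types f g : T -> R.

Lemma ae_le_integrable f g : measurable_fun setT f ->
  {ae mu, forall x, `|f x| <= g x} -> mu.-integrable setT (EFin \o g) ->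
  mu.-integrable setT (EFin \o f).
Proof.
move=> mf fg /integrableP[mg gi]; apply/integrableP; split; first exact/measurable_EFinP.
apply: le_lt_trans gi; apply: ae_ge0_le_integral => //.
- by apply: measurableT_comp => //; exact/measurable_EFinP.
- exact: measurableT_comp.
- by apply: (ae_imp fg) => x fgx _; rewrite /= lee_fin (le_trans fgx)// ler_norm.
Qed.

Lemma ae_le_Rintegral f g : mu.-integrable setT (EFin \o f) ->
  mu.-integrable setT (EFin \o g) -> {ae mu, forall x, f x <= g x} ->
  \int[mu]_x f x <= \int[mu]_x g x.
Proof.
move=> fi gi fg; rewrite -subr_ge0 -RintegralB//.
have di := integrableB_EFin measurableT gi fi.
rewrite (_ : \int[mu]_x _ = \int[mu]_x `|g x - f x|); first exact: Rintegral_ge0.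
congr fine; have mE := measurable_int mu di; apply: ae_eq_integral => //.
- apply/measurable_EFinP; apply: measurableT_comp => //; exact/measurable_EFinP.
- by apply: (ae_imp fg) => x fgx _; rewrite /= ger0_norm// subr_ge0.
Qed.

Lemma ae_Rintegral_bound f g : mu.-integrable setT (EFin \o f) ->
  mu.-integrable setT (EFin \o g) -> {ae mu, forall x, `|f x| <= g x} ->
  `|\int[mu]_x f x| <= \int[mu]_x g x.
Proof.
move=> fi gi fg; apply: (le_trans (le_normr_Rintegral measurableT fi)).
apply: ae_le_Rintegral => //.
by have := integrable_abse fi; apply: eq_integrable.
Qed.

End AeReal.

(** * Filtrations as sigma-algebras on the sample space *)

Section Filtration.
Context {R : realType} {d : measure_display} {T : measurableType d}.
Implicit Types (Y P : R -> T -> R).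

Lemma natural_filtration_measurable Y t A :
  (forall s, 0 <= s -> measurable_fun setT (Y s)) ->
  natural_filtration Y t A -> measurable A.
Proof.
move=> mY; apply: smallest_sub; first exact: sigma_algebra_measurable.
move=> B [s /=]; rewrite in_itv/= => /andP[s0 _] [C mC <-].
by apply: mY.
Qed.

(** The sample space with the sigma-algebra known at time t: adaptedness becomes ordinary
    measurability, so its closure properties apply. *)
Definition filtration_type Y (t : R) :=
  g_sigma_algebraType (\bigcup_(s in `[0, t]) preimage_set_system setT (Y s) measurable).

Lemma filtration_measurableP Y t (f : T -> R) :
  (forall B : set R, measurable B -> natural_filtration Y t (f @^-1` B)) <->
  measurable_fun setT (f : filtration_type Y t -> R).
Proof.
split=> [h _ B mB|h B mB]; first by rewrite setTI; exact: h.
by have := h measurableT B mB; rewrite setTI.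
Qed.

Lemma filtration_self Y s t : 0 <= s -> s <= t ->
  measurable_fun setT (Y s : filtration_type Y t -> R).
Proof.
move=> s0 st; apply/filtration_measurableP => B mB.
apply: sub_gen_smallest; exists s; first by rewrite /= in_itv/= s0.
by exists B => //; rewrite setTI.
Qed.

(** Demand is an affine image of the noise. Through this inclusion, whatever is adapted to demand is
    independent of later Brownian increments. *)
Lemma demand_filtration (b sigma d0 : R) Y t A :
  natural_filtration (demand b sigma d0 Y) t A -> natural_filtration Y t A.
Proof.
apply: smallest_sub; first exact: smallest_sigma_algebra.
move=> B [s /=]; rewrite in_itv/= => /andP[s0 st] [C mC <-].
have : measurable_fun setT (demand b sigma d0 Y s : filtration_type Y t -> R).
  apply: measurable_funD; first exact: measurable_cst.
  apply: measurable_funM; first exact: measurable_cst.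
  exact: filtration_self.
by move=> /(_ measurableT _ mC).
Qed.

End Filtration.

Section AbsPow.
Context {R : realType}.

Lemma measurable_abs : measurable_fun setT (fun x : R => `|x|).
Proof. exact: normr_measurable. Qed.

Lemma measurable_abs3 : measurable_fun setT (fun x : R => `|x| ^+ 3).
Proof. exact: measurable_funX measurable_abs. Qed.

Lemma abs3_le_pow4 (x : R) : `|x| ^+ 3 <= 1 + x ^+ 4.
Proof.
have -> : x ^+ 4 = `|x| ^+ 4 by rewrite -normrX ger0_norm// exprn_even_ge0.
move: (`|x|) (normr_ge0 x) => y y0; have [y1|y1] := leP y 1.
  by have := exprn_ile1 3 y0 y1; have := exprn_ge0 4 y0; lra.
have : y ^+ 3 <= y ^+ 4 by rewrite ler_weXn2l// ltW.
lra.
Qed.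

End AbsPow.

Section NormalAbsMoments.
Context {R : realType}.
Variable s : R.
Hypothesis s0 : 0 < s.
Notation nu := (normal_prob 0 s).

Let mX k : measurable_fun setT (fun x : R => x ^+ k).
Proof. exact: measurable_funX. Qed.

Let iX2 : nu.-integrable setT (EFin \o (fun x => x ^+ 2)).
Proof.
apply: (@normal_integrable _ _ s0 _ 1) => // x.
by rewrite mul1r ger0_norm ?sqr_ge0// pow2_le_pow4.
Qed.

Let iX4 : nu.-integrable setT (EFin \o (fun x => x ^+ 4)).
Proof.
apply: (@normal_integrable _ _ s0 _ 1) => // x.
by rewrite mul1r ger0_norm ?exprn_even_ge0// lerDr.
Qed.

Let iabs : nu.-integrable setT (EFin \o (fun x => `|x|)).
Proof.
apply: (@normal_integrable _ _ s0 _ 1); first exact: measurable_abs.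
by move=> x; rewrite mul1r normr_id abs_le_pow4.
Qed.

Let iabs3 : nu.-integrable setT (EFin \o (fun x => `|x| ^+ 3)).
Proof.
apply: (@normal_integrable _ _ s0 _ 1); first exact: measurable_abs3.
by move=> x; rewrite mul1r ger0_norm ?exprn_ge0// abs3_le_pow4.
Qed.

Let i1 : nu.-integrable setT (EFin \o (cst (1 : R))).
Proof. by apply: (@bounded_probability_integrable _ _ _ _ _ 1) => // x; rewrite normr1. Qed.

(** Young's inequality |y| <= y^2 / (2 s) + s / 2, balanced so that both terms have mean s / 2. *)
Lemma normal_abs_le : \int[nu]_y `|y| <= s.
Proof.
apply: (@le_trans _ _ (\int[nu]_y (s^-1 / 2 * y ^+ 2 + s / 2 * 1))).
  apply: le_Rintegral => //.
    by apply: integrableD_EFin => //; exact: integrableZ_EFin.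
  move=> x _; rewrite -(real_normK (num_real x)).
  rewrite -subr_ge0.
  have -> : s^-1 / 2 * `|x| ^+ 2 + s / 2 * 1 - `|x| = (`|x| - s) ^+ 2 * (s^-1 / 2).
    by field; rewrite gt_eqF.
  by rewrite mulr_ge0 ?sqr_ge0// divr_ge0// invr_ge0 ltW.
rewrite RintegralD//; [|exact: integrableZ_EFin|exact: integrableZ_EFin].
rewrite !RintegralZl//= (normal_variance s0) Rintegral_cst//= probability_setT.
by rewrite le_eqVlt; apply/orP; left; apply/eqP; rewrite /=; field; rewrite gt_eqF.
Qed.

(** From |y|^3 <= s y^2 / 2 + y^4 / (2 s) and the crude fourth moment 128 s^4 one gets (1/2 + 64)
    s^3. *)
Lemma normal_abs3_le : \int[nu]_y (`|y| ^+ 3) <= 65 * s ^+ 3.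
Proof.
apply: (@le_trans _ _ (\int[nu]_y (s / 2 * y ^+ 2 + s^-1 / 2 * y ^+ 4))).
  apply: le_Rintegral => //.
    by apply: integrableD_EFin => //; exact: integrableZ_EFin.
  move=> x _; rewrite -(real_normK (num_real x)).
  have -> : x ^+ 4 = `|x| ^+ 4 by rewrite -normrX ger0_norm// exprn_even_ge0.
  rewrite -subr_ge0.
  have -> : s / 2 * `|x| ^+ 2 + s^-1 / 2 * `|x| ^+ 4 - `|x| ^+ 3 =
     (`|x| - s) ^+ 2 * (`|x| ^+ 2 * (s^-1 / 2)).
    by field; rewrite gt_eqF.
  rewrite mulr_ge0 ?sqr_ge0// mulr_ge0 ?sqr_ge0// divr_ge0// invr_ge0 ltW//.
rewrite RintegralD//; [|exact: integrableZ_EFin|exact: integrableZ_EFin].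
rewrite !RintegralZl//= (normal_variance s0).
have h4 := normal_pow4_le s0.
have si : 0 <= s^-1 / 2 by rewrite divr_ge0// invr_ge0 ltW.
apply: (@le_trans _ _ (s / 2 * s ^+ 2 + s^-1 / 2 * (128 * s ^+ 4))).
  by rewrite lerD2l; exact: ler_wpM2l.
have -> : s / 2 * s ^+ 2 + s^-1 / 2 * (128 * s ^+ 4) = (1/2 + 64) * s ^+ 3.
  by field; rewrite gt_eqF.
by rewrite ler_wpM2r ?exprn_ge0 ?ltW//; lra.
Qed.

End NormalAbsMoments.

Section BrownianStep.
Context {R : realType} {d : measure_display} {T : measurableType d}.
Variables (Pr : probability T R) (W : R -> T -> R).
Hypothesis hW : standard_brownian_motion Pr W.

Lemma increment_measurable s t : 0 <= s -> 0 <= t -> measurable_fun setT (increment W s t).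
Proof. by move=> s0 t0; apply: measurable_funB; exact: bm_measurable hW _ _. Qed.

Section Step.
Variables (t h : R) (xi : T -> R).
Hypotheses (t0 : 0 <= t) (h0 : 0 < h).
Hypothesis xiF : forall B : set R, measurable B -> natural_filtration W t (xi @^-1` B).
Let eta := increment W t (t + h).
Let r := Num.sqrt h.
Let th0 : 0 <= t + h. Proof. by rewrite addr_ge0// ltW. Qed.
Let r0 : 0 < r. Proof. by rewrite sqrtr_gt0. Qed.
Let rr : r ^+ 2 = h. Proof. by rewrite sqr_sqrtr// ltW. Qed.

Lemma step_measurable : measurable_fun setT xi.
Proof.
move=> _ B mB; rewrite setTI; apply: natural_filtration_measurable (xiF mB).
exact: bm_measurable hW.
Qed.

Lemma step_indep A B : measurable A -> measurable B ->
  Pr (xi @^-1` A `&` eta @^-1` B) = (Pr (xi @^-1` A) * normal_prob 0 r B)%E.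
Proof.
move=> mA mB; have tth : t < t + h by rewrite ltrDl.
rewrite (bm_independent hW t0 tth (xiF mA) mB) (bm_gaussian hW t0 tth mB).
by rewrite addrC addKr.
Qed.

Lemma step_expect (g phi : R -> R) (K A : R) :
  measurable_fun setT g -> measurable_fun setT phi -> (forall x, `|g x| <= K) ->
  (forall x, `|phi x| <= A * (1 + x ^+ 4)) ->
  Pr.-integrable setT (EFin \o (fun w => g (xi w) * phi (eta w))) /\
  \int[Pr]_w (g (xi w) * phi (eta w)) =
    (\int[Pr]_w g (xi w)) * \int[normal_prob 0 r]_y phi y.
Proof.
move=> mg mphi gK phiA.
apply: (@indep_Rintegral _ _ _ Pr xi eta (normal_prob 0 r) _ _ _ g phi K) => //.
- exact: step_measurable.
- exact: increment_measurable.
- exact: step_indep.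
- exact: normal_integrable phiA.
Qed.

Lemma step_expect1 (phi : R -> R) (A : R) :
  measurable_fun setT phi -> (forall x, `|phi x| <= A * (1 + x ^+ 4)) ->
  Pr.-integrable setT (EFin \o (fun w => phi (eta w))) /\
  \int[Pr]_w (phi (eta w)) = \int[normal_prob 0 r]_y phi y.
Proof.
move=> mphi phiA.
have [] := @step_expect (cst 1) phi 1 A (measurable_cst _) mphi _ phiA.
  by move=> x; rewrite normr1.
under [X in EFin \o X]eq_fun do rewrite mul1r.
rewrite /cst; under eq_Rintegral do rewrite mul1r.
by rewrite Rintegral_cst//= probability_setT !mul1r => ? ->.
Qed.

Lemma step_mean (g : R -> R) (K : R) : measurable_fun setT g -> (forall x, `|g x| <= K) ->
  Pr.-integrable setT (EFin \o (fun w => g (xi w) * eta w)) /\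
  \int[Pr]_w (g (xi w) * eta w) = 0.
Proof.
move=> mg gK; have [] := @step_expect g id K 1 mg (@measurable_id _ _ _) gK.
  by move=> x; rewrite mul1r; exact: abs_le_pow4.
by rewrite (normal_mean r0) mulr0.
Qed.

Lemma step_variance (g : R -> R) (K : R) : measurable_fun setT g -> (forall x, `|g x| <= K) ->
  Pr.-integrable setT (EFin \o (fun w => g (xi w) * eta w ^+ 2)) /\
  \int[Pr]_w (g (xi w) * eta w ^+ 2) = h * \int[Pr]_w g (xi w).
Proof.
move=> mg gK; have [] := @step_expect g (fun x => x ^+ 2) K 1 mg _ gK.
- exact: measurable_funX.
- by move=> x; rewrite mul1r ger0_norm ?sqr_ge0// pow2_le_pow4.
by rewrite (normal_variance r0) rr => ? ->; split=> //; rewrite mulrC.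
Qed.

Lemma step_abs : Pr.-integrable setT (EFin \o (fun w => `|eta w|)) /\
  \int[Pr]_w `|eta w| <= r.
Proof.
have [|i1 ->] := @step_expect1 (fun x => `|x|) 1 measurable_abs.
  by move=> x; rewrite mul1r normr_id abs_le_pow4.
by split => //; exact: normal_abs_le.
Qed.

Lemma step_abs3 : Pr.-integrable setT (EFin \o (fun w => `|eta w| ^+ 3)) /\
  \int[Pr]_w (`|eta w| ^+ 3) <= 65 * (r * h).
Proof.
have [|i1 ->] := @step_expect1 (fun x => `|x| ^+ 3) 1 measurable_abs3.
  by move=> x; rewrite mul1r ger0_norm ?exprn_ge0// abs3_le_pow4.
by split => //; rewrite -[X in r * X]rr -exprS; exact: normal_abs3_le.
Qed.

End Step.
End BrownianStep.

(** * One-step expansion along a controlled path *)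

Section FubiniBounded.
Context {R : realType} {d : measure_display} {T : measurableType d}.
Variable Pr : probability T R.
Notation mu := (@lebesgue_measure R).

Lemma section_measurable (f : measurableTypeR R * T -> R) s :
  measurable_fun setT f -> measurable_fun setT (fun w => f (s, w)).
Proof. by move=> mf; apply: (measurableT_comp mf); exact: measurable_fun_pair. Qed.

Lemma expect_measurable (f : measurableTypeR R * T -> R) :
  measurable_fun setT f -> (forall z, 0 <= f z) ->
  measurable_fun setT (fun s : R => \int[Pr]_w f (s, w)).
Proof.
move=> mf f0; apply: (measurableT_comp (fine_measurable measurableT)) => //.
apply: (@measurable_fun_fubini_tonelli_F _ _ (measurableTypeR R) T R Pr (EFin \o f)).
  exact/measurable_EFinP.
by move=> z; rewrite lee_fin.
Qed.

Lemma expect_bounded_measurable (f : measurableTypeR R * T -> R) M :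
  measurable_fun setT f -> (forall z, `|f z| <= M) ->
  measurable_fun setT (fun s : R => \int[Pr]_w f (s, w)) /\
  forall s, `|\int[Pr]_w f (s, w)| <= M.
Proof.
move=> mf fM.
have bi (g : T -> R) : measurable_fun setT g -> (forall w, `|g w| <= M) ->
    Pr.-integrable setT (EFin \o g).
  by move=> mg gM; exact: bounded_probability_integrable gM.
have ic := probability_cst_integrable Pr.
have mfs s := section_measurable s mf.
split; last first.
  move=> s; rewrite -[leRHS](Rintegral_probability_cst Pr M).
  by apply: ae_Rintegral_bound => //; [exact: bi|exact: aeW].
(* Shifting by M reduces the claim to a nonnegative integrand, to which Tonelli's theorem
   applies. *)
rewrite (_ : (fun s => _) = (fun s => \int[Pr]_w (f (s, w) + M) - M)).
  apply: measurable_funB => //.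
  apply: (@expect_measurable (fun z => f z + M)); first exact: measurable_funD.
  by move=> z; have := fM z; rewrite ler_norml -lerBlDr sub0r => /andP[].
apply/funext => s; rewrite RintegralD//; last exact: bi.
by rewrite Rintegral_probability_cst addrK.
Qed.

Lemma Rintegral_swap (f : measurableTypeR R * T -> R) (M a c : R) :
  measurable_fun setT f -> (forall z, `|f z| <= M) ->
  measurable_fun setT (fun w => \int[mu]_(s in `[a, c]) f (s, w))%R /\
  \int[Pr]_w (\int[mu]_(s in `[a, c]) f (s, w))%R =
  (\int[mu]_(s in `[a, c]) (\int[Pr]_w f (s, w)))%R.
Proof.
move=> mf fM.
have M0 : 0 <= M by apply: le_trans (fM (0, point)).
(* The time interval is encoded by an indicator, so that Fubini's theorem is applied on the whole
   product space. *)
pose g (z : measurableTypeR R * T) : R := \1_(`[a, c]%classic) z.1 * f z.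
have mg : measurable_fun setT g.
  apply: measurable_funM => //.
  apply: (@measurableT_comp _ _ _ _ _ _ (\1_(`[a, c]%classic) : measurableTypeR R -> R) _ fst).
    exact: measurable_indic.
  exact: measurable_fst.
have muac : (mu `[a, c]%classic < +oo)%E.
  rewrite [X in (X < _)%E](lebesgue_measure_itv `[a, c])/=.
  by case: ifP => _; rewrite ?ltry// -EFinB ltry.
have gi : (mu \x Pr)%E.-integrable setT (EFin \o g).
  apply/integrable12ltyP; first exact/measurable_EFinP.
  apply: (@le_lt_trans _ _ (\int[mu]_s (\1_(`[a, c]%classic) s * M)%:E)%E).
    apply: ge0_le_integral => //.
    - by move=> x _; exact: integral_ge0.
    - apply: (@measurable_fun_fubini_tonelli_F _ _ _ _ _ Pr (abse \o (EFin \o g))).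
        by apply: measurableT_comp => //; exact/measurable_EFinP.
      by move=> z; exact: abse_ge0.
    - by apply/measurable_EFinP; apply: measurable_funM => //; exact: measurable_indic.
    - move=> s _; rewrite -[leRHS]mule1 -(@probability_setT _ _ _ Pr) -integral_cst//.
      apply: ge0_le_integral => //.
      + by apply: measurableT_comp => //; apply/measurable_EFinP; exact: section_measurable.
      + by move=> w _; rewrite lee_fin /g/= normrM ger0_norm ?indicE ?ler0n// ler_wpM2l.
  under eq_integral do rewrite EFinM.
  rewrite ge0_integralZr//; [|exact/measurable_EFinP/measurable_indic].
  rewrite integral_indic// setIT.
  by rewrite muleC; apply: lte_mul_pinfty => //; rewrite lee_fin.
have /= F := Fubini gi.
have inner1 s : (\int[Pr]_w (g (s, w))%:E = (\1_(`[a, c]%classic) s * \int[Pr]_w f (s, w))%:E)%E.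
  have fi : Pr.-integrable setT (EFin \o (fun w => f (s, w))).
    by apply: (@bounded_probability_integrable _ _ _ _ _ M) => //; exact: section_measurable.
  rewrite /g/= -[LHS]fineK; last first.
    by apply: integrable_fin_num => //; exact: integrableZ_EFin.
  by congr EFin; rewrite -RintegralZl.
have inner2 w : (\int[mu]_s (g (s, w))%:E = (\int[mu]_(s in `[a, c]) f (s, w))%:E)%E.
  have fi : mu.-integrable `[a, c] (EFin \o (fun s => f (s, w))).
    apply: (@bounded_integrable _ _ _ _ M) => //.
    by apply: (measurableT_comp mf); exact: measurable_fun_pair.
  rewrite fineK; last exact: integrable_fin_num.
  rewrite [RHS]integral_mkcond; apply: eq_integral => s _.
  by rewrite patchE /g/= indicE; case: ifPn => _; rewrite ?mul1r ?mul0r.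
split.
  apply/measurable_EFinP; have /= := measurable_fubini_G gi.
  by congr (measurable_fun _ _); apply/funext => w; rewrite /fubini_G/= inner2.
rewrite {1}/Rintegral; under eq_integral do rewrite -inner2.
rewrite -F; under eq_integral do rewrite inner1.
rewrite /Rintegral; congr fine; rewrite [RHS]integral_mkcond; apply: eq_integral => s _.
by rewrite patchE indicE; case: ifPn => _; rewrite ?mul1r ?mul0r.
Qed.

End FubiniBounded.

Section ControlledProcess.
Context {R : realType} {d : measure_display} {T : measurableType d}.
Variables (Pr : probability T R) (W : R -> T -> R).
Hypothesis hW : standard_brownian_motion Pr W.
Variables (b sigma d0 p0 K0 : R).
Hypotheses (sigma0 : 0 < sigma) (K00 : 0 <= K0).
Variable P : R -> T -> R.
Variable p : measurableTypeR R * T -> R.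
Hypothesis P0 : forall w, P 0 w = p0.
Hypothesis adP : forall t, 0 <= t -> forall B : set R, measurable B ->
  natural_filtration W t (P t @^-1` B).
Hypothesis cP : forall w, {within `[0, +oo[, continuous (P^~ w)}.
Hypothesis mp : measurable_fun setT p.
Hypothesis pK : forall z, `|p z| <= K0.
Hypothesis Pp : {ae Pr, forall w, forall s t, 0 <= s -> s <= t ->
  P t w - P s w = (\int[lebesgue_measure]_(u in `[s, t]) p (u, w))%R}.

Let D := demand b sigma d0 W.
Let X t w := P t w - D t w.
Let K := K0 + `|b|.
Let K_ge0 : 0 <= K. Proof. by rewrite addr_ge0. Qed.

Lemma state_adapted t : 0 <= t -> forall B : set R, measurable B ->
  natural_filtration W t (X t @^-1` B).
Proof.
move=> t0; apply/filtration_measurableP; apply: measurable_funB.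
  by apply/filtration_measurableP; exact: adP.
apply: measurable_funD; first exact: measurable_cst.
apply: measurable_funM; first exact: measurable_cst.
exact: filtration_self.
Qed.

Lemma state_measurable t : 0 <= t -> measurable_fun setT (X t).
Proof.
move=> t0 _ B mB; rewrite setTI.
by apply: (natural_filtration_measurable _ (state_adapted t0 mB)); exact: bm_measurable hW.
Qed.

Lemma capacity_measurable t : 0 <= t -> measurable_fun setT (P t).
Proof.
move=> t0 _ B mB; rewrite setTI.
by apply: (natural_filtration_measurable _ (adP t0 mB)); exact: bm_measurable hW.
Qed.

Lemma state_continuous w : {within `[0, +oo[, continuous (X^~ w)}.
Proof.
move=> x; apply: (@continuousB _ _ _ (P^~ w : subspace _ -> R)); first exact: cP.
apply: continuousD.
  apply: continuousD; first exact: cst_continuous.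
  by apply: continuousM; [exact: cst_continuous|apply: continuous_subspaceT => ?; exact: cvg_id].
by apply: continuousM; [exact: cst_continuous|exact: (bm_continuous hW)].
Qed.

Let pw_measurable w : measurable_fun setT (fun u : R => p (u, w)).
Proof. by apply: (measurableT_comp mp); exact: measurable_fun_pair. Qed.

Lemma capacity_increment : {ae Pr, forall w, forall s t, 0 <= s -> s <= t ->
  `|P t w - P s w| <= K0 * (t - s)}.
Proof.
apply: (ae_imp Pp) => w h s t s0 st; rewrite h//.
by have [] := lipschitz_primitive (pw_measurable w) (fun u => pK (u, w)) s0 st.
Qed.

Lemma stateB s t w : X t w - X s w =
  (P t w - P s w - b * (t - s)) - sigma * increment W s t w.
Proof. by rewrite /X /D /demand /increment; ring. Qed.

Lemma state_increment : {ae Pr, forall w, forall s t, 0 <= s -> s <= t ->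
  `|P t w - P s w - b * (t - s)| <= K * (t - s)}.
Proof.
apply: (ae_imp capacity_increment) => w h s t s0 st.
rewrite (le_trans (ler_normB _ _))// mulrDl lerD ?h// normrM.
by rewrite (ger0_norm (x := t - s)) ?subr_ge0.
Qed.

Lemma state_increment_abs t h : 0 <= t -> 0 < h ->
  Pr.-integrable setT (EFin \o (fun w => `|X (t + h) w - X t w|)) /\
  \int[Pr]_w `|X (t + h) w - X t w| <= K * h + sigma * Num.sqrt h.
Proof.
move=> t0 h0.
have th0 : 0 <= t + h by rewrite addr_ge0// ltW.
have [i1 l1] := step_abs hW t0 h0 (state_adapted t0).
have ic := probability_cst_integrable Pr.
have ig : Pr.-integrable setT (EFin \o (fun w => K * h + sigma * `|increment W t (t + h) w|)).
  by integrability; exact: ic.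
have le : {ae Pr, forall w, `| `|X (t + h) w - X t w| | <= K * h + sigma * `|increment W t (t +
  h) w|}.
  apply: (ae_imp state_increment) => w /(_ t (t + h) t0); rewrite lerDl ltW// => /(_ isT) ha.
  rewrite normr_id stateB (le_trans (ler_normB _ _))// normrM (ger0_norm (ltW sigma0)) lerD2r.
  by move: ha; rewrite (addrC t) addrK.
have mX : measurable_fun setT (fun w => `|X (t + h) w - X t w|).
  apply: measurableT_comp => //; apply: measurable_funB; exact: state_measurable.
have i2 := ae_le_integrable mX le ig.
split => //.
apply: (@le_trans _ _ (\int[Pr]_w (K * h + sigma * `|increment W t (t + h) w|))).
  by apply: ae_le_Rintegral => //; apply: (ae_imp le) => w; rewrite normr_id.
rewrite RintegralD//; last exact: integrableZ_EFin.
by rewrite Rintegral_probability_cst RintegralZl//; apply: lerD => //; apply: ler_wpM2l => //;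
  exact: ltW.
Qed.

Section TestFunction.
Variables (V v v2 : R -> R) (L : R).
Hypothesis L0 : 0 <= L.
Hypotheses (mV : measurable_fun setT V) (mv : measurable_fun setT v) (mv2 : measurable_fun setT v2).
Hypotheses (vL : forall x, `|v x| <= L) (v2L : forall x, `|v2 x| <= L).
Hypothesis lipV : forall x y, `|V y - V x| <= L * `|y - x|.
Hypothesis jetV : forall x y,
  `|V y - V x - v x * (y - x) - v2 x / 2 * (y - x) ^+ 2| <= L * `|y - x| ^+ 3.

Lemma comp_state_measurable (g : R -> R) t : measurable_fun setT g -> 0 <= t ->
  measurable_fun setT (fun w => g (X t w)).
Proof. by move=> mg t0; apply: (measurableT_comp mg); exact: state_measurable. Qed.

Lemma lipschitz_state_integrable (g : R -> R) (M : R) t : measurable_fun setT g ->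
  (forall x y, `|g y - g x| <= M * `|y - x|) -> 0 <= t ->
  Pr.-integrable setT (EFin \o (fun w => g (X t w))) /\
  `|\int[Pr]_w g (X t w)| <= `|g (p0 - d0)| + M * (K * t + sigma * Num.sqrt t).
Proof.
move=> mg gM; rewrite le_eqVlt => /predU1P[<-|t0].
  have X0 w : X 0 w = p0 - d0.
    by rewrite /X P0 /D /demand mulr0 (bm_start hW) mulr0 !addr0.
  under [X in EFin \o X]eq_fun do rewrite X0.
  under eq_Rintegral do rewrite X0.
  split; first by apply: (@bounded_probability_integrable _ _ _ _ _ `|g (p0 - d0)|).
  by rewrite Rintegral_probability_cst sqrtr0 !mulr0 addr0 mulr0 addr0.
have M0 : 0 <= M by have := gM 0 1; rewrite subr0 normr1 mulr1; exact: le_trans.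
have [] := state_increment_abs (lexx 0) t0; rewrite add0r => i1 l1.
have ic := probability_cst_integrable Pr.
have X0 w : X 0 w = p0 - d0.
  by rewrite /X P0 /D /demand mulr0 (bm_start hW) mulr0 !addr0.
have ig : Pr.-integrable setT (EFin \o (fun w => `|g (p0 - d0)| + M * `|X t w - X 0 w|)).
  by integrability; exact: ic.
have le w : `|g (X t w)| <= `|g (p0 - d0)| + M * `|X t w - X 0 w|.
  by rewrite -lerBlDl (le_trans (lerB_dist _ _))// -(X0 w).
have i2 : Pr.-integrable setT (EFin \o (fun w => g (X t w))).
  apply: (ae_le_integrable _ _ ig); last exact: aeW.
  by apply: comp_state_measurable => //; exact: ltW.
split => //.
apply: (le_trans (ae_Rintegral_bound i2 ig (aeW _ le))).
rewrite RintegralD//; last exact: integrableZ_EFin.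
by rewrite RintegralZl// Rintegral_probability_cst lerD2l ler_wpM2l.
Qed.

(** The state increment is a - sigma y with |a| <= K h. The terms kept on the left are those whose
    expectation is computed or kept exactly; g2 (a^2 / 2 - sigma a y) and the cubic remainder go to
    the right, using (A + B)^3 <= 4 (A^3 + B^3). *)
Lemma taylor_path_bound (V1 V0 g g2 x0 x1 y dP : R) (h : R) :
  `|g2| <= L ->
  `|V1 - V0 - g * (x1 - x0) - g2 / 2 * (x1 - x0) ^+ 2| <= L * `|x1 - x0| ^+ 3 ->
  x1 - x0 = dP - b * h - sigma * y -> `|dP - b * h| <= K * h ->
  `|V1 - V0 - g * dP + (b * h * g + (sigma * (g * y) - sigma ^+ 2 / 2 * (g2 * y ^+ 2)))|
  <= L * (4 * K ^+ 3 * h ^+ 3 + K ^+ 2 * h ^+ 2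
      + (4 * sigma ^+ 3 * `|y| ^+ 3 + 2 * sigma * K * h * `|y|)).
Proof.
move=> g2L + xE; rewrite xE => jet.
set a := dP - b * h => aK.
have A0 : 0 <= K * h by apply: le_trans aK.
have -> : V1 - V0 - g * dP + (b * h * g + (sigma * (g * y) - sigma ^+ 2 / 2 * (g2 * y ^+ 2))) =
  (V1 - V0 - g * (a - sigma * y) - g2 / 2 * (a - sigma * y) ^+ 2)
    + (g2 * (a ^+ 2 / 2 - sigma * (a * y))) by rewrite /a; field.
have sy0 : 0 <= sigma * `|y| by rewrite mulr_ge0// ltW.
have ay : `|a - sigma * y| <= K * h + sigma * `|y|.
  by rewrite (le_trans (ler_normB _ _))// lerD// normrM (ger0_norm (ltW sigma0)).
have cube (A B : R) : 0 <= A -> 0 <= B -> (A + B) ^+ 3 <= 4 * (A ^+ 3 + B ^+ 3).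
  move=> A1 B1; rewrite -subr_ge0.
  have -> : 4 * (A ^+ 3 + B ^+ 3) - (A + B) ^+ 3 = 3 * ((A - B) ^+ 2 * (A + B)) by ring.
  by apply: mulr_ge0 => //; apply: mulr_ge0; rewrite ?sqr_ge0// addr_ge0.
have J : `|a - sigma * y| ^+ 3 <= 4 * ((K * h) ^+ 3 + (sigma * `|y|) ^+ 3).
  by apply: le_trans (cube _ _ A0 sy0); apply: lerXn2r; rewrite ?nnegrE// addr_ge0.
have a2 : `|a ^+ 2 / 2 - sigma * (a * y)| <= (K * h) ^+ 2 / 2 + sigma * (K * h * `|y|).
  rewrite (le_trans (ler_normB _ _))// lerD//.
    rewrite normrM normrX (ger0_norm (x := 2^-1))//; apply: ler_wpM2r => //.
    by apply: lerXn2r; rewrite ?nnegrE.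
  rewrite normrM (ger0_norm (ltW sigma0)); apply: ler_wpM2l; first exact: ltW.
  by rewrite normrM; apply: ler_wpM2r.
apply: (le_trans (ler_normD _ _)).
apply: (@le_trans _ _ (L * (4 * ((K * h) ^+ 3 + (sigma * `|y|) ^+ 3)) +
   L * ((K * h) ^+ 2 / 2 + sigma * (K * h * `|y|)))).
  apply: lerD; first by apply: (le_trans jet); exact: ler_wpM2l.
  by rewrite normrM; apply: ler_pM.
rewrite -mulrDr; apply: ler_wpM2l => //; rewrite -subr_ge0.
have -> : 4 * K ^+ 3 * h ^+ 3 + K ^+ 2 * h ^+ 2
      + (4 * sigma ^+ 3 * `|y| ^+ 3 + 2 * sigma * K * h * `|y|) -
  (4 * ((K * h) ^+ 3 + (sigma * `|y|) ^+ 3) + ((K * h) ^+ 2 / 2 + sigma * (K * h * `|y|))) =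
  (K * h) ^+ 2 / 2 + (sigma * `|y|) * (K * h) by field.
by apply: addr_ge0; apply: mulr_ge0 => //; exact: exprn_ge0.
Qed.

(** Expectation of the pathwise bound for h <= 1, where h^3 and h^2 are at most h sqrt h, E |y|^3 <=
    65 h sqrt h and E |y| <= sqrt h. *)
Definition taylor_const : R :=
  L * (4 * (K ^+ 3 + 65 * sigma ^+ 3) + (K ^+ 2 + 2 * sigma * K)).

(** Independence removes the term linear in the noise and replaces its square by h. The product of v
    (X t) with the increment of P stays whole, because that increment may depend on the noise of the
    step. *)
Lemma state_taylor t h : 0 <= t -> 0 < h -> h <= 1 ->
  `|\int[Pr]_w V (X (t + h) w) - \int[Pr]_w V (X t w)
    - \int[Pr]_w (v (X t w) * (P (t + h) w - P t w))
    + b * h * \int[Pr]_w v (X t w) - sigma ^+ 2 / 2 * h * \int[Pr]_w v2 (X t w)|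
  <= taylor_const * (h * Num.sqrt h).
Proof.
move=> t0 h0 h1; have th0 : 0 <= t + h by rewrite addr_ge0// ltW.
have tth : t <= t + h by rewrite lerDl ltW.
pose eta := increment W t (t + h).
have xiF := state_adapted t0.
have [iVY _] := lipschitz_state_integrable mV lipV th0.
have [iVX _] := lipschitz_state_integrable mV lipV t0.
have iv : Pr.-integrable setT (EFin \o (fun w => v (X t w))).
  by apply: (@bounded_probability_integrable _ _ _ _ _ L) => //; exact: comp_state_measurable.
have iv2 : Pr.-integrable setT (EFin \o (fun w => v2 (X t w))).
  by apply: (@bounded_probability_integrable _ _ _ _ _ L) => //; exact: comp_state_measurable.
have ic := probability_cst_integrable Pr.
have iP : Pr.-integrable setT (EFin \o (fun w => v (X t w) * (P (t + h) w - P t w))).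
  apply: (ae_le_integrable _ _ (ic (L * (K0 * h)))).
    apply: measurable_funM; first exact: comp_state_measurable.
    by apply: measurable_funB; exact: capacity_measurable.
  apply: (ae_imp capacity_increment) => w /(_ t (t + h) t0 tth); rewrite (addrC t) addrK => hw.
  by rewrite normrM ler_pM.
have [ivn vn0] := step_mean hW t0 h0 xiF mv vL.
have [iv2n v2n0] := step_variance hW t0 h0 xiF mv2 v2L.
have [ia la] := step_abs hW t0 h0 xiF.
have [ia3 la3] := step_abs3 hW t0 h0 xiF.
pose Z w := (V (X (t + h) w) - V (X t w) - v (X t w) * (P (t + h) w - P t w))
   + (b * h * v (X t w) + (sigma * (v (X t w) * eta w)
     - sigma ^+ 2 / 2 * (v2 (X t w) * eta w ^+ 2))).
have iZ : Pr.-integrable setT (EFin \o Z).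
   by rewrite /Z; integrability.
have EZ : \int[Pr]_w Z w = \int[Pr]_w V (X (t + h) w) - \int[Pr]_w V (X t w)
    - \int[Pr]_w (v (X t w) * (P (t + h) w - P t w))
    + b * h * \int[Pr]_w v (X t w) - sigma ^+ 2 / 2 * h * \int[Pr]_w v2 (X t w).
  rewrite /Z RintegralD//; try by integrability.
  rewrite RintegralB//; try by integrability.
  rewrite RintegralB//.
  rewrite RintegralD//; try by integrability.
  rewrite RintegralB//; try by integrability.
  rewrite !RintegralZl// vn0 v2n0.
  by ring.
pose Q w := L * ((4 * K ^+ 3 * h ^+ 3 + K ^+ 2 * h ^+ 2) * 1
    + (4 * sigma ^+ 3 * `|eta w| ^+ 3 + 2 * sigma * K * h * `|eta w|)).
have i1 := ic 1.
have iQ : Pr.-integrable setT (EFin \o Q) by rewrite /Q; integrability.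
have ZQ : {ae Pr, forall w, `|Z w| <= Q w}.
  apply: (ae_imp state_increment) => w /(_ t (t + h) t0 tth).
  have := stateB t (t + h) w; rewrite (addrC t) addrK (addrC h) -/eta.
  rewrite /Z /Q mulr1.
  have := jetV (X t w) (X (t + h) w); have := v2L (X t w).
  by move=> h2 h3 h4 h5; exact: taylor_path_bound h3 h4 h5.
rewrite -EZ (le_trans (ae_Rintegral_bound iZ iQ ZQ))//.
rewrite /Q RintegralZl//; try by integrability.
rewrite RintegralD//; try by integrability.
rewrite RintegralD//; try by integrability.
rewrite !RintegralZl// Rintegral_probability_cst mulr1.
have r0 : 0 < Num.sqrt h by rewrite sqrtr_gt0.
have rr : Num.sqrt h ^+ 2 = h by rewrite sqr_sqrtr// ltW.
rewrite /taylor_const -[leRHS]mulrA; apply: ler_wpM2l => //.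
move: (Num.sqrt h) r0 rr la la3 => r r0 rr la la3.
have r1 : r <= 1 by rewrite -(@ler_sqr R) ?nnegrE ?(ltW r0)// rr expr1n.
have hh2 : h ^+ 2 <= h * r.
  by rewrite expr2; apply: ler_wpM2l; rewrite ?(ltW h0)// -rr expr2 ger_pMr.
have hh3 : h ^+ 3 <= h * r.
  by apply: le_trans hh2; rewrite exprS ger_pMl ?exprn_gt0.
have e1 : 4 * K ^+ 3 * h ^+ 3 <= 4 * K ^+ 3 * (h * r).
  by apply: ler_wpM2l => //; rewrite mulr_ge0// exprn_ge0.
have e2 : K ^+ 2 * h ^+ 2 <= K ^+ 2 * (h * r).
  by apply: ler_wpM2l => //; rewrite exprn_ge0.
have s3 : 0 <= 4 * sigma ^+ 3 by rewrite mulr_ge0// exprn_ge0// ltW.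
have e3 := ler_wpM2l s3 la3.
have s4 : 0 <= 2 * sigma * K * h by rewrite !mulr_ge0// ltW.
have e4 := ler_wpM2l s4 la.
apply: (le_trans (lerD (lerD e1 e2) (lerD e3 e4))).
by rewrite le_eqVlt; apply/orP; left; apply/eqP; ring.
Qed.

Variables (alpha : R) (hx G c : R -> R).
Hypotheses (mh : measurable_fun setT hx) (mG : measurable_fun setT G) (mc : measurable_fun setT c).
Hypotheses (hx0 : forall x, 0 <= hx x) (c0 : forall x, 0 <= c x).
Hypothesis liph : forall x y, `|hx y - hx x| <= L * `|y - x|.
Hypothesis GL : forall x, `|G x| <= L.
Hypothesis cL : forall z, c (p z) <= L.
Hypothesis HJB : forall x,
  sigma ^+ 2 / 2 * v2 x - b * v x - alpha * V x + hx x + G x = 0.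

Definition running_cost (z : measurableTypeR R * T) : R :=
  hx (X (Num.max z.1 0) z.2) + c (p z).

Definition expected_value t : R := \int[Pr]_w V (X t w).

Definition expected_rate s : R := \int[Pr]_w running_cost (s, w).

Lemma running_cost_measurable : measurable_fun setT running_cost.
Proof.
apply: measurable_funD; last exact: (measurableT_comp mc).
apply: (measurableT_comp mh); apply: measurable_fun_caratheodory.
  by move=> t t0; exact: state_measurable.
exact: state_continuous.
Qed.

Lemma running_cost_ge0 z : 0 <= running_cost z.
Proof. exact: addr_ge0. Qed.

Lemma expected_rate_measurable : measurable_fun setT (expected_rate : R -> R).
Proof. by apply: expect_measurable; [exact: running_cost_measurable|exact: running_cost_ge0]. Qed.

Lemma expected_rate_ge0 s : 0 <= expected_rate s.
Proof. by apply: Rintegral_ge0 => w _; exact: running_cost_ge0. Qed.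

Lemma control_cost_integrable s : Pr.-integrable setT (EFin \o (fun w => c (p (s, w)))).
Proof.
apply: (@bounded_probability_integrable _ _ _ _ _ L) => [|w]; last by rewrite ger0_norm.
by apply: (measurableT_comp mc); exact: section_measurable.
Qed.

Lemma expected_rateE s : 0 <= s ->
  expected_rate s = \int[Pr]_w hx (X s w) + \int[Pr]_w c (p (s, w)).
Proof.
move=> s0; rewrite /expected_rate /running_cost/= (max_idPl s0) RintegralD//.
  by have [] := lipschitz_state_integrable mh liph s0.
exact: control_cost_integrable.
Qed.

Lemma expected_rate_le s : 0 <= s ->
  expected_rate s <= `|hx (p0 - d0)| + L * (K * s + sigma * Num.sqrt s) + L.
Proof.
move=> s0; rewrite expected_rateE//; apply: lerD.
  by have [_] := lipschitz_state_integrable mh liph s0; apply: le_trans; exact: ler_norm.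
have ic := probability_cst_integrable Pr L.
apply: (@le_trans _ _ (\int[Pr]_w L)); last first.
  by rewrite Rintegral_probability_cst.
apply: le_Rintegral => //; exact: control_cost_integrable.
Qed.

Lemma expected_rate_integrable t s : 0 <= t ->
  (@lebesgue_measure R).-integrable `[t, s] (EFin \o expected_rate).
Proof.
move=> t0; apply: measurable_bounded_integrable => //.
- rewrite [X in (X < _)%E](lebesgue_measure_itv `[t, s])/=.
  by case: ifP => _; rewrite ?ltry// -EFinB ltry.
- by apply: measurable_funTS; exact: expected_rate_measurable.
- exists (`|hx (p0 - d0)| + L * (K * s + sigma * Num.sqrt s) + L).
  split; first by rewrite num_real.
  move=> M hM u; rewrite /= in_itv/= => /andP[tu us]; have u0 := le_trans t0 tu.
  rewrite ger0_norm ?expected_rate_ge0//; apply: le_trans (ltW hM).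
  apply: (le_trans (expected_rate_le u0)); rewrite lerD2r lerD2l; apply: ler_wpM2l => //.
  apply: lerD; apply: ler_wpM2l => //; first exact: ltW.
  by rewrite ler_sqrt// (le_trans u0).
Qed.

Lemma state_dist t s h : 0 <= t -> t <= s -> s <= t + h -> 0 < h -> h <= 1 ->
  Pr.-integrable setT (EFin \o (fun w => `|X s w - X t w|)) /\
  \int[Pr]_w `|X s w - X t w| <= (K + sigma) * Num.sqrt h.
Proof.
move=> t0 ts sth h0 h1.
have r0 : 0 <= Num.sqrt h by exact: sqrtr_ge0.
move: ts; rewrite le_eqVlt => /predU1P[<-|ts].
  under [X in EFin \o X]eq_fun do rewrite subrr normr0.
  under eq_Rintegral do rewrite subrr normr0.
  split; first by apply: (@bounded_probability_integrable _ _ _ _ _ 0) => // ?; rewrite normr0.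
  by rewrite Rintegral_cst// mul0r mulr_ge0// addr_ge0// ltW.
have st0 : 0 < s - t by rewrite subr_gt0.
have := state_increment_abs t0 st0; rewrite addrC subrK => -[i1 l1]; split => //.
have rr : Num.sqrt h * Num.sqrt h = h by rewrite -expr2 sqr_sqrtr// ltW.
have r1 : Num.sqrt h <= 1 by rewrite -[leRHS]sqrtr1 ler_sqrt.
have sth' : s - t <= h by lra.
apply: (le_trans l1); rewrite [leRHS]mulrDl; apply: lerD.
  by apply: ler_wpM2l => //; apply: (le_trans sth'); rewrite -[leLHS]rr ler_piMl.
by apply: ler_wpM2l; [exact: ltW|rewrite ler_sqrt// ltW].
Qed.

Section OneStep.
Variables t h : R.
Hypotheses (t0 : 0 <= t) (h0 : 0 < h) (h1 : h <= 1).
Notation mu := (@lebesgue_measure R).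

Let EG := \int[Pr]_w G (X t w).
Let Eh := \int[Pr]_w hx (X t w).
Let drift s := \int[Pr]_w (v (X t w) * p (s, w)).
(** The expected defect in the Hamilton-Jacobi-Bellman equation when the rate and cost at time s are
    paired with the state at time t. Its sign, up to O(sqrt h), gives the two one-step
    inequalities. *)
Let gap s := drift s + expected_rate s - (EG + Eh).

Let tth : t <= t + h. Proof. by rewrite lerDl ltW. Qed.

Let iv : Pr.-integrable setT (EFin \o (fun w => v (X t w))).
Proof. by apply: (@bounded_probability_integrable _ _ _ _ _ L) => //; exact:
  comp_state_measurable. Qed.

Let iv2 : Pr.-integrable setT (EFin \o (fun w => v2 (X t w))).
Proof. by apply: (@bounded_probability_integrable _ _ _ _ _ L) => //; exact:
  comp_state_measurable. Qed.

Let iG : Pr.-integrable setT (EFin \o (fun w => G (X t w))).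
Proof. by apply: (@bounded_probability_integrable _ _ _ _ _ L) => //; exact:
  comp_state_measurable. Qed.

Let ihx : Pr.-integrable setT (EFin \o (fun w => hx (X t w))).
Proof. by have [] := lipschitz_state_integrable mh liph t0. Qed.

Let iV : Pr.-integrable setT (EFin \o (fun w => V (X t w))).
Proof. by have [] := lipschitz_state_integrable mV lipV t0. Qed.

Let mdrift : measurable_fun setT (fun z : measurableTypeR R * T => v (X t z.2) * p z).
Proof.
apply: measurable_funM => //.
by apply: (measurableT_comp (comp_state_measurable mv t0)); exact: measurable_snd.
Qed.

Let drift_le (z : measurableTypeR R * T) : `|v (X t z.2) * p z| <= L * K0.
Proof. by rewrite normrM ler_pM. Qed.

Let drift_integrable s : Pr.-integrable setT (EFin \o (fun w => v (X t w) * p (s, w))).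
Proof.
apply: (@bounded_probability_integrable _ _ _ _ _ (L * K0)).
  exact: (section_measurable s mdrift).
by move=> w; exact: (drift_le (s, w)).
Qed.

Let idrift : mu.-integrable `[t, t + h] (EFin \o drift).
Proof.
have [mD Dle] := expect_bounded_measurable Pr mdrift drift_le.
exact: bounded_integrable Dle.
Qed.

Let muth : mu `[t, t + h]%classic = h%:E.
Proof. by rewrite lebesgue_measure_itv/= lte_fin ltrDl h0 -EFinB (addrC t) addrK. Qed.

Let icst (k : R) : mu.-integrable `[t, t + h] (EFin \o (fun=> k)).
Proof. by apply: (@bounded_integrable _ _ _ _ `|k|). Qed.

Let cstE (k : R) : \int[mu]_(s in `[t, t + h]) k = k * h.
Proof. by rewrite -[RHS]/(k * fine h%:E) -muth Rintegral_cst. Qed.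

Let drift_swap : \int[Pr]_w (v (X t w) * (P (t + h) w - P t w)) =
  \int[mu]_(s in `[t, t + h]) drift s.
Proof.
have [/= mD] := @Rintegral_swap _ _ _ Pr _ (L * K0) t (t + h) mdrift drift_le.
rewrite /drift => <-.
rewrite /Rintegral; congr fine; apply: ae_eq_integral => //.
- apply/measurable_EFinP; apply: measurable_funM; first exact: comp_state_measurable.
  apply: measurable_funB; apply: capacity_measurable => //.
  by rewrite addr_ge0// ltW.
- exact/measurable_EFinP.
apply: (ae_imp Pp) => w hw _; rewrite hw//; congr EFin.
rewrite -RintegralZl//; apply: bounded_integrable; first exact: pw_measurable.
by move=> u; exact: pK.
Qed.

(** The expansion [state_taylor] combined with h times the expectation of the equation at X_t, which
    eliminates [v2]; Fubini's theorem turns the increment of P into the integral of [drift]. *)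
Lemma step_identity :
  `|expected_value (t + h) - expected_value t - alpha * h * expected_value t
    + (\int[mu]_(s in `[t, t + h]) expected_rate s)%R - (\int[mu]_(s in `[t, t + h]) gap s)%R|
  <= taylor_const * (h * Num.sqrt h).
Proof.
have ir := expected_rate_integrable (t + h) t0.
have -> : (\int[mu]_(s in `[t, t + h]) gap s)%R = \int[mu]_(s in `[t, t + h]) drift s
   + \int[mu]_(s in `[t, t + h]) expected_rate s - (EG + Eh) * h.
  rewrite /gap RintegralB//; last by integrability.
  by rewrite RintegralD// cstE.
have hjb : sigma ^+ 2 / 2 * \int[Pr]_w v2 (X t w) - b * \int[Pr]_w v (X t w)
    - alpha * expected_value t + Eh + EG = 0.
  rewrite /Eh /EG /expected_value -!RintegralZl// -!RintegralB//; try by integrability.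
  rewrite -!RintegralD//; try by integrability.
  under eq_Rintegral do rewrite HJB.
  by rewrite Rintegral_cst// mul0r.
have := state_taylor t0 h0 h1; rewrite drift_swap.
rewrite -/(expected_value (t + h)) -/(expected_value t).
congr (`|_| <= _).
move: hjb; move: (expected_value _) (expected_value _) (\int[Pr]_w v2 _) (\int[Pr]_w v _).
move=> e1 e2 e3 e4 hjb.
apply/eqP; rewrite -subr_eq0; apply/eqP.
rewrite -[RHS](mulr0 (- h)) -hjb; ring.
Qed.

(** The pointwise inequality is used at x = X_t with the rate at time s, whatever their dependence.
    Only the holding cost has to be moved from X_s to X_t, at the price L E |X_s - X_t|. *)
Lemma step_ge : (forall x z, G x <= v x * p z + c (p z)) ->
  expected_value (t + h) - expected_value t - alpha * h * expected_value t
    + (\int[mu]_(s in `[t, t + h]) expected_rate s)%R >=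
  - ((taylor_const + L * (K + sigma)) * (h * Num.sqrt h)).
Proof.
move=> Gle.
have ir := expected_rate_integrable (t + h) t0.
have gap_ge s : s \in `[t, t + h] -> - (L * ((K + sigma) * Num.sqrt h)) <= gap s.
  rewrite in_itv/= => /andP[ts sth].
  have s0 := le_trans t0 ts.
  have [idx ldx] := state_dist t0 ts sth h0 h1.
  have ich := control_cost_integrable s.
  have [ihs _] := lipschitz_state_integrable mh liph s0.
  have id := drift_integrable s.
  rewrite /gap /drift expected_rateE//.
  have h1' : EG <= \int[Pr]_w (v (X t w) * p (s, w)) + \int[Pr]_w c (p (s, w)).
    rewrite -RintegralD//; apply: le_Rintegral => //; first by integrability.
  have h2' : Eh - L * \int[Pr]_w `|X s w - X t w| <= \int[Pr]_w hx (X s w).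
    rewrite -RintegralZl// -RintegralB//; last by integrability.
    apply: le_Rintegral => //; first by integrability.
    move=> w _; have := liph (X t w) (X s w); rewrite ler_norml => /andP[+ _]; lra.
  have := ler_wpM2l L0 ldx; lra.
have igap : mu.-integrable `[t, t + h] (EFin \o gap) by rewrite /gap; integrability.
have : - (L * ((K + sigma) * Num.sqrt h)) * h <= (\int[mu]_(s in `[t, t + h]) gap s)%R.
  rewrite -cstE; apply: le_Rintegral => //.
have := step_identity; rewrite ler_norml => /andP[+ _].
set A := taylor_const * _.
have -> : (taylor_const + L * (K + sigma)) * (h * Num.sqrt h) =
   A + L * ((K + sigma) * Num.sqrt h) * h by rewrite /A; ring.
lra.
Qed.

(** A feedback attains the minimum at the current state X_s, while [drift] carries v at X_t. Moving
    [G], [hx] and v p between the two states costs 1, 1 and K0 times L E |X_s - X_t|, whence 2 +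
    K0. *)
Lemma step_le : (forall x y, `|v y - v x| <= L * `|y - x|) ->
  (forall x y, `|G y - G x| <= L * `|y - x|) ->
  (forall s w, 0 <= s -> v (X s w) * p (s, w) + c (p (s, w)) = G (X s w)) ->
  expected_value (t + h) - expected_value t - alpha * h * expected_value t
    + (\int[mu]_(s in `[t, t + h]) expected_rate s)%R <=
  (taylor_const + L * (2 + K0) * (K + sigma)) * (h * Num.sqrt h).
Proof.
move=> lipv lipG Geq.
have ir := expected_rate_integrable (t + h) t0.
have gap_le s : s \in `[t, t + h] -> gap s <= L * (2 + K0) * ((K + sigma) * Num.sqrt h).
  rewrite in_itv/= => /andP[ts sth].
  have s0 := le_trans t0 ts.
  have [idx ldx] := state_dist t0 ts sth h0 h1.
  have ich := control_cost_integrable s.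
  have [ihs _] := lipschitz_state_integrable mh liph s0.
  have id := drift_integrable s.
  rewrite /gap /drift expected_rateE//.
  have h1' : \int[Pr]_w (v (X t w) * p (s, w)) + \int[Pr]_w c (p (s, w)) <=
      EG + L * (1 + K0) * \int[Pr]_w `|X s w - X t w|.
    rewrite -RintegralD// -RintegralZl// -RintegralD//; last by integrability.
    apply: le_Rintegral => //; [by integrability|by integrability|].
    move=> w _.
    have -> : v (X t w) * p (s, w) + c (p (s, w)) =
      G (X s w) - (v (X s w) - v (X t w)) * p (s, w) by rewrite -Geq//; ring.
    have := lipG (X t w) (X s w); rewrite ler_norml => /andP[_ g1].
    have : `|(v (X s w) - v (X t w)) * p (s, w)| <= L * `|X s w - X t w| * K0.
      by rewrite normrM; apply: ler_pM.
    rewrite ler_norml => /andP[g2 _].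
    have -> : L * (1 + K0) * `|X s w - X t w| = L * `|X s w - X t w| + L * `|X s w - X t w| * K0.
      by ring.
    lra.
  have h2' : \int[Pr]_w hx (X s w) <= Eh + L * \int[Pr]_w `|X s w - X t w|.
    rewrite -RintegralZl// -RintegralD//; last by integrability.
    apply: le_Rintegral => //; first by integrability.
    move=> w _; have := liph (X t w) (X s w); rewrite ler_norml => /andP[_]; lra.
  have L2 : 0 <= L * (2 + K0) by rewrite mulr_ge0// addr_ge0.
  have := ler_wpM2l L2 ldx.
  have -> : L * (2 + K0) * \int[Pr]_w `|X s w - X t w| =
    L * (1 + K0) * \int[Pr]_w `|X s w - X t w| + L * \int[Pr]_w `|X s w - X t w| by ring.
  lra.
have igap : mu.-integrable `[t, t + h] (EFin \o gap) by rewrite /gap; integrability.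
have : (\int[mu]_(s in `[t, t + h]) gap s)%R <= L * (2 + K0) * ((K + sigma) * Num.sqrt h) * h.
  rewrite -cstE; apply: le_Rintegral => //.
have := step_identity; rewrite ler_norml => /andP[_].
set A := taylor_const * _.
have -> : (taylor_const + L * (2 + K0) * (K + sigma)) * (h * Num.sqrt h) =
   A + L * (2 + K0) * ((K + sigma) * Num.sqrt h) * h by rewrite /A; ring.
lra.
Qed.

End OneStep.

End TestFunction.
End ControlledProcess.

(** * Telescoping the discounted one-step inequalities *)

Section Telescope.
Context {R : realType}.
Notation mu := (@lebesgue_measure R).

Lemma itv_integrable (f : R -> R) (s t M : R) : measurable_fun setT f ->
  (forall u, s <= u -> u <= t -> `|f u| <= M) -> mu.-integrable `[s, t] (EFin \o f).
Proof.
move=> mf fM; apply: measurable_bounded_integrable => //.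
- rewrite [X in (X < _)%E](lebesgue_measure_itv `[s, t])/=.
  by case: ifP => _; rewrite ?ltry// -EFinB ltry.
- exact: measurable_funTS.
- exists M; split; first by rewrite num_real.
  move=> M' hM u; rewrite /= in_itv/= => /andP[su ut].
  by rewrite (le_trans (fM _ su ut))// ltW.
Qed.

Lemma Rintegral_itv_split (f : R -> R) (s t u : R) : s <= t -> t <= u ->
  mu.-integrable `[s, u] (EFin \o f) ->
  (\int[mu]_(x in `[s, u]) f x)%R =
  (\int[mu]_(x in `[s, t]) f x)%R + (\int[mu]_(x in `[t, u]) f x)%R.
Proof.
move=> st tu fi.
have := Rintegral_itvB fi; move=> /(_ t); rewrite !bnd_simp => /(_ st tu).
rewrite (Rintegral_itv_obnd_cbnd (f := f) (b := BRight u)); last first.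
  by apply: integrableS fi => //; apply: subset_itvr; rewrite bnd_simp.
by move=> <-; rewrite addrC subrK.
Qed.

(** One step multiplies the value by 1 + a and discounts it by exp (- a); the mismatch is of second
    order, so it does not accumulate in the limit. *)
Lemma expR_step_bound (a : R) : 0 <= a -> 0 <= 1 - expR (- a) * (1 + a) <= a ^+ 2.
Proof.
move=> a0; have h1 := expR_ge1Dx (- a); have h2 := expR_ge1Dx a.
have e0 := expR_gt0 a; have e1 := expR_gt0 (- a).
have ee : expR (- a) * expR a = 1 by rewrite -expRD addNr expR0.
apply/andP; split.
  by rewrite subr_ge0 -[leRHS]ee; apply: ler_wpM2l; [exact: ltW|].
have : (1 - a) * (1 + a) <= expR (- a) * (1 + a).
  by apply: ler_wpM2r => //; exact: addr_ge0.
have -> : (1 - a) * (1 + a) = 1 - a ^+ 2 by ring.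
lra.
Qed.

Variables (phi kap : R -> R) (alpha C B T : R).
Hypotheses (alpha0 : 0 <= alpha) (C0 : 0 <= C) (B0 : 0 <= B) (T0 : 0 < T).
Hypothesis mkap : measurable_fun setT kap.
Hypothesis kapB : forall s, 0 <= s -> s <= T -> `|kap s| <= B.
Hypothesis phiB : forall s, 0 <= s -> s <= T -> `|phi s| <= B.
Hypothesis step : forall t h, 0 <= t -> 0 < h -> h <= 1 -> t + h <= T ->
  - (C * (h * Num.sqrt h)) <=
  phi (t + h) - phi t - alpha * h * phi t + (\int[mu]_(s in `[t, t + h]) kap s)%R.

Let disc s := expR (- alpha * s).
(** Discounted value plus cost incurred so far: the mean of the submartingale in the martingale
    principle of optimality. It is nondecreasing up to the step errors. *)
Let m t := disc t * phi t + (\int[mu]_(s in `[0%R, t]) (disc s * kap s))%R.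

Let mdisc : measurable_fun setT disc.
Proof. by apply: measurableT_comp => //; exact: measurable_funM. Qed.

Let disc_le1 s : 0 <= s -> disc s <= 1.
Proof. by move=> s0; rewrite -(@expR0 R) ler_expR mulNr oppr_le0 mulr_ge0. Qed.

Let disc_gt0 s : 0 < disc s. Proof. exact: expR_gt0. Qed.

Let ikap s t : 0 <= s -> t <= T -> mu.-integrable `[s, t] (EFin \o kap).
Proof.
move=> s0 tT; apply: (@itv_integrable _ _ _ B) => // u su ut.
by apply: kapB; [exact: le_trans su|exact: le_trans tT].
Qed.

Let idkap s t : 0 <= s -> t <= T -> mu.-integrable `[s, t] (EFin \o (fun u => disc u * kap u)).
Proof.
move=> s0 tT; apply: (@itv_integrable _ _ _ B); first exact: measurable_funM.
move=> u su ut; have u0 := le_trans s0 su.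
rewrite normrM (ger0_norm (ltW (disc_gt0 _))) -[leRHS]mul1r.
by apply: ler_pM => //; [exact: ltW|exact: disc_le1|apply: kapB => //; exact: le_trans tT].
Qed.

(** The three terms are the Taylor error, the mismatch between exp (- alpha h) and 1 + alpha h
    acting on [phi], and the variation of the discount factor within the step acting on [kap]. *)
Let C' := C + B * alpha ^+ 2 + alpha * B.

Lemma telescope_step t h : 0 <= t -> 0 < h -> h <= 1 -> t + h <= T ->
  - (C' * (h * Num.sqrt h)) <= m (t + h) - m t.
Proof.
move=> t0 h0 h1 thT.
have tth : t <= t + h by rewrite lerDl ltW.
have th0 : 0 <= t + h by apply: le_trans tth.
have r0 : 0 <= Num.sqrt h by exact: sqrtr_ge0.
have rr : Num.sqrt h * Num.sqrt h = h by rewrite -expr2 sqr_sqrtr// ltW.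
have r1 : Num.sqrt h <= 1 by rewrite -[leRHS]sqrtr1 ler_sqrt.
have hh : h ^+ 2 <= h * Num.sqrt h.
  by rewrite expr2; apply: ler_wpM2l; [exact: ltW|rewrite -[leLHS]rr ler_piMl].
rewrite /m (@Rintegral_itv_split _ 0 t (t + h))//; last exact: idkap.
have e1 : disc (t + h) = disc t * expR (- (alpha * h)).
  by rewrite /disc -expRD; congr expR; ring.
have /andP[b1 b2] := expR_step_bound (mulr_ge0 alpha0 (ltW h0)).
have phit : `|phi t| <= B by apply: phiB => //; apply: le_trans thT.
have main := ler_wpM2l (ltW (disc_gt0 (t + h))) (step t0 h0 h1 thT).
(* The step inequality discounts the whole running cost at the end of the step; on an interval of
   length h this changes the factor by at most alpha h. *)
have tail : disc (t + h) * (\int[mu]_(s in `[t, t + h]) kap s)%R - alpha * B * h ^+ 2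
    <= (\int[mu]_(s in `[t, t + h]) (disc s * kap s))%R.
  have ic : mu.-integrable `[t, t + h] (EFin \o (fun=> alpha * h * B)).
    by apply: (@itv_integrable _ _ _ `|alpha * h * B|).
  have cE : (\int[mu]_(s in `[t, t + h]) (alpha * h * B))%R = alpha * B * h ^+ 2.
    rewrite Rintegral_cst//= lebesgue_measure_itv/= lte_fin ltrDl h0 -EFinB/=.
    by ring.
  rewrite -cE -RintegralZl//; last exact: ikap.
  rewrite -RintegralB//; last by integrability; exact: ikap.
  apply: le_Rintegral => //; [by integrability; exact: ikap|exact: idkap|].
  move=> s; rewrite /= in_itv/= => /andP[ts sth].
  have s0 := le_trans t0 ts.
  have d1 : 0 <= disc s - disc (t + h) <= alpha * h.
    have -> : disc (t + h) = disc s * expR (- (alpha * (t + h - s))).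
      by rewrite /disc -expRD; congr expR; ring.
    rewrite -[X in X - _]mulr1 -mulrBr.
    have a0 : 0 <= alpha * (t + h - s) by rewrite mulr_ge0// subr_ge0.
    have := expR_ge1Dx (- (alpha * (t + h - s))).
    have : expR (- (alpha * (t + h - s))) <= 1 by rewrite -[leRHS](@expR0 R) ler_expR oppr_le0.
    move=> q1 q2; apply/andP; split; first by rewrite mulr_ge0 ?subr_ge0// ltW.
    apply: (@le_trans _ _ (1 * (alpha * (t + h - s)))).
      by apply: ler_pM; [exact: ltW|rewrite subr_ge0|exact: disc_le1|lra].
    rewrite mul1r; apply: ler_wpM2l => //; lra.
  have /andP[d2 d3] := d1.
  have kB : `|kap s| <= B by apply: kapB => //; exact: le_trans thT.
  have : `|(disc s - disc (t + h)) * kap s| <= alpha * h * B.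
    by rewrite normrM (ger0_norm d2); apply: ler_pM.
  rewrite ler_norml => /andP[+ _]; lra.
have first_ : disc (t + h) * ((1 + alpha * h) * phi t) - disc t * phi t >= - (B * alpha ^+ 2 *
  h ^+ 2).
  have -> : disc (t + h) * ((1 + alpha * h) * phi t) - disc t * phi t =
    - (disc t * (1 - expR (- (alpha * h)) * (1 + alpha * h)) * phi t) by rewrite e1; ring.
  have : `|disc t * (1 - expR (- (alpha * h)) * (1 + alpha * h)) * phi t| <= 1 * (alpha * h) ^+
    2 * B.
    rewrite normrM; apply: ler_pM => //.
    rewrite normrM (ger0_norm (ltW (disc_gt0 _))) (ger0_norm b1).
    by apply: ler_pM => //; [exact: ltW|exact: disc_le1].
  rewrite ler_norml => /andP[_].
  have -> : 1 * (alpha * h) ^+ 2 * B = B * alpha ^+ 2 * h ^+ 2 by ring.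
  by rewrite lerN2.
have small : disc (t + h) * - (C * (h * Num.sqrt h)) >= - (C * (h * Num.sqrt h)).
  rewrite mulrN lerN2 -[leRHS]mul1r; apply: ler_wpM2r; last exact: disc_le1.
  by rewrite !mulr_ge0// ltW.
have hB1 := ler_wpM2l (mulr_ge0 B0 (sqr_ge0 alpha)) hh.
have hB2 := ler_wpM2l (mulr_ge0 alpha0 B0) hh.
have -> : C' * (h * Num.sqrt h) = C * (h * Num.sqrt h) + B * alpha ^+ 2 * (h * Num.sqrt h)
   + alpha * B * (h * Num.sqrt h) by rewrite /C'; ring.
move: main tail first_ small hB1 hB2.
rewrite !mulrDr !mulrDl.
set I1 := (\int[mu]_(s in `[t, t + h]) kap s)%R.
set I2 := (\int[mu]_(s in `[t, t + h]) (disc s * kap s))%R.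
set I0 := (\int[mu]_(s in `[0%R, t]) (disc s * kap s))%R.
set Q := h * Num.sqrt h.
lra.
Qed.

Lemma discounted_telescope : phi 0 <= disc T * phi T + (\int[mu]_(s in `[0%R, T]) (disc s * kap
  s))%R.
Proof.
have m0 : m 0 = phi 0.
  by rewrite /m /disc mulr0 expR0 mul1r set_itv1 Rintegral_set1 addr0.
have C'0 : 0 <= C' by rewrite !addr_ge0// !mulr_ge0// sqr_ge0.
rewrite -m0 -/(m T) leNgt; apply/negP => mT.
pose dl := m 0 - m T.
have dl0 : 0 < dl by rewrite subr_gt0.
(* With n + 1 steps of length h = T / (n + 1) the total loss is at most C' T sqrt h. Squaring turns
   the limit into a bound on n + 1, which the Archimedean property contradicts. *)
have key (n : nat) : T <= n.+1%:R -> dl ^+ 2 * n.+1%:R <= C' ^+ 2 * T ^+ 3.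
  move=> Tn.
  have n0 : (0 : R) < n.+1%:R by [].
  pose h := T / n.+1%:R.
  have h0 : 0 < h by rewrite divr_gt0.
  have h1 : h <= 1 by rewrite ler_pdivrMr// mul1r.
  have nh : n.+1%:R * h = T by rewrite /h mulrC divfK// gt_eqF.
  have ind k : (k <= n.+1)%N -> - (k%:R * (C' * (h * Num.sqrt h))) <= m (k%:R * h) - m 0.
    elim: k => [_|k IH kn]; first by rewrite !mul0r subrr oppr0.
    have := IH (ltnW kn).
    have khT : k%:R * h + h <= T.
      by rewrite -[X in _ + X]mul1r -mulrDl natr1 -nh ler_wpM2r ?ler_nat// ltW.
    have := telescope_step (mulr_ge0 (ler0n _ k) (ltW h0)) h0 h1 khT.
    have -> : k.+1%:R * h = k%:R * h + h by rewrite -natr1 mulrDl mul1r.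
    have -> : k.+1%:R * (C' * (h * Num.sqrt h)) =
      k%:R * (C' * (h * Num.sqrt h)) + C' * (h * Num.sqrt h) by rewrite -natr1 mulrDl mul1r.
    lra.
  have := ind n.+1 (leqnn _); rewrite nh.
  have -> : n.+1%:R * (C' * (h * Num.sqrt h)) = C' * T * Num.sqrt h by rewrite -nh; ring.
  move=> hdl; have {}hdl : dl <= C' * T * Num.sqrt h by rewrite /dl; lra.
  have : dl ^+ 2 <= (C' * T * Num.sqrt h) ^+ 2.
    by apply: lerXn2r; rewrite ?nnegrE ?(ltW dl0)// (le_trans (ltW dl0)).
  rewrite exprMn sqr_sqrtr; last exact: ltW.
  rewrite -(ler_pM2r n0) => /le_trans; apply.
  by rewrite le_eqVlt; apply/orP; left; apply/eqP; rewrite /h; field; rewrite gt_eqF.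
(* The summand T makes the step length T / (N + 1) at most 1. *)
pose N := Num.truncn (C' ^+ 2 * T ^+ 3 / dl ^+ 2 + T).
have NT : C' ^+ 2 * T ^+ 3 / dl ^+ 2 + T < N.+1%:R by exact: truncnS_gt.
have q0 : 0 <= C' ^+ 2 * T ^+ 3 / dl ^+ 2.
  by rewrite divr_ge0 ?sqr_ge0// mulr_ge0 ?sqr_ge0// exprn_ge0// ltW.
have := key N; have -> : T <= N.+1%:R by lra.
move=> /(_ isT); rewrite mulrC -ler_pdivlMr ?exprn_gt0//.
by apply/negP; rewrite -ltNge; apply: le_lt_trans NT; rewrite lerDl ltW.
Qed.

End Telescope.

(** * Solution of the Hamilton-Jacobi-Bellman equation *)

Section Jets.
Context {R : realType}.
Implicit Types (V v w : R -> R) (S : set R) (L M : R).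

(* Second-order jets in Whitney form: the bounds are those of a function with
   Lipschitz second derivative, but they can be glued at a point without ever
   differentiating there. *)
Record jet S L V v w : Prop := Jet {
  jet_v : forall x, S x -> `|v x| <= L ;
  jet_w : forall x, S x -> `|w x| <= L ;
  jet_V1 : forall x y, S x -> S y -> `|V y - V x| <= L * `|y - x| ;
  jet_v1 : forall x y, S x -> S y -> `|v y - v x| <= L * `|y - x| ;
  jet_w1 : forall x y, S x -> S y -> `|w y - w x| <= L * `|y - x| ;
  jet_v2 : forall x y, S x -> S y ->
    `|v y - v x - w x * (y - x)| <= L * `|y - x| ^+ 2 ;
  jet_V3 : forall x y, S x -> S y ->
    `|V y - V x - v x * (y - x) - w x / 2 * (y - x) ^+ 2| <= L * `|y - x| ^+ 3 }.

Lemma jet_le S L L' V v w : L <= L' -> jet S L V v w -> jet S L' V v w.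
Proof.
move=> LL [h1 h2 h3 h4 h5 h6 h7].
split=> [x /h1|x /h2|x y Sx Sy|x y Sx Sy|x y Sx Sy|x y Sx Sy|x y Sx Sy].
- by move=> h; exact: le_trans LL.
- by move=> h; exact: le_trans LL.
- by apply: (le_trans (h3 x y Sx Sy)); exact: ler_wpM2r.
- by apply: (le_trans (h4 x y Sx Sy)); exact: ler_wpM2r.
- by apply: (le_trans (h5 x y Sx Sy)); exact: ler_wpM2r.
- by apply: (le_trans (h6 x y Sx Sy)); apply: ler_wpM2r => //; exact: exprn_ge0.
- by apply: (le_trans (h7 x y Sx Sy)); apply: ler_wpM2r => //; exact: exprn_ge0.
Qed.

Lemma jetD S L1 L2 V1 v1 w1 V2 v2 w2 : jet S L1 V1 v1 w1 -> jet S L2 V2 v2 w2 ->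
  jet S (L1 + L2) (V1 \+ V2) (v1 \+ v2) (w1 \+ w2).
Proof.
have tri (a b c A B C : R) : c = a + b -> `|a| <= A -> `|b| <= B -> A + B = C -> `|c| <= C.
  by move=> -> h1 h2 <-; apply: (le_trans (ler_normD _ _)); exact: lerD.
move=> [a1 a2 a3 a4 a5 a6 a7] [b1 b2 b3 b4 b5 b6 b7].
split=> [x Sx|x Sx|x y Sx Sy|x y Sx Sy|x y Sx Sy|x y Sx Sy|x y Sx Sy] /=.
- by apply: tri (a1 x Sx) (b1 x Sx) _.
- by apply: tri (a2 x Sx) (b2 x Sx) _.
- by apply: tri (a3 x y Sx Sy) (b3 x y Sx Sy) _; ring.
- by apply: tri (a4 x y Sx Sy) (b4 x y Sx Sy) _; ring.
- by apply: tri (a5 x y Sx Sy) (b5 x y Sx Sy) _; ring.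
- by apply: tri (a6 x y Sx Sy) (b6 x y Sx Sy) _; ring.
- by apply: tri (a7 x y Sx Sy) (b7 x y Sx Sy) _; field.
Qed.

Lemma jetZ S L k V v w : jet S L V v w ->
  jet S (`|k| * L) (fun x => k * V x) (fun x => k * v x) (fun x => k * w x).
Proof.
have sc (a b A B : R) : b = k * a -> `|a| <= A -> `|k| * A = B -> `|b| <= B.
  by move=> -> h1 <-; rewrite normrM; exact: ler_wpM2l.
move=> [a1 a2 a3 a4 a5 a6 a7].
split=> [x Sx|x Sx|x y Sx Sy|x y Sx Sy|x y Sx Sy|x y Sx Sy|x y Sx Sy] /=.
- by apply: sc (a1 x Sx) _.
- by apply: sc (a2 x Sx) _.
- by apply: sc (a3 x y Sx Sy) _; ring.
- by apply: sc (a4 x y Sx Sy) _; ring.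
- by apply: sc (a5 x y Sx Sy) _; ring.
- by apply: sc (a6 x y Sx Sy) _; ring.
- by apply: sc (a7 x y Sx Sy) _; field.
Qed.

Lemma jet_affine S (be ga : R) : jet S `|be| (fun x => be * x + ga) (fun=> be) (fun=> 0).
Proof.
split=> [//|x _|x y _ _|x y _ _|x y _ _|x y _ _|x y _ _].
- by rewrite normr0.
- by rewrite (_ : be * y + ga - _ = be * (y - x)) ?normrM//; ring.
- by rewrite subrr normr0 mulr_ge0.
- by rewrite subrr normr0 mulr_ge0.
- by rewrite !subrr mul0r subrr normr0 mulr_ge0 ?exprn_ge0.
- rewrite (_ : _ - _ = 0); last by field.
  by rewrite normr0 mulr_ge0 ?exprn_ge0.
Qed.

Lemma expR_dist (a b M : R) : expR a <= M -> expR b <= M ->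
  `|expR b - expR a| <= M * `|b - a|.
Proof.
wlog ab : a b / a <= b.
  move=> H aM bM; have [ab|/ltW ba] := leP a b; first exact: H.
  by rewrite distrC (distrC b); exact: H.
move=> aM bM; rewrite !ger0_norm ?subr_ge0 ?ler_expR//.
have := expR_ge1Dx (a - b); rewrite expRD expRN ler_pdivlMr ?expR_gt0// => h.
apply: (@le_trans _ _ (expR b * (b - a))); last by apply: ler_wpM2r => //; rewrite subr_ge0.
by move: h; rewrite mulrDl mul1r; lra.
Qed.

(** The two conditions on c say that it lies between a and b, whichever of the two is larger. *)
Lemma MVT_bound (f df : R -> R) (a b M : R) :
  (forall x : R, is_derive x (1 : R) f (df x)) ->
  (forall c, `|c - a| <= `|b - a| -> (c - a) * (b - a) >= 0 -> `|df c| <= M) ->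
  `|f b - f a| <= M * `|b - a|.
Proof.
move=> fd dfM.
have cf : continuous f.
  by move=> x; apply: differentiable_continuous; apply/derivable1_diffP; case: (fd x).
have [ab|ba] := leP a b.
  have [|c cab ->] := @MVT_segment _ f df a b ab (fun x _ => fd x).
    exact: continuous_subspaceT.
  rewrite normrM; apply: ler_wpM2r => //; apply: dfM; move: cab; rewrite in_itv/= => /andP[ac cb].
    by rewrite !ger0_norm ?subr_ge0// lerD2r.
  by rewrite mulr_ge0 ?subr_ge0.
have [|c cab E] := @MVT_segment _ f df b a (ltW ba) (fun x _ => fd x).
  exact: continuous_subspaceT.
rewrite distrC E normrM (distrC b); apply: ler_wpM2r => //; apply: dfM; move: cab; rewrite
  in_itv/= => /andP[ac cb].
  by rewrite !ler0_norm ?subr_le0// ?(ltW ba)// lerN2 lerD2r.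
by rewrite mulr_le0 ?subr_le0// ltW.
Qed.

Lemma expR_between (a b c M : R) : expR a <= M -> expR b <= M ->
  `|c - a| <= `|b - a| -> (c - a) * (b - a) >= 0 -> expR c <= M.
Proof.
move=> aM bM cb s.
have [ab|ba] := leP a b.
  apply: le_trans bM; rewrite ler_expR -(lerD2r (- a)); apply: (le_trans (ler_norm _)).
  by apply: (le_trans cb); rewrite ger0_norm// subr_ge0.
apply: le_trans aM; rewrite ler_expR -subr_le0 leNgt; apply/negP => ca.
by move: s; rewrite leNgt => /negP; apply; rewrite pmulr_rlt0// subr_lt0.
Qed.

(** The derivative of this remainder is the remainder of one order less, so the mean value theorem
    raises the order by one; [expR_taylor3] repeats the argument. *)
Lemma expR_taylor2 (a b M : R) : expR a <= M -> expR b <= M ->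
  `|expR b - expR a - expR a * (b - a)| <= M * `|b - a| ^+ 2.
Proof.
move=> aM bM; pose f x := expR x - expR a * (x - a).
have fd (x : R) : is_derive x (1 : R) f (expR x - expR a).
  by apply: is_derive_eq; rewrite /GRing.scale/=; ring.
have := @MVT_bound f (fun x => expR x - expR a) a b (M * `|b - a|) fd.
have -> : f b - f a = expR b - expR a - expR a * (b - a) by rewrite /f; ring.
rewrite -mulrA -expr2; apply => c cb s; apply: (le_trans (expR_dist aM _)).
  exact: expR_between cb s.
by apply: ler_wpM2l => //; apply: le_trans aM; exact: expR_ge0.
Qed.

Lemma expR_taylor3 (a b M : R) : expR a <= M -> expR b <= M ->
  `|expR b - expR a - expR a * (b - a) - expR a / 2 * (b - a) ^+ 2| <= M * `|b - a| ^+ 3.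
Proof.
move=> aM bM; pose f x := expR x - expR a * (x - a) - expR a / 2 * (x - a) ^+ 2.
have fd (x : R) : is_derive x (1 : R) f (expR x - expR a - expR a * (x - a)).
  by apply: is_derive_eq; rewrite /GRing.scale/=; field.
have := @MVT_bound f (fun x => expR x - expR a - expR a * (x - a)) a b (M * `|b - a| ^+ 2) fd.
have -> : f b - f a = expR b - expR a - expR a * (b - a) - expR a / 2 * (b - a) ^+ 2.
  by rewrite /f; field.
have -> : M * `|b - a| ^+ 3 = M * `|b - a| ^+ 2 * `|b - a| by ring.
apply => c cb s; apply: (le_trans (expR_taylor2 aM _)).
  exact: expR_between cb s.
apply: ler_wpM2l => //; first by apply: le_trans aM; exact: expR_ge0.
by apply: lerXn2r; rewrite ?nnegrE.
Qed.

Lemma jet_expR S (rho M : R) : (forall x, S x -> expR (rho * x) <= M) ->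
  exists L, jet S L (fun x => expR (rho * x)) (fun x => rho * expR (rho * x))
    (fun x => rho ^+ 2 * expR (rho * x)).
Proof.
move=> SM.
have [[x0 Sx0]|S0] := pselect (exists x, S x); last first.
  by exists 0; split=> [x Sx|x Sx|x ? Sx|x ? Sx|x ? Sx|x ? Sx|x ? Sx]; exfalso; apply: S0; exists x.
have M0 : 0 <= M by apply: le_trans (SM _ Sx0); exact: expR_ge0.
(* Since q >= 1, its cube dominates every power of |rho| up to the third, so one constant serves all
   seven bounds. *)
pose q : R := 1 + `|rho|.
have q1 : 1 <= q by rewrite lerDl.
have q0 : 0 <= q by apply: le_trans q1.
have rq : `|rho| <= q by rewrite lerDr.
have q3 k : (k <= 3)%N -> `|rho| ^+ k <= q ^+ 3.
  move=> k3; apply: (@le_trans _ _ (q ^+ k)); first by apply: lerXn2r; rewrite ?nnegrE.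
  exact: ler_weXn2l.
pose L := q ^+ 3 * M.
have MX k : (k <= 3)%N -> `|rho| ^+ k * M <= L by move=> k3; apply: ler_wpM2r => //; exact: q3.
have em x : S x -> `|expR (rho * x)| <= M by move=> Sx; rewrite ger0_norm ?expR_ge0// SM.
have dE x y : rho * y - rho * x = rho * (y - x) by ring.
exists L; split=> [x Sx|x Sx|x y Sx Sy|x y Sx Sy|x y Sx Sy|x y Sx Sy|x y Sx Sy].
- rewrite normrM; apply: le_trans (MX 1 isT); rewrite expr1; apply: ler_wpM2l => //; exact: em.
- by rewrite normrM normrX; apply: le_trans (MX 2 isT); apply: ler_wpM2l; rewrite ?exprn_ge0// em.
- apply: (le_trans (expR_dist (SM _ Sx) (SM _ Sy))); rewrite dE normrM mulrA.
  by apply: ler_wpM2r => //; rewrite mulrC; exact: (MX 1).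
- rewrite -mulrBr normrM; apply: (@le_trans _ _ (`|rho| * (M * `|rho * (y - x)|))).
    by apply: ler_wpM2l => //; rewrite -dE; exact: expR_dist (SM _ Sx) (SM _ Sy).
  rewrite normrM; have -> : `|rho| * (M * (`|rho| * `|y - x|)) = `|rho| ^+ 2 * M * `|y - x| by ring.
  by apply: ler_wpM2r => //; exact: MX.
- rewrite -mulrBr normrM normrX; apply: (@le_trans _ _ (`|rho| ^+ 2 * (M * `|rho * (y - x)|))).
    by apply: ler_wpM2l; rewrite ?exprn_ge0// -dE; exact: expR_dist (SM _ Sx) (SM _ Sy).
  rewrite normrM; have -> : `|rho| ^+ 2 * (M * (`|rho| * `|y - x|)) = `|rho| ^+ 3 * M * `|y -
    x| by ring.
  by apply: ler_wpM2r => //; exact: MX.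
- have -> : rho * expR (rho * y) - rho * expR (rho * x) - rho ^+ 2 * expR (rho * x) * (y - x) =
    rho * (expR (rho * y) - expR (rho * x) - expR (rho * x) * (rho * y - rho * x)) by ring.
  rewrite normrM; apply: (@le_trans _ _ (`|rho| * (M * `|rho * (y - x)| ^+ 2))).
    by apply: ler_wpM2l => //; rewrite -dE; exact: expR_taylor2 (SM _ Sx) (SM _ Sy).
  rewrite normrM; have -> : `|rho| * (M * (`|rho| * `|y - x|) ^+ 2) = `|rho| ^+ 3 * M * `|y -
    x| ^+ 2.
    by ring.
  by apply: ler_wpM2r; rewrite ?exprn_ge0//; exact: MX.
- have -> : expR (rho * y) - expR (rho * x) - rho * expR (rho * x) * (y - x) -
    rho ^+ 2 * expR (rho * x) / 2 * (y - x) ^+ 2 =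
    expR (rho * y) - expR (rho * x) - expR (rho * x) * (rho * y - rho * x)
    - expR (rho * x) / 2 * (rho * y - rho * x) ^+ 2 by field.
  apply: (le_trans (expR_taylor3 (SM _ Sx) (SM _ Sy))).
  rewrite dE normrM; have -> : M * (`|rho| * `|y - x|) ^+ 3 = `|rho| ^+ 3 * M * `|y - x| ^+ 3
    by ring.
  by apply: ler_wpM2r; rewrite ?exprn_ge0//; exact: MX.
Qed.

Definition paste (z : R) (f g : R -> R) (x : R) : R := if x <= z then f x else g x.

Lemma paste_l z f g x : x <= z -> paste z f g x = f x.
Proof. by rewrite /paste => ->. Qed.

Lemma paste_r z f g x : f z = g z -> z <= x -> paste z f g x = g x.
Proof.
move=> fgz zx; rewrite /paste; case: ifPn => // xz.
by have -> : x = z by apply/le_anti; rewrite xz.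
Qed.

(** The constant L does not deteriorate: for points on opposite sides of z, the terms produced by
    re-centring at z are dominated by the mixed terms of the binomial expansion of (|z - x| + |y -
    z|)^k. *)
Lemma jet_paste S z L V1 v1 w1 V2 v2 w2 : S z ->
  jet (S `&` [set x | x <= z]) L V1 v1 w1 -> jet (S `&` [set x | z <= x]) L V2 v2 w2 ->
  V1 z = V2 z -> v1 z = v2 z -> w1 z = w2 z ->
  jet S L (paste z V1 V2) (paste z v1 v2) (paste z w1 w2).
Proof.
move=> Sz j1 j2 Vz vz wz.
pose V := paste z V1 V2; pose v := paste z v1 v2; pose w := paste z w1 w2.
have j1' : jet (S `&` [set x | x <= z]) L V v w.
  case: j1 => a1 a2 a3 a4 a5 a6 a7.
  split=> [x [Sx xz]|x [Sx xz]|x y [Sx xz] [Sy yz]|x y [Sx xz] [Sy yz]|x y [Sx xz] [Sy yz]|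
    x y [Sx xz] [Sy yz]|x y [Sx xz] [Sy yz]]; rewrite /V /v /w !paste_l//.
  - exact: a1.
  - exact: a2.
  - exact: a3.
  - exact: a4.
  - exact: a5.
  - exact: a6.
  - exact: a7.
have j2' : jet (S `&` [set x | z <= x]) L V v w.
  case: j2 => a1 a2 a3 a4 a5 a6 a7.
  split=> [x [Sx xz]|x [Sx xz]|x y [Sx xz] [Sy yz]|x y [Sx xz] [Sy yz]|x y [Sx xz] [Sy yz]|
    x y [Sx xz] [Sy yz]|x y [Sx xz] [Sy yz]]; rewrite /V /v /w !paste_r//.
  - exact: a1.
  - exact: a2.
  - exact: a3.
  - exact: a4.
  - exact: a5.
  - exact: a6.
  - exact: a7.
rewrite -/V -/v -/w; case: j1' => a1 a2 a3 a4 a5 a6 a7; case: j2' => b1 b2 b3 b4 b5 b6 b7.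
have L0 : 0 <= L by apply: le_trans (a1 z _); rewrite /= ?lexx.
(* Pairs separated by z are chained through z. *)
pose cross x y := [/\ `|V z - V x| <= L * `|z - x|, `|v z - v x| <= L * `|z - x|,
  `|w z - w x| <= L * `|z - x|, `|v z - v x - w x * (z - x)| <= L * `|z - x| ^+ 2 &
  `|V z - V x - v x * (z - x) - w x / 2 * (z - x) ^+ 2| <= L * `|z - x| ^+ 3] /\
  [/\ `|V y - V z| <= L * `|y - z|, `|v y - v z| <= L * `|y - z|,
  `|w y - w z| <= L * `|y - z|, `|v y - v z - w z * (y - z)| <= L * `|y - z| ^+ 2 &
  `|V y - V z - v z * (y - z) - w z / 2 * (y - z) ^+ 2| <= L * `|y - z| ^+ 3] /\
  `|y - x| = `|z - x| + `|y - z|.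
have cases x y : S x -> S y ->
    [\/ (S `&` [set x | x <= z]) x /\ (S `&` [set x | x <= z]) y,
      (S `&` [set x | z <= x]) x /\ (S `&` [set x | z <= x]) y | cross x y].
  move=> Sx Sy; have [xz|zx] := leP x z; have [yz|zy] := leP y z.
  - by constructor 1.
  - have yz' := ltW zy; constructor 3; split; last split.
    + by split; [apply: a3|apply: a4|apply: a5|apply: a6|apply: a7]; split => //=.
    + by split; [apply: b3|apply: b4|apply: b5|apply: b6|apply: b7]; split => //=.
    + rewrite !ger0_norm ?subr_ge0//; [ring|exact: le_trans yz'].
  - have zx' := ltW zx; constructor 3; split; last split.
    + by split; [apply: b3|apply: b4|apply: b5|apply: b6|apply: b7]; split => //=.
    + by split; [apply: a3|apply: a4|apply: a5|apply: a6|apply: a7]; split => //=.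
    + rewrite !ler0_norm ?subr_le0//; [ring|exact: le_trans zx'].
  - by constructor 2; split; split => //=; exact: ltW.
have tri (p q r A B : R) : r = p + q -> `|p| <= A -> `|q| <= B -> `|r| <= A + B.
  by move=> -> h1 h2; apply: (le_trans (ler_normD _ _)); exact: lerD.
split.
- by move=> x Sx; have [xz|/ltW zx] := leP x z; [apply: a1|apply: b1]; split.
- by move=> x Sx; have [xz|/ltW zx] := leP x z; [apply: a2|apply: b2]; split.
- move=> x y Sx Sy; have [[? ?]|[? ?]|[[c1 _ _ _ _] [[d1 _ _ _ _] e]]] := cases x y Sx Sy.
  + exact: a3.
  + exact: b3.
  + by rewrite e mulrDr; apply: tri c1 d1; ring.
- move=> x y Sx Sy; have [[? ?]|[? ?]|[[_ c1 _ _ _] [[_ d1 _ _ _] e]]] := cases x y Sx Sy.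
  + exact: a4.
  + exact: b4.
  + by rewrite e mulrDr; apply: tri c1 d1; ring.
- move=> x y Sx Sy; have [[? ?]|[? ?]|[[_ _ c1 _ _] [[_ _ d1 _ _] e]]] := cases x y Sx Sy.
  + exact: a5.
  + exact: b5.
  + by rewrite e mulrDr; apply: tri c1 d1; ring.
- move=> x y Sx Sy; have [[? ?]|[? ?]|[[_ _ c3 c4 _] [[_ _ _ d4 _] e]]] := cases x y Sx Sy.
  + exact: a6.
  + exact: b6.
  + have c3' : `|(w z - w x) * (y - z)| <= L * `|z - x| * `|y - z|.
      by rewrite normrM; apply: ler_wpM2r.
    have := tri _ _ _ _ _ erefl (tri _ _ _ _ _ erefl d4 c4 : `|_| <= _) c3' => {}tri'.
    apply: (@le_trans _ _ (L * `|y - z| ^+ 2 + L * `|z - x| ^+ 2 + L * `|z - x| * `|y - z|)).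
      by apply: le_trans tri'; rewrite le_eqVlt; apply/orP; left; apply/eqP; congr `|_|; ring.
    rewrite e -subr_ge0.
    have -> : L * (`|z - x| + `|y - z|) ^+ 2 -
      (L * `|y - z| ^+ 2 + L * `|z - x| ^+ 2 + L * `|z - x| * `|y - z|) =
      L * (`|z - x| * `|y - z|) by ring.
    by rewrite !mulr_ge0.
- move=> x y Sx Sy; have [[? ?]|[? ?]|[[_ _ c3 c4 c5] [[_ _ _ _ d5] e]]] := cases x y Sx Sy.
  + exact: a7.
  + exact: b7.
  + have c4' : `|(v z - v x - w x * (z - x)) * (y - z)| <= L * `|z - x| ^+ 2 * `|y - z|.
      by rewrite normrM; apply: ler_wpM2r.
    have c3' : `|(w z - w x) * ((y - z) ^+ 2 / 2)| <= L * `|z - x| * (`|y - z| ^+ 2 / 2).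
      rewrite normrM normrM normrX (ger0_norm (x := 2^-1))//; apply: ler_wpM2r => //.
    have := tri _ _ _ _ _ erefl (tri _ _ _ _ _ erefl (tri _ _ _ _ _ erefl d5 c5) c4') c3' => {}tri'.
    apply: (@le_trans _ _ (L * `|y - z| ^+ 3 + L * `|z - x| ^+ 3 + L * `|z - x| ^+ 2 * `|y - z|
       + L * `|z - x| * (`|y - z| ^+ 2 / 2))).
      by apply: le_trans tri'; rewrite le_eqVlt; apply/orP; left; apply/eqP; congr `|_|; field.
    rewrite e -subr_ge0.
    have -> : L * (`|z - x| + `|y - z|) ^+ 3 - (L * `|y - z| ^+ 3 + L * `|z - x| ^+ 3
       + L * `|z - x| ^+ 2 * `|y - z| + L * `|z - x| * (`|y - z| ^+ 2 / 2)) =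
      L * (2 * (`|z - x| ^+ 2 * `|y - z|) + 5 / 2 * (`|z - x| * `|y - z| ^+ 2)) by field.
    by rewrite mulr_ge0// addr_ge0// !mulr_ge0// ?exprn_ge0.
Qed.

End Jets.

(** * Characteristic roots and their dependence on the drift *)

Section Roots.
Context {R : realType}.
Variables (alpha sigma : R).
Hypotheses (alpha0 : 0 < alpha) (sigma0 : 0 < sigma).
Implicit Types c z : R.

Definition charpoly c z : R := sigma ^+ 2 / 2 * z ^+ 2 - c * z - alpha.

Let disc c := Num.sqrt (c ^+ 2 + 2 * alpha * sigma ^+ 2).

Let disc2 c : disc c ^+ 2 = c ^+ 2 + 2 * alpha * sigma ^+ 2.
Proof. by rewrite sqr_sqrtr// addr_ge0 ?sqr_ge0// !mulr_ge0 ?sqr_ge0// ltW. Qed.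

Let s2 : 0 < sigma ^+ 2. Proof. exact: exprn_gt0. Qed.

Let disc_gt c : `|c| < disc c.
Proof.
rewrite -(@ltr_sqr R) ?nnegrE ?sqrtr_ge0// disc2 real_normK ?num_real// ltrDl.
by rewrite !mulr_gt0.
Qed.

Lemma pos_root_gt0 c : 0 < pos_root alpha c sigma.
Proof.
rewrite divr_gt0//; have := disc_gt c; rewrite ltr_norml => /andP[+ _].
rewrite -/(disc c); lra.
Qed.

Lemma neg_root_lt0 c : neg_root alpha c sigma < 0.
Proof.
rewrite /neg_root -oppr_gt0 -mulNr divr_gt0//; have := disc_gt c; rewrite ltr_norml => /andP[_].
rewrite -/(disc c); lra.
Qed.

Lemma charpoly_fact c z : charpoly c z =
  sigma ^+ 2 / 2 * ((z - pos_root alpha c sigma) * (z - neg_root alpha c sigma)).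
Proof.
rewrite /charpoly /pos_root /neg_root -/(disc c).
have -> : sigma ^+ 2 / 2 * ((z - (c + disc c) / sigma ^+ 2) * (z - (c - disc c) / sigma ^+ 2)) =
  sigma ^+ 2 / 2 * z ^+ 2 - c * z + (c ^+ 2 - disc c ^+ 2) / (2 * sigma ^+ 2).
  by field; rewrite gt_eqF.
by rewrite disc2; field; rewrite gt_eqF.
Qed.

Lemma charpoly_pos c : charpoly c (pos_root alpha c sigma) = 0.
Proof. by rewrite charpoly_fact subrr mul0r mulr0. Qed.

Lemma charpoly_neg c : charpoly c (neg_root alpha c sigma) = 0.
Proof. by rewrite charpoly_fact subrr !mulr0. Qed.

Lemma charpolyD c c' z : charpoly c z = charpoly c' z + (c' - c) * z.
Proof. by rewrite /charpoly; ring. Qed.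

(** At the negative root for c' the polynomial for c takes the value (c' - c) times that root, which
    is negative; the point therefore lies strictly between the two roots for c. *)
Lemma neg_root_lt c c' : c < c' -> neg_root alpha c sigma < neg_root alpha c' sigma.
Proof.
move=> cc; have := charpolyD c c' (neg_root alpha c' sigma).
rewrite charpoly_neg add0r charpoly_fact.
have n0 := neg_root_lt0 c'; have p0 := pos_root_gt0 c.
have q0 : neg_root alpha c' sigma - pos_root alpha c sigma < 0 by lra.
have : (c' - c) * neg_root alpha c' sigma < 0 by rewrite pmulr_rlt0// subr_gt0.
move=> + E; rewrite -E pmulr_rlt0 ?divr_gt0// nmulr_rlt0// subr_gt0//.
Qed.

(** Here the value is positive, and a positive point where the polynomial is positive lies beyond
    its larger root. *)
Lemma pos_root_lt c c' : c < c' -> pos_root alpha c sigma < pos_root alpha c' sigma.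
Proof.
move=> cc; have := charpolyD c c' (pos_root alpha c' sigma).
rewrite charpoly_pos add0r charpoly_fact.
have n0 := neg_root_lt0 c; have p0 := pos_root_gt0 c'.
have q0 : 0 < pos_root alpha c' sigma - neg_root alpha c sigma by lra.
have : 0 < (c' - c) * pos_root alpha c' sigma by rewrite mulr_gt0// subr_gt0.
by move=> + E; rewrite -E pmulr_rgt0 ?divr_gt0// pmulr_lgt0// subr_gt0.
Qed.

End Roots.

(** * Explicit value functions for the two signs of the threshold *)

Section ValueFunction.
Context {R : realType}.
Variables (alpha b sigma thl C M Ip Dp : R).
Hypotheses (alpha0 : 0 < alpha) (sigma0 : 0 < sigma) (thl0 : thl < 0).
Implicit Types (V v w : R -> R) (S : set R).

Definition holding_cost (x : R) : R := C * Num.max x 0 + M * (- Num.min x 0).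

(** For q >= - Ip this is the minimum of q r + adjustment cost of r over the admissible rates:
    increasing costs (q + Ip) r >= 0, and decreasing pays only when q > Dp, and then at full
    rate. *)
Definition hamiltonian (q : R) : R := thl * Num.max (q - Dp) 0.

Lemma hamiltonian_le q : q <= Dp -> hamiltonian q = 0.
Proof. by move=> qD; rewrite /hamiltonian (max_idPr _) ?mulr0// subr_le0. Qed.

Lemma hamiltonian_ge q : Dp <= q -> hamiltonian q = thl * (q - Dp).
Proof. by move=> qD; rewrite /hamiltonian (max_idPl _)// subr_ge0. Qed.

Lemma holding_cost_le x : x <= 0 -> holding_cost x = - M * x.
Proof. by move=> x0; rewrite /holding_cost (max_idPr x0) (min_idPl x0); ring. Qed.

Lemma holding_cost_pos x : 0 <= x -> holding_cost x = C * x.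
Proof. by move=> x0; rewrite /holding_cost (max_idPl x0) (min_idPr x0); ring. Qed.

Definition hjb_on S V v w := forall x, S x ->
  sigma ^+ 2 / 2 * w x - b * v x - alpha * V x + holding_cost x + hamiltonian (v x) = 0.

Definition local_solution S V v w := (exists L, jet S L V v w) /\ hjb_on S V v w.

(** Continuity of V at z comes for free: since alpha is nonzero, the equation at z determines V from
    v and w. *)
Lemma local_solution_paste S z V1 v1 w1 V2 v2 w2 : S z ->
  local_solution (S `&` [set x | x <= z]) V1 v1 w1 ->
  local_solution (S `&` [set x | z <= x]) V2 v2 w2 ->
  v1 z = v2 z -> w1 z = w2 z ->
  local_solution S (paste z V1 V2) (paste z v1 v2) (paste z w1 w2).
Proof.
move=> Sz [[L1 j1] h1] [[L2 j2] h2] vz wz.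
have Vz : V1 z = V2 z.
  have e1 : (S `&` [set x | x <= z]) z by split => //=.
  have e2 : (S `&` [set x | z <= x]) z by split => //=.
  have := h1 z e1; have := h2 z e2; rewrite vz wz => <- e.
  have : alpha * V1 z = alpha * V2 z by lra.
  by apply: mulfI; rewrite gt_eqF.
split.
  exists (Num.max L1 L2); apply: jet_paste => //.
    by apply: jet_le j1; rewrite le_max lexx.
  by apply: jet_le j2; rewrite le_max lexx orbT.
move=> x Sx; have [xz|/ltW zx] := leP x z.
  by rewrite !paste_l//; apply: h1; split.
by rewrite !paste_r//; apply: h2; split.
Qed.

Section Piece.
Variables (d s k c1 rho1 c2 rho2 : R).

(** General solution of sigma^2 / 2 V'' - d V' - alpha V + s x + k = 0 when rho1 and rho2 are the
    two characteristic roots. The coefficients are normalised for v = V', on which all gluing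
    conditions are imposed. *)
Definition pieceV (x : R) : R := s / alpha * x + (k - d * (s / alpha)) / alpha
  + (c1 / rho1 * expR (rho1 * x) + c2 / rho2 * expR (rho2 * x)).
Definition piecev (x : R) : R := s / alpha + (c1 * expR (rho1 * x) + c2 * expR (rho2 * x)).
Definition piecew (x : R) : R := c1 * rho1 * expR (rho1 * x) + c2 * rho2 * expR (rho2 * x).

(** On each piece the Hamiltonian is affine in v, and its slope is absorbed into the drift: d = b
    where capacity rests, d = b - thl where it decreases at full rate. *)
Lemma piece_solution S (B : R) : rho1 != 0 -> rho2 != 0 ->
  charpoly alpha sigma d rho1 = 0 -> charpoly alpha sigma d rho2 = 0 ->
  (forall x, S x -> expR (rho1 * x) <= B) -> (forall x, S x -> expR (rho2 * x) <= B) ->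
  (forall x, S x -> holding_cost x = s * x) ->
  (forall x, S x -> hamiltonian (piecev x) = (b - d) * piecev x + k) ->
  local_solution S pieceV piecev piecew.
Proof.
move=> r1 r2 ch1 ch2 B1 B2 hS HS; split.
  have [L1 j1] := jet_expR B1; have [L2 j2] := jet_expR B2.
  exists (`|s / alpha| + (`|c1 / rho1| * L1 + `|c2 / rho2| * L2)).
  have := jetD (jet_affine S (s / alpha) ((k - d * (s / alpha)) / alpha))
    (jetD (jetZ (c1 / rho1) j1) (jetZ (c2 / rho2) j2)).
  congr (jet _ _ _ _ _); apply/funext => x /=.
  - by rewrite /piecev !mulrA !divfK.
  - by rewrite /piecew; field; rewrite r1 r2.
move=> x Sx; rewrite HS// hS//.
have e1 : sigma ^+ 2 / 2 * rho1 - d - alpha / rho1 = 0.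
  have -> : sigma ^+ 2 / 2 * rho1 - d - alpha / rho1 = charpoly alpha sigma d rho1 / rho1.
    by rewrite /charpoly; field.
  by rewrite ch1 mul0r.
have e2 : sigma ^+ 2 / 2 * rho2 - d - alpha / rho2 = 0.
  have -> : sigma ^+ 2 / 2 * rho2 - d - alpha / rho2 = charpoly alpha sigma d rho2 / rho2.
    by rewrite /charpoly; field.
  by rewrite ch2 mul0r.
have -> : sigma ^+ 2 / 2 * piecew x - b * piecev x - alpha * pieceV x + s * x +
   ((b - d) * piecev x + k) =
  c1 * expR (rho1 * x) * (sigma ^+ 2 / 2 * rho1 - d - alpha / rho1)
  + c2 * expR (rho2 * x) * (sigma ^+ 2 / 2 * rho2 - d - alpha / rho2).
  rewrite /piecew /piecev /pieceV; field.
  by rewrite r1 r2 gt_eqF.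
by rewrite e1 e2 !mulr0 addr0.
Qed.

End Piece.

Definition value_function (U : R) V v w :=
  [/\ local_solution setT V v w, forall x, - Ip <= v x,
    forall x, x <= U -> v x <= Dp & forall x, U <= x -> Dp <= v x].

Hypotheses (C0 : 0 < C) (M0 : 0 < M) (Dp0 : 0 <= Dp) (DC : Dp < C / alpha) (IM : M / alpha <= Ip).

Variables r1 r2 t1 t2 : R.
Hypotheses (r1_gt0 : 0 < r1) (r2_lt0 : r2 < 0) (t1_gt0 : 0 < t1) (t2_lt0 : t2 < 0).
Hypotheses (r2t2 : r2 < t2) (r1t1 : r1 < t1).
Hypotheses (chr1 : charpoly alpha sigma b r1 = 0) (chr2 : charpoly alpha sigma b r2 = 0).
Hypotheses (cht1 : charpoly alpha sigma (b - thl) t1 = 0)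
  (cht2 : charpoly alpha sigma (b - thl) t2 = 0).

Let J1 := (C - alpha * Dp) * (r1 - t2).
Let J3 := (C + M) * r1.

(** The distance from Dp up to the limit C / alpha of v at +oo. *)
Let kap := C / alpha - Dp.
Let kap0 : 0 < kap. Proof. by rewrite subr_gt0. Qed.
Let J1E : J1 = alpha * kap * (r1 - t2).
Proof. by rewrite /J1 /kap; field; rewrite gt_eqF. Qed.
Let J1_gt0 : 0 < J1. Proof.
rewrite J1E; apply: mulr_gt0; first exact: mulr_gt0.
by rewrite subr_gt0; exact: lt_trans t2_lt0 r1_gt0.
Qed.
Let J3_gt0 : 0 < J3. Proof. by rewrite /J3 mulr_gt0// addr_gt0. Qed.

Lemma expR_tangent (a y : R) : expR a * (1 + (y - a)) <= expR y.
Proof.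
have -> : expR y = expR a * expR (y - a) by rewrite -expRD; congr expR; ring.
by apply: ler_wpM2l; [exact: expR_ge0|exact: expR_ge1Dx].
Qed.

(** Boundedness of v leaves one exponential on each outer piece. The unknowns [a], [b1], [b2], [g],
    U are fixed by continuity of v and w at 0, the value Dp of v at U from both sides, and
    continuity of w at U. *)
Lemma value_function_right (U : R) : J1 <= J3 ->
  U = 1 / (- r2) * ln (J3 / J1) -> 0 <= U ->
  exists V v w, value_function U V v w.
Proof.
move=> J13 UE U0.
(* The conditions at 0 determine [b2], those at U determine [b2] times exp (r2 U); this quotient is
   the equation for U. *)
have e2E : expR (r2 * U) = J1 / J3.
  have -> : r2 * U = - ln (J3 / J1) by rewrite UE; field; rewrite lt_eqF.
  by rewrite expRN lnK ?posrE ?divr_gt0// invf_div.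
pose e1 := expR (r1 * U); pose e3 := expR (t2 * U).
have e10 : 0 < e1 by exact: expR_gt0.
have e30 : 0 < e3 by exact: expR_gt0.
pose b2 := - (r1 * (C + M)) / (alpha * (r1 - r2)).
pose b1 := kap * (r2 - t2) / (r1 - r2) / e1.
pose a := (r1 * b1 + r2 * b2) / r1.
pose g := - kap / e3.
have r12 : 0 < r1 - r2 by rewrite subr_gt0; exact: lt_trans r2_lt0 r1_gt0.
have r1t2 : 0 < r1 - t2 by rewrite subr_gt0; exact: lt_trans t2_lt0 r1_gt0.
have CM : 0 < C + M by exact: addr_gt0.
have b1_lt0 : b1 < 0.
  by rewrite /b1 pmulr_llt0 ?invr_gt0// pmulr_llt0 ?invr_gt0// pmulr_rlt0// subr_lt0.
have b2_lt0 : b2 < 0.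
  rewrite /b2 mulNr oppr_lt0 divr_gt0// mulr_gt0// addr_gt0//.
have b1e : b1 * e1 = kap * (r2 - t2) / (r1 - r2) by rewrite /b1 divfK// gt_eqF.
have b2e : b2 * expR (r2 * U) = - kap * (r1 - t2) / (r1 - r2).
  rewrite e2E J1E /J3 /b2; field.
  by rewrite !gt_eqF.
have ge : g * e3 = - kap by rewrite /g divfK// gt_eqF.
have vU : b1 * e1 + b2 * expR (r2 * U) = - kap.
  by rewrite b1e b2e; field; rewrite gt_eqF.
have wU : b1 * r1 * e1 + b2 * r2 * expR (r2 * U) = - t2 * kap.
  rewrite mulrAC b1e (mulrAC b2) b2e; field; by rewrite gt_eqF.
have v0 : - M / alpha + a = C / alpha + (b1 + b2).
  rewrite /a /b2; field; by rewrite !gt_eqF.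
have a_gt0 : 0 < a.
  rewrite /a divr_gt0//.
  (* The right side is w at 0+, equal to r1 [a], and the left side is w at U, which is positive; w
     decreases between them because both of its terms do. *)
  have h1 : b1 * r1 * e1 + b2 * r2 * expR (r2 * U) <= b1 * r1 + b2 * r2.
    have q1 : 1 <= e1 by rewrite -[leLHS](@expR0 R) ler_expR mulr_ge0// ltW.
    have q2 : expR (r2 * U) <= 1 by rewrite -[leRHS](@expR0 R) ler_expR mulr_le0_ge0// ltW.
    apply: lerD; first by rewrite ger_nMr// nmulr_rlt0//.
    by rewrite ger_pMr// nmulr_rgt0.
  have : 0 < - t2 * kap by rewrite mulr_gt0// oppr_gt0.
  by move=> w0; rewrite (mulrC r1 b1) (mulrC r2 b2); apply: lt_le_trans h1; rewrite wU.
(* On an outer piece the second exponential has coefficient 0, and its exponent repeats the first so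
   that the root conditions hold. *)
pose VL := pieceV b (- M) 0 a r1 0 r1; pose vL := piecev (- M) a r1 0 r1; pose wL := piecew a
  r1 0 r1.
pose VM := pieceV b C 0 b1 r1 b2 r2; pose vM := piecev C b1 r1 b2 r2; pose wM := piecew b1 r1 b2 r2.
pose VR := pieceV (b - thl) C (- thl * Dp) g t2 0 t2; pose vR := piecev C g t2 0 t2; pose wR :=
  piecew g t2 0 t2.
have vLE x : vL x = - M / alpha + a * expR (r1 * x) by rewrite /vL /piecev mul0r addr0.
have vRE x : vR x = C / alpha + g * expR (t2 * x) by rewrite /vR /piecev mul0r addr0.
have vM_U : vM U = Dp by rewrite /vM /piecev vU /kap; ring.
(* On the middle piece v is concave, so it lies below its tangent at U. *)
have wM_ge x : 0 <= x -> x <= U -> 0 <= wM x.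
  move=> x0 xU; apply: (@le_trans _ _ (- t2 * kap)).
    by rewrite mulr_ge0 ?(ltW kap0)// oppr_ge0 ltW.
  rewrite -wU /wM /piecew; apply: lerD.
    rewrite ler_nM2l; last by rewrite nmulr_rlt0.
    by rewrite ler_expR ler_pM2l.
  rewrite ler_pM2l; last by rewrite nmulr_rgt0.
  by rewrite ler_expR ler_nM2l.
have vM_tan x y : vM x <= vM y + wM y * (x - y).
  rewrite /vM /piecev /wM /piecew -addrA lerD2l.
  have -> : b1 * expR (r1 * y) + b2 * expR (r2 * y) +
     (b1 * r1 * expR (r1 * y) + b2 * r2 * expR (r2 * y)) * (x - y) =
     b1 * (expR (r1 * y) * (1 + (r1 * x - r1 * y))) + b2 * (expR (r2 * y) * (1 + (r2 * x - r2 *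
       y))).
    by ring.
  by apply: lerD; rewrite ler_nM2l// expR_tangent.
have vM_le x : 0 <= x -> x <= U -> vM x <= Dp.
  move=> x0 xU; rewrite -vM_U; apply: (le_trans (vM_tan x U)).
  by rewrite gerDl mulr_ge0_le0 ?subr_le0// wM_ge.
have vM_ge x : 0 <= x -> x <= U -> vM 0 <= vM x.
  move=> x0 xU; apply: (le_trans (vM_tan 0 x)).
  by rewrite gerDl sub0r mulrN oppr_le0 mulr_ge0// wM_ge.
have vL0 : vL 0 = vM 0 by rewrite vLE /vM /piecev !mulr0 expR0 !mulr1 v0.
have vL_le x : x <= 0 -> vL x <= vL 0.
  by move=> x0; rewrite !vLE lerD2l ler_pM2l// ler_expR mulr0 mulr_ge0_le0// ltW.
have vL_ge x : - M / alpha <= vL x.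
  by rewrite vLE lerDl mulr_ge0 ?expR_ge0// ltW.
have vR_ge x : U <= x -> Dp <= vR x.
  move=> Ux; rewrite vRE.
  have : g * e3 <= g * expR (t2 * x).
    rewrite ler_nM2l; last by rewrite /g mulNr oppr_lt0 divr_gt0.
    by rewrite ler_expR ler_nM2l.
  rewrite ge /kap; lra.
have solL : local_solution (setT `&` [set x | x <= 0]) VL vL wL.
  apply: (@piece_solution b _ _ _ _ _ _ _ 1) => //; try by [rewrite gt_eqF|assumption].
  - by move=> x [_ /= x0]; rewrite -[leRHS](@expR0 R) ler_expR mulr_ge0_le0// ltW.
  - by move=> x [_ /= x0]; rewrite -[leRHS](@expR0 R) ler_expR mulr_ge0_le0// ltW.
  - by move=> x [_ /= x0]; exact: holding_cost_le.
  - move=> x [_ /= x0]; rewrite subrr mul0r addr0; apply: hamiltonian_le.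
    by apply: (le_trans (vL_le x x0)); rewrite vL0 vM_le.
have solM : local_solution ((setT `&` [set x | 0 <= x]) `&` [set x | x <= U]) VM vM wM.
  apply: (@piece_solution b _ _ _ _ _ _ _ e1) => //;
    try by [rewrite gt_eqF|rewrite lt_eqF|assumption].
  - by move=> x [[_ /= x0] xU]; rewrite ler_expR ler_pM2l.
  - move=> x [[_ /= x0] xU]; apply: (@le_trans _ _ 1).
      by rewrite -[leRHS](@expR0 R) ler_expR mulr_le0_ge0// ltW.
    by rewrite -[leLHS](@expR0 R) ler_expR mulr_ge0// ltW.
  - by move=> x [[_ /= x0] xU]; exact: holding_cost_pos.
  - by move=> x [[_ /= x0] xU]; rewrite subrr mul0r addr0; apply: hamiltonian_le; exact: vM_le.
have solR : local_solution ((setT `&` [set x | 0 <= x]) `&` [set x | U <= x]) VR vR wR.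
  apply: (@piece_solution (b - thl) _ _ _ _ _ _ _ 1) => //;
    try by [rewrite gt_eqF|rewrite lt_eqF|assumption].
  - by move=> x [[_ /= x0] xU]; rewrite -[leRHS](@expR0 R) ler_expR mulr_le0_ge0// ltW.
  - by move=> x [[_ /= x0] xU]; rewrite -[leRHS](@expR0 R) ler_expR mulr_le0_ge0// ltW.
  - by move=> x [[_ /= x0] xU]; exact: holding_cost_pos.
  - move=> x [[_ /= x0] xU]; rewrite hamiltonian_ge; last exact: vR_ge.
    by rewrite /vR; ring.
have vMR : vM U = vR U by rewrite vM_U vRE -/e3 ge /kap; ring.
have wMR : wM U = wR U by rewrite /wM /wR /piecew wU !mul0r addr0 mulrAC -/e3 ge; ring.
have wLM : wL 0 = wM 0.
  rewrite /wL /wM /piecew !mulr0 expR0 /a; field; by rewrite gt_eqF.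
have sol1 := local_solution_paste (conj Logic.I U0 : (setT `&` [set x | 0 <= x]) U) solM solR
  vMR wMR.
have sol := local_solution_paste (Logic.I : setT 0) solL sol1.
rewrite !(paste_l _ _ U0) in sol; have {}sol := sol vL0 wLM.
exists (paste 0 VL (paste U VM VR)), (paste 0 vL (paste U vM vR)), (paste 0 wL (paste U wM wR)).
have g0 : vL 0 = paste U vM vR 0 by rewrite paste_l.
have v0ge x : 0 <= x -> vM 0 <= paste U vM vR x.
  move=> x0; have [xU|/ltW Ux] := leP x U; first by rewrite paste_l// vM_ge.
  by rewrite paste_r//; apply: le_trans (vR_ge x Ux); exact: vM_le.
split => //.
- move=> x; apply: (@le_trans _ _ (- M / alpha)); first by rewrite mulNr lerN2.
  have [x0|/ltW x0] := leP x 0; first by rewrite paste_l.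
  by rewrite paste_r//; apply: le_trans (v0ge x x0); rewrite -vL0.
- move=> x xU; have [x0|/ltW x0] := leP x 0.
    by rewrite paste_l//; apply: (le_trans (vL_le x x0)); rewrite vL0 vM_le.
  by rewrite paste_r// paste_l// vM_le.
- move=> x Ux; have x0 := le_trans U0 Ux.
  by rewrite paste_r// paste_r// vR_ge.
Qed.

(** Now the middle piece [U, 0] has holding cost slope - M and drift b - thl, hence the roots t1 and
    t2. The conditions at 0 fix [g1], those at U fix [g1] times exp (t1 U), and comparing them gives
    U. Positivity of [g2] is where r1 < t1 enters. *)
Lemma value_function_left (U : R) :
  U = 1 / t1 * ln ((alpha * Dp + M) * (r1 - t2) / ((C + M) * (- t2))) -> U < 0 ->
  exists V v w, value_function U V v w.
Proof.
move=> UE /ltW U0.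
(* The distance from the limit - M / alpha of v at -oo up to Dp. *)
pose lam := Dp + M / alpha.
have lam_gt0 : 0 < lam by rewrite ltr_wpDl// divr_gt0.
have r1t2 : 0 < r1 - t2 by rewrite subr_gt0; exact: lt_trans t2_lt0 r1_gt0.
have t12 : 0 < t1 - t2 by rewrite subr_gt0; exact: lt_trans t2_lt0 t1_gt0.
have CM : 0 < C + M by exact: addr_gt0.
have nt2 : 0 < - t2 by rewrite oppr_gt0.
have alam : alpha * Dp + M = alpha * lam by rewrite /lam; field; rewrite gt_eqF.
have e1E : expR (t1 * U) = alpha * lam * (r1 - t2) / ((C + M) * (- t2)).
  have -> : t1 * U = ln ((alpha * Dp + M) * (r1 - t2) / ((C + M) * (- t2))).
    by rewrite UE; field; rewrite gt_eqF.
  rewrite alam lnK ?posrE// divr_gt0//; last exact: mulr_gt0.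
  by apply: mulr_gt0 => //; exact: mulr_gt0.
pose e2 := expR (t2 * U); pose e3 := expR (r1 * U).
have e20 : 0 < e2 by exact: expR_gt0.
have e30 : 0 < e3 by exact: expR_gt0.
pose g1 := - t2 * (C + M) / (alpha * (t1 - t2)).
pose g2 := lam * (t1 - r1) / (t1 - t2) / e2.
pose g := (t1 * g1 + t2 * g2) / t2.
pose a := lam / e3.
have g1_gt0 : 0 < g1 by rewrite /g1 divr_gt0// mulr_gt0.
have g2_gt0 : 0 < g2.
  by rewrite /g2 divr_gt0// divr_gt0// mulr_gt0// subr_gt0.
have a_gt0 : 0 < a by exact: divr_gt0.
have g1e : g1 * expR (t1 * U) = lam * (r1 - t2) / (t1 - t2).
  by rewrite e1E /g1; field; rewrite (lt_eqF t2_lt0) !gt_eqF.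
have g2e : g2 * e2 = lam * (t1 - r1) / (t1 - t2) by rewrite /g2 divfK// gt_eqF.
have ae : a * e3 = lam by rewrite /a divfK// gt_eqF.
have vU : g1 * expR (t1 * U) + g2 * e2 = lam.
  by rewrite g1e g2e; field; rewrite gt_eqF.
have wU : g1 * t1 * expR (t1 * U) + g2 * t2 * e2 = lam * r1.
  by rewrite mulrAC g1e (mulrAC g2) g2e; field; rewrite gt_eqF.
have v0 : - M / alpha + (g1 + g2) = C / alpha + g.
  by rewrite /g /g1; field; rewrite (lt_eqF t2_lt0) !gt_eqF.
pose VL := pieceV b (- M) 0 a r1 0 r1; pose vL := piecev (- M) a r1 0 r1; pose wL := piecew a
  r1 0 r1.
pose VM := pieceV (b - thl) (- M) (- thl * Dp) g1 t1 g2 t2; pose vM := piecev (- M) g1 t1 g2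
  t2; pose wM := piecew g1 t1 g2 t2.
pose VR := pieceV (b - thl) C (- thl * Dp) g t2 0 t2; pose vR := piecev C g t2 0 t2; pose wR :=
  piecew g t2 0 t2.
have vLE x : vL x = - M / alpha + a * expR (r1 * x) by rewrite /vL /piecev mul0r addr0.
have vRE x : vR x = C / alpha + g * expR (t2 * x) by rewrite /vR /piecev mul0r addr0.
have vM_U : vM U = Dp by rewrite /vM /piecev vU /lam; ring.
(* On the middle piece v is convex, so it lies above its tangent at U. *)
have wM_U : wM U = lam * r1 by [].
have wM0 : wM U <= wM 0.
  rewrite /wM /piecew; apply: lerD.
    by rewrite ler_pM2l; [rewrite ler_expR ler_pM2l|exact: mulr_gt0].
  by rewrite ler_nM2l; [rewrite ler_expR ler_nM2l|rewrite pmulr_rlt0].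
have vM_ge x : U <= x -> Dp <= vM x.
  move=> Ux; apply: (@le_trans _ _ (vM U + wM U * (x - U))).
    by rewrite vM_U wM_U lerDl !mulr_ge0 ?subr_ge0// ltW.
  rewrite /vM /piecev /wM /piecew -addrA lerD2l.
  have -> : g1 * expR (t1 * U) + g2 * expR (t2 * U) +
     (g1 * t1 * expR (t1 * U) + g2 * t2 * expR (t2 * U)) * (x - U) =
     g1 * (expR (t1 * U) * (1 + (t1 * x - t1 * U))) + g2 * (expR (t2 * U) * (1 + (t2 * x - t2 *
       U))).
    by ring.
  by apply: lerD; rewrite ler_pM2l// expR_tangent.
have w0 : wM 0 = t1 * g1 + t2 * g2 by rewrite /wM /piecew !mulr0 expR0; ring.
(* t2 [g] is w at 0, which is at least w at U by convexity of v, hence positive, while t2 is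
   negative. *)
have g_lt0 : g < 0.
  rewrite /g -w0 ltr_ndivrMr// mul0r; apply: lt_le_trans wM0.
  by rewrite wM_U mulr_gt0.
have vMR : vM 0 = vR 0.
  by rewrite vRE /vM /piecev !mulr0 expR0 !mulr1 v0.
have vR_ge x : 0 <= x -> Dp <= vR x.
  move=> x0; apply: (@le_trans _ _ (vR 0)); first by rewrite -vMR vM_ge.
  rewrite !vRE lerD2l ler_nM2l// ler_expR mulr0 mulr_le0_ge0//; exact: ltW.
have vLU : vL U = vM U by rewrite vLE vM_U -/e3 ae /lam; ring.
have vL_le x : x <= U -> vL x <= Dp.
  by move=> xU; rewrite -vM_U -vLU !vLE lerD2l ler_pM2l// ler_expR ler_pM2l.
have vL_ge x : - M / alpha <= vL x.
  by rewrite vLE lerDl mulr_ge0 ?expR_ge0// ltW.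
have solL : local_solution (setT `&` [set x | x <= U]) VL vL wL.
  apply: (@piece_solution b _ _ _ _ _ _ _ e3) => //; try by [rewrite gt_eqF|assumption].
  - by move=> x [_ /= xU]; rewrite ler_expR ler_pM2l.
  - by move=> x [_ /= xU]; rewrite ler_expR ler_pM2l.
  - by move=> x [_ /= xU]; apply: holding_cost_le; exact: le_trans U0.
  - by move=> x [_ /= xU]; rewrite subrr mul0r addr0; apply: hamiltonian_le; exact: vL_le.
have solM : local_solution ((setT `&` [set x | U <= x]) `&` [set x | x <= 0]) VM vM wM.
  apply: (@piece_solution (b - thl) _ _ _ _ _ _ _ (Num.max 1 e2)) => //;
    try by [rewrite gt_eqF|rewrite lt_eqF|assumption].
  - move=> x [[_ /= Ux] x0]; rewrite le_max -[X in _ <= X](@expR0 R) ler_expR.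
    by rewrite mulr_ge0_le0// ltW.
  - by move=> x [[_ /= Ux] x0]; rewrite le_max ler_expR ler_nM2l// Ux orbT.
  - by move=> x [[_ /= Ux] x0]; exact: holding_cost_le.
  - move=> x [[_ /= Ux] x0]; rewrite hamiltonian_ge; last exact: vM_ge.
    by rewrite /vM; ring.
have solR : local_solution ((setT `&` [set x | U <= x]) `&` [set x | 0 <= x]) VR vR wR.
  apply: (@piece_solution (b - thl) _ _ _ _ _ _ _ 1) => //;
    try by [rewrite gt_eqF|rewrite lt_eqF|assumption].
  - by move=> x [[_ /= Ux] x0]; rewrite -[leRHS](@expR0 R) ler_expR mulr_le0_ge0// ltW.
  - by move=> x [[_ /= Ux] x0]; rewrite -[leRHS](@expR0 R) ler_expR mulr_le0_ge0// ltW.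
  - by move=> x [[_ /= Ux] x0]; exact: holding_cost_pos.
  - move=> x [[_ /= Ux] x0]; rewrite hamiltonian_ge; last exact: vR_ge.
    by rewrite /vR; ring.
have wMR : wM 0 = wR 0.
  by rewrite w0 /wR /piecew mulr0 expR0 /g; field; rewrite lt_eqF.
have wLM : wL U = wM U.
  by rewrite wM_U /wL /piecew mulrAC -/e3 ae; ring.
have sol1 := local_solution_paste (conj Logic.I U0 : (setT `&` [set x | U <= x]) 0) solM solR
  vMR wMR.
have sol := local_solution_paste (Logic.I : setT U) solL sol1.
rewrite !(paste_l _ _ U0) in sol; have {}sol := sol vLU wLM.
exists (paste U VL (paste 0 VM VR)), (paste U vL (paste 0 vM vR)), (paste U wL (paste 0 wM wR)).
have gU : vL U = paste 0 vM vR U by rewrite paste_l.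
have vUge x : U <= x -> Dp <= paste 0 vM vR x.
  move=> Ux; have [x0|/ltW x0] := leP x 0; first by rewrite paste_l// vM_ge.
  by rewrite paste_r// vR_ge.
split => //.
- move=> x; apply: (@le_trans _ _ (- M / alpha)); first by rewrite mulNr lerN2.
  have [xU|/ltW Ux] := leP x U; first by rewrite paste_l.
  rewrite paste_r//; apply: le_trans (vUge x Ux); apply: le_trans Dp0.
  by rewrite mulNr oppr_le0 divr_ge0// ltW.
- by move=> x xU; rewrite paste_l// vL_le.
- by move=> x Ux; rewrite paste_r// vUge.
Qed.

Lemma threshold_right_ge0 : J1 <= J3 -> 0 <= 1 / (- r2) * ln (J3 / J1).
Proof.
move=> J13; rewrite mulr_ge0 ?divr_ge0 ?oppr_ge0 ?(ltW r2_lt0)//.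
by apply: ln_ge0; rewrite ler_pdivlMr// mul1r.
Qed.

(** Denominator minus numerator inside the logarithm is exactly J1 - J3. *)
Lemma threshold_left_lt0 : J3 < J1 ->
  1 / t1 * ln ((alpha * Dp + M) * (r1 - t2) / ((C + M) * (- t2))) < 0.
Proof.
move=> J31; rewrite pmulr_rlt0 ?divr_gt0//.
have CM : 0 < C + M by exact: addr_gt0.
have d0 : 0 < (C + M) * (- t2) by rewrite mulr_gt0// oppr_gt0.
have n0 : 0 < (alpha * Dp + M) * (r1 - t2).
  rewrite mulr_gt0//; first by rewrite ltr_wpDl// mulr_ge0// ltW.
  by rewrite subr_gt0; exact: lt_trans t2_lt0 r1_gt0.
rewrite ln_lt0// divr_gt0//= ltr_pdivrMr// mul1r -subr_gt0.
have -> : (C + M) * (- t2) - (alpha * Dp + M) * (r1 - t2) = J1 - J3 by rewrite /J1 /J3; ring.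
by rewrite subr_gt0.
Qed.

End ValueFunction.

(** * The threshold policy *)

Section EulerScheme.
Context {R : realType}.
Variables (th p0 : R) (B : R -> R).
Hypothesis th0 : th < 0.
Hypothesis cB : {within `[0, +oo[, continuous B}.

Lemma within_continuous_uniform (T e : R) : 0 < e -> exists2 dl, 0 < dl &
  forall s t, 0 <= s <= T -> 0 <= t <= T -> `|s - t| < dl -> `|B s - B t| <= e.
Proof.
move=> e0; have /compact_near_coveringP /(_ _ ((0 : R)^'+)
  (fun dl x => 0 <= x -> forall y, 0 <= y -> `|x - y| < dl -> `|B x - B y| <= e) _) :=
    @segment_compact R 0 T.
have F : forall x : R, x \in `[0, T] -> \forall x' \near x & dl \near (0 : R)^'+,
    0 <= x' -> forall y, 0 <= y -> `|x' - y| < dl -> `|B x' - B y| <= e.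
  move=> x; rewrite in_itv/= => /andP[x0 xT].
  have [|d d0 dB] := (within_continuousP B).1 cB x x0 (e / 2); first exact: divr_gt0.
  have d2 : 0 < d / 2 by exact: divr_gt0.
  exists (ball x (d / 2), [set dl | 0 < dl < d / 2]) => /=.
    split; first exact: nbhsx_ballx.
    near=> dl => /=; apply/andP; split; near: dl; [exact: nbhs_right_gt|exact: nbhs_right_lt].
  move=> [x' dl] /= [xx' /andP[dl0 dld]] x'0 y y0 xy.
  have h1 : `|x' - x| < d / 2 by rewrite distrC.
  have := dB x' x'0 (lt_trans h1 _); rewrite ltr_pdivrMr// ltr_pMr// ltr1n => /(_ isT) h2.
  have h3 : `|y - x| < d.
    apply: (le_lt_trans (ler_distD x' _ _)); rewrite [ltRHS](splitr d) distrC.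
    by apply: ltrD => //; exact: lt_trans dld.
  apply: (le_trans (ler_distD (B x) _ _)); rewrite [leRHS](splitr e).
  by apply: lerD; apply: ltW => //; rewrite distrC; exact: dB.
move=> /(_ F) [d /= d0 dP].
exists (d / 2); first exact: divr_gt0.
move=> s t sT /andP[t0 _] st; apply: (dP (d / 2)) => //.
- by rewrite /= sub0r normrN ger0_norm ?divr_ge0// ?(ltW d0)// ltr_pdivrMr// ltr_pMr// ltr1n.
- exact: divr_gt0.
- by case/andP: sT.
Unshelve. all: by end_near. Qed.

(* euler n k is the value at time k / 2^n. *)
Fixpoint euler (n k : nat) : R :=
  if k is k'.+1 then
    euler n k' + th / 2 ^+ n * (B (k'%:R / 2 ^+ n) < euler n k')%R%:R
  else p0.

Let mesh_gt0 n : 0 < 2 ^+ n :> R. Proof. exact: exprn_gt0. Qed.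

Let step_le0 n : th / 2 ^+ n <= 0.
Proof. by rewrite mulr_le0_ge0// ?invr_ge0 ltW. Qed.

Lemma eulerD n k i : th / 2 ^+ n * i%:R <= euler n (k + i) - euler n k <= 0.
Proof.
elim: i => [|i /andP[h1 h2]]; first by rewrite addn0 subrr mulr0 lexx.
rewrite addnS /= [i.+1%:R]mulrSr mulrDr mulr1.
have := step_le0 n; case: (_ < _); rewrite /= ?mulr1 ?mulr0; lra.
Qed.

Lemma euler_constant (q : bool) n k i :
  (forall j, (j < i)%N -> (B ((k + j)%:R / 2 ^+ n) < euler n (k + j))%R = q) ->
  euler n (k + i) - euler n k = th * q%:R * (i%:R / 2 ^+ n).
Proof.
elim: i => [_|i IH H]; first by rewrite addn0 subrr mul0r mulr0.
rewrite addnS /= H// addrAC IH => [|j ji]; last by apply: H; exact: ltnW.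
by rewrite [i.+1%:R]mulrSr; ring.
Qed.

(* The feedback is monotone, so the error between two meshes can only grow while
   it is below the oscillation of the barrier over one coarse mesh. *)
Lemma dissipative_step (a c x y z e s h : R) : s <= h -> h <= 0 -> s <= x -> x <= 0 ->
  `|y - z| <= e -> `|a - (c + x)| <= e - 2 * s ->
  `|a + h * (y < a)%R%:R - (c + x + h * (z < c)%R%:R)| <= e - 2 * s.
Proof.
move=> sh h0 sx x0; rewrite !ler_norml => /andP[yz1 yz2] /andP[ac1 ac2].
have [ya|ya] := ltP y a; have [zc|zc] := ltP z c; rewrite ?mulr1 ?mulr0; lra.
Qed.

(** Within a coarse step the fine scheme is compared with the coarse one moved linearly under its
    frozen feedback; at i = 2^m this is the next coarse value. By [dissipative_step] the bound does
    not grow with k. *)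
Lemma euler_refine n m (T e : R) : 0 <= e ->
  (forall s t, 0 <= s <= T -> 0 <= t <= T -> `|s - t| <= (2 ^+ n)^-1 -> `|B s - B t| <= e) ->
  forall k i, (i <= 2 ^ m)%N -> (k * 2 ^ m + i)%:R / 2 ^+ (n + m) <= T ->
  `|euler (n + m) (k * 2 ^ m + i)
     - (euler n k + th / 2 ^+ (n + m) * i%:R * (B (k%:R / 2 ^+ n) < euler n k)%R%:R)|
  <= e - 2 * (th / 2 ^+ n).
Proof.
move=> e0 osc; have sn := step_le0 n; have snm := step_le0 (n + m).
have meshE : (2 ^+ n)^-1 = (2 ^ m)%N%:R / 2 ^+ (n + m) :> R.
  by rewrite exprD natrX; field; rewrite !gt_eqF.
have snE : th / 2 ^+ n = th / 2 ^+ (n + m) * (2 ^ m)%N%:R.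
  by rewrite meshE; ring.
have bound0 : 0 <= e - 2 * (th / 2 ^+ n) by lra.
have inner k : `|euler (n + m) (k * 2 ^ m) - euler n k| <= e - 2 * (th / 2 ^+ n) ->
    forall i, (i <= 2 ^ m)%N -> (k * 2 ^ m + i)%:R / 2 ^+ (n + m) <= T ->
  `|euler (n + m) (k * 2 ^ m + i)
     - (euler n k + th / 2 ^+ (n + m) * i%:R * (B (k%:R / 2 ^+ n) < euler n k)%R%:R)|
  <= e - 2 * (th / 2 ^+ n).
  move=> H0; elim=> [|i IHi] im iT; first by rewrite addn0 mulr0 mul0r addr0.
  rewrite addnS /= [i.+1%:R]mulrSr (mulrDr _ i%:R) mulr1 (mulrDl _ _ (_%:R)) [in X in `|X|]addrA.
  have iT' : (k * 2 ^ m + i)%:R / 2 ^+ (n + m) <= T.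
    by apply: le_trans iT; rewrite ler_pM2r ?invr_gt0// ler_nat addnS.
  have xs : th / 2 ^+ n <= th / 2 ^+ (n + m) * i%:R <= 0.
    by rewrite snE ler_wnM2l ?ler_nat 1?ltnW// mulr_le0_ge0.
  have kE : k%:R / 2 ^+ n = (k * 2 ^ m)%N%:R / 2 ^+ (n + m) :> R by rewrite natrM meshE mulrA.
  apply: dissipative_step => //.
  - rewrite snE -[leRHS]mulr1 ler_wnM2l// ler1n expn_gt0//.
  - by case: (_ < _); rewrite ?mulr1 ?mulr0//; case/andP: xs.
  - by case: (_ < _); rewrite ?mulr1 ?mulr0//; case/andP: xs.
  - rewrite kE; apply: osc.
    + by rewrite iT' andbT divr_ge0// ltW.
    + apply/andP; split; first by rewrite divr_ge0// ltW.
      apply: le_trans iT'.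
      by rewrite ler_pM2r ?invr_gt0// ler_nat leq_addr.
    + rewrite -mulrBl natrD addrAC subrr add0r ger0_norm; last by rewrite divr_ge0// ltW.
      by rewrite meshE ler_pM2r ?invr_gt0// ler_nat ltnW.
  - by apply: IHi => //; exact: ltnW.
suff outer k : (k * 2 ^ m)%:R / 2 ^+ (n + m) <= T ->
    `|euler (n + m) (k * 2 ^ m) - euler n k| <= e - 2 * (th / 2 ^+ n).
  move=> k i im iT; apply: inner => //; apply: outer; apply: le_trans iT.
  by rewrite ler_pM2r ?invr_gt0// ler_nat leq_addr.
elim: k => [_|k IH kT]; first by rewrite mul0n /= subrr normr0.
have := inner k _ (2 ^ m)%N (leqnn _).
rewrite -snE -mulSnr /=; apply => //; apply: IH; apply: le_trans kT.
by rewrite ler_pM2r ?invr_gt0// ler_nat leq_mul2r leqnSn orbT.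
Qed.

Definition euler_path (n : nat) (t : R) : R := euler n (Num.truncn (t * 2 ^+ n)).

Lemma truncn_refine n m (t : R) : 0 <= t -> exists i, (i <= 2 ^ m)%N /\
  Num.truncn (t * 2 ^+ (n + m)) = (Num.truncn (t * 2 ^+ n) * 2 ^ m + i)%N.
Proof.
move=> t0; set k := Num.truncn (t * 2 ^+ n).
have /truncn_itv /andP[h1 h2] : 0 <= t * 2 ^+ n by rewrite mulr_ge0// ltW.
have tnm : 0 <= t * 2 ^+ (n + m) by rewrite mulr_ge0// ltW.
have E : t * 2 ^+ (n + m) = t * 2 ^+ n * (2 ^ m)%N%:R by rewrite exprD natrX mulrA.
have h3 : (k * 2 ^ m <= Num.truncn (t * 2 ^+ (n + m)))%N.
  by rewrite truncn_ge_nat// E natrM ler_pM2r// natrX.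
have h4 : (Num.truncn (t * 2 ^+ (n + m)) < k.+1 * 2 ^ m)%N.
  by rewrite truncn_lt_nat// E natrM ltr_pM2r// natrX.
exists (Num.truncn (t * 2 ^+ (n + m)) - k * 2 ^ m)%N; split; last by rewrite subnKC.
by rewrite leq_subLR -mulSnr ltnW.
Qed.

Lemma euler_path_cauchy (T e : R) : 0 < e -> exists N, forall n m t, (N <= n)%N -> t <= T ->
  `|euler_path (n + m) t - euler_path n t| <= e.
Proof.
move=> e0; have [|dl dl0 osc] := @within_continuous_uniform T (e / 2); first exact: divr_gt0.
have th3 : 0 < - (6 * th) by rewrite oppr_gt0 pmulr_rlt0.
(* The refinement bound costs two coarse displacements and the motion inside a coarse step one more;
   the three must fit into e / 2. *)
pose ga := Num.min dl (e / (- (6 * th))).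
have ga0 : 0 < ga by rewrite lt_min dl0 divr_gt0.
have [N _ NP] := near_infty_natSinv_expn_lt (PosNum ga0).
exists N => n m t /NP /=; rewrite /euler_path.
rewrite lt_min div1r => /andP[ndl]; rewrite ltr_pdivlMr// => nth tT.
have [t0|t0] := ltP t 0.
  have tz k : Num.truncn (t * 2 ^+ k) = 0%N.
    by rewrite truncn_floor leNgt pmulr_llt0// t0.
  by rewrite !tz /= subrr normr0 ltW.
have [i [im ->]] := truncn_refine n m t0.
set k := Num.truncn _.
have kt : k%:R / 2 ^+ n <= t by rewrite ler_pdivrMr// /k truncn_le// mulr_ge0// ltW.
have kE : k%:R / 2 ^+ n = (k * 2 ^ m)%N%:R / 2 ^+ (n + m) :> R.
  by rewrite natrM exprD natrX; field; rewrite !gt_eqF.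
have := @euler_refine n m T (e / 2) _ _ k 0 isT; rewrite !addn0 mulr0 mul0r addr0 => H.
have {}H : `|euler (n + m) (k * 2 ^ m) - euler n k| <= e / 2 - 2 * (th / 2 ^+ n).
  apply: H; first by rewrite divr_ge0// ltW.
  - by move=> s u sT uT su; apply: osc => //; exact: le_lt_trans ndl.
  - by rewrite -kE; exact: le_trans tT.
have /andP[l1 l2] := eulerD (n + m) (k * 2 ^ m) i.
have l3 : th / 2 ^+ n <= th / 2 ^+ (n + m) * i%:R.
  have -> : th / 2 ^+ n = th / 2 ^+ (n + m) * (2 ^ m)%N%:R.
    by rewrite exprD natrX; field; rewrite !gt_eqF.
  by rewrite ler_wnM2l// ler_nat.
move: H nth l1 l2 l3; rewrite mulrN -/k => H nth l1 l2 l3.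
move: H; rewrite !ler_norml => /andP[H1 H2]; apply/andP; split; lra.
Qed.

Definition tracking_path (t : R) : R := limn (fun n => euler_path n t).

Lemma euler_path_cvg t : euler_path n t @[n --> \oo] --> tracking_path t.
Proof.
suff : cvgn (fun n => euler_path n t) by [].
apply/cauchy_cvgP/cauchy_exP => e e0.
have [|N NP] := @euler_path_cauchy t (e / 2); first exact: divr_gt0.
exists (euler_path N t); exists N => // n /= Nn; rewrite /ball/= distrC.
rewrite -(subnKC Nn); apply: le_lt_trans (NP N _ t (leqnn _) (lexx _)) _.
by rewrite ltr_pdivrMr// ltr_pMr// ltr1n.
Qed.

Lemma tracking_path_uniform (T e : R) : 0 < e -> exists n, (2 ^+ n)^-1 <= e /\
  forall t, t <= T -> `|tracking_path t - euler_path n t| <= e.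
Proof.
move=> e0; have [N NP] := @euler_path_cauchy T e e0.
have [M _ MP] := near_infty_natSinv_expn_lt (PosNum e0).
exists (maxn N M); split; first by rewrite -div1r ltW// MP//= leq_maxr.
move=> t tT; set n := maxn N M.
have c : `|euler_path k t - euler_path n t| @[k --> \oo] --> `|tracking_path t - euler_path n t|.
  by apply: cvg_norm; apply: cvgB; [exact: euler_path_cvg|exact: cvg_cst].
rewrite -(cvg_lim (@Rhausdorff R) c); apply: limr_le; first exact: (cvgP _ c).
by exists n => // k /= nk; rewrite -(subnKC nk); apply: NP => //; exact: leq_maxl.
Qed.

Lemma tracking_path_le0 t : t <= 0 -> tracking_path t = p0.
Proof.
move=> t0; apply: cvg_lim => //; apply: cvg_near_cst; near=> n.
rewrite /euler_path truncn_floor.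
case: ifPn => [|//]; rewrite pmulr_lge0// => t0'.
by have -> : t = 0 by [apply/eqP; rewrite eq_le t0]; rewrite mul0r floor0.
Unshelve. all: by end_near. Qed.

Lemma truncn_mono (n : nat) (s t : R) : s <= t ->
  (Num.truncn (s * 2 ^+ n) <= Num.truncn (t * 2 ^+ n))%N.
Proof. by move=> st; apply: le_truncn; rewrite ler_pM2r. Qed.

Lemma truncn_mesh_dist n (s t : R) : 0 <= s -> 0 <= t -> s <= t ->
  `|(Num.truncn (t * 2 ^+ n) - Num.truncn (s * 2 ^+ n))%N%:R / 2 ^+ n - (t - s)| <= 2 * (2 ^+ n)^-1.
Proof.
move=> s0 t0 st; rewrite natrB ?truncn_mono// mulrBl.
have := truncn_div_dist t0 (mesh_gt0 n); have := truncn_div_dist s0 (mesh_gt0 n).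
set x := _ / _; set y := _ / _; rewrite !ler_norml => /andP[? ?] /andP[? ?].
by apply/andP; split; lra.
Qed.

Lemma euler_pathD n (s t : R) : s <= t ->
  exists2 i, i = (Num.truncn (t * 2 ^+ n) - Num.truncn (s * 2 ^+ n))%N &
  euler_path n t = euler n (Num.truncn (s * 2 ^+ n) + i).
Proof. by move=> st; eexists; [reflexivity|rewrite subnKC// truncn_mono]. Qed.

Lemma tracking_path_dist s t : 0 <= s -> s <= t ->
  th * (t - s) <= tracking_path t - tracking_path s <= 0.
Proof.
move=> s0 st; have t0 := le_trans s0 st.
suff H e : 0 < e -> th * (t - s) - (2 - 2 * th) * e <= tracking_path t - tracking_path s <= 2 * e.
  have th2 : 0 < 2 - 2 * th by rewrite addr_gt0// oppr_gt0 pmulr_rlt0.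
  apply/andP; split; apply/ler_addgt0Pr => e e0.
    have := H (e / (2 - 2 * th)) (divr_gt0 e0 th2).
    rewrite (mulrC (2 - 2 * th)) divfK ?gt_eqF//.
    by rewrite lerBlDr => /andP[].
  have e2 : 0 < e / 2 by exact: divr_gt0.
  have := H (e / 2) e2; rewrite (_ : 2 * (e / 2) = e); last by field.
  by rewrite add0r => /andP[].
move=> e0; have [n [ne nP]] := tracking_path_uniform t e0.
have := nP t (lexx _); have := nP s st.
have := truncn_mesh_dist n s0 t0 st.
have [i <- ->] := euler_pathD n st; rewrite /(euler_path n s).
have := eulerD n (Num.truncn (s * 2 ^+ n)) i.
rewrite (mulrAC th); rewrite !ler_norml -mulrA.
set y := i%:R / _; set a := euler _ _; set c := euler _ _; set m := 2 ^- n in ne *.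
move=> /andP[h1 h2] /andP[h3 h4] /andP[h5 h6] /andP[h7 h8].
have h9 : th * (t - s + 2 * e) <= th * y by rewrite ler_nM2l//; lra.
by apply/andP; split; lra.
Qed.

(** Uniform convergence transfers the margin e to a fine Euler path, whose feedback is then
    constant. The window opens at s - e because the grid point below s may precede s. *)
Lemma tracking_path_constant (q : bool) s t : 0 <= s -> s <= t ->
  (exists2 e, 0 < e & forall u, 0 <= u -> s - e <= u <= t ->
     if q then B u + e <= tracking_path u else tracking_path u + e <= B u) ->
  tracking_path t - tracking_path s = th * q%:R * (t - s).
Proof.
move=> s0 st [e e0 Be]; have t0 := le_trans s0 st.
have q0 : 0 <= - (th * q%:R) by rewrite oppr_ge0 mulr_le0_ge0// ltW.
suff H d : 0 < d -> d < e ->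
    `|tracking_path t - tracking_path s - th * q%:R * (t - s)| <= (2 - 2 * (th * q%:R)) * d.
  have th2 : 0 < 2 - 2 * (th * q%:R) by rewrite -mulrN ltr_wpDr// mulr_ge0.
  apply/eqP; rewrite -subr_eq0 -normr_le0; apply/ler_addgt0Pr => d d0; rewrite add0r.
  have m0 : 0 < Num.min (e / 2) (d / (2 - 2 * (th * q%:R))) by rewrite lt_min !divr_gt0.
  apply: (le_trans (H _ m0 _)).
    by rewrite gt_min ltr_pdivrMr// ltr_pMr// ltr1n.
  by rewrite mulrC -ler_pdivlMr// ge_min lexx orbT.
move=> d0 de; have [n [nd nP]] := tracking_path_uniform t d0.
have := nP t (lexx _); have := nP s st.
have := truncn_mesh_dist n s0 t0 st.
have [i iE ->] := euler_pathD n st; rewrite -iE /(euler_path n s).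
have const j : (j < i)%N -> (B ((Num.truncn (s * 2 ^+ n) + j)%N%:R / 2 ^+ n)
    < euler n (Num.truncn (s * 2 ^+ n) + j))%R = q.
  move=> ji; set k := (_ + j)%N; set u := k%:R / 2 ^+ n.
  have u0 : 0 <= u by rewrite divr_ge0// ltW.
  have ut : u <= t.
    rewrite ler_pdivrMr// -truncn_ge_nat ?mulr_ge0 ?(ltW (mesh_gt0 _))//.
    by rewrite /k -(subnKC (truncn_mono n st)) -iE leq_add2l ltnW.
  have su : s - e <= u.
    have h1 : (Num.truncn (s * 2 ^+ n))%:R / 2 ^+ n <= u.
      by rewrite ler_pM2r ?invr_gt0// ler_nat leq_addr.
    have := truncn_div_dist s0 (mesh_gt0 n); rewrite ler_norml => /andP[h2 _].
    by move: h1 h2; set x := _ / _; lra.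
  have uE : euler_path n u = euler n k by rewrite /euler_path divfK ?gt_eqF// natrK.
  have := Be u u0; rewrite su ut => /(_ isT).
  have := nP u ut; rewrite uE ler_norml => /andP[h1 h2]; move: h1 h2.
  case: (q) => h1 h2 h; [apply/idP; lra|apply/negbTE; rewrite -leNgt; lra].
have := euler_constant const; rewrite !ler_norml.
move: (th * q%:R) q0 => r q0.
set y := i%:R / _; set a := euler _ _; set c := euler _ _; set m := 2 ^- n in nd *.
move=> h1 /andP[h3 h4] /andP[h5 h6] /andP[h7 h8].
have h9 : - r * y <= - r * (t - s + 2 * d) by apply: ler_wpM2l => //; lra.
have h10 : - r * (t - s - 2 * d) <= - r * y by apply: ler_wpM2l => //; lra.
by apply/andP; split; lra.
Qed.

Lemma tracking_path_lipschitz s t : `|tracking_path t - tracking_path s| <= - th * `|t - s|.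
Proof.
wlog st : s t / s <= t.
  move=> H; have [st|/ltW ts] := leP s t; first exact: H.
  by rewrite distrC (distrC t); exact: H.
have [s0|/ltW s0] := leP 0 s.
  have := tracking_path_dist s0 st; rewrite ler_norml [`|t - s|]ger0_norm ?subr_ge0// =>
    /andP[h1 h2].
  by apply/andP; split; [rewrite mulNr opprK|apply: (le_trans h2); rewrite mulr_ge0 ?subr_ge0//
    oppr_ge0 ltW].
have [t0|/ltW t0] := leP t 0.
  by rewrite !tracking_path_le0// subrr normr0 mulr_ge0// oppr_ge0 ltW.
rewrite (tracking_path_le0 s0) -(tracking_path_le0 (lexx 0)).
have := tracking_path_dist (lexx 0) t0; rewrite subr0 => /andP[h1 h2].
have h3 : th * (t - s) <= th * t by rewrite ler_nM2l// lerBrDr gerDl.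
rewrite ler_norml [`|t - s|]ger0_norm ?subr_ge0//; apply/andP; split; first by rewrite mulNr
  opprK; exact: le_trans h1.
by apply: (le_trans h2); rewrite mulr_ge0 ?subr_ge0// oppr_ge0 ltW.
Qed.

Lemma tracking_gap_continuous t e : 0 <= t -> 0 < e -> exists2 dl, 0 < dl &
  forall s, 0 <= s -> `|s - t| < dl ->
    `|(tracking_path s - B s) - (tracking_path t - B t)| < e.
Proof.
move=> t0 e0; have e2 : 0 < e / 2 by exact: divr_gt0.
have [d d0 dP] := (within_continuousP B).1 cB t t0 (e / 2) e2.
have th1 : 0 < - th by rewrite oppr_gt0.
exists (Num.min d (e / 2 / - th)); first by rewrite lt_min d0 divr_gt0.
move=> s s0; rewrite lt_min => /andP[sd]; rewrite ltr_pdivlMr// mulrC => st.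
have -> : tracking_path s - B s - (tracking_path t - B t) =
  (tracking_path s - tracking_path t) - (B s - B t) by ring.
apply: (le_lt_trans (ler_normB _ _)); rewrite [ltRHS](splitr e); apply: ltrD; last exact: dP.
exact: le_lt_trans (tracking_path_lipschitz _ _) st.
Qed.

Lemma derive1_local_affine (f : R -> R) (t v dl : R) : 0 < dl ->
  (forall s, `|s - t| < dl -> f s - f t = v * (s - t)) ->
  derivable f t 1 /\ derive1 f t = v.
Proof.
move=> dl0 H.
have D : is_derive t (1 : R) (fun s => v * (s - t) + f t) v.
  by apply: is_derive_eq; rewrite /GRing.scale/=; ring.
have E : {near t, (fun s => v * (s - t) + f t) =1 f}.
  exists dl => //= s; rewrite /ball/= distrC => /H <-; ring.
have [df dv] := near_eq_is_derive E D.
by rewrite derive1E.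
Qed.

(** Off the barrier the gap keeps its sign, with a margin, on a neighbourhood of t, and the path is
    affine there. Times on the barrier are left to a probabilistic argument. *)
Lemma tracking_path_derive t : 0 < t -> tracking_path t != B t ->
  derivable tracking_path t 1 /\
  derive1 tracking_path t = if tracking_path t <= B t then 0 else th.
Proof.
move=> t0 tB; set q := tracking_path t - B t.
have q0 : 0 < `|q| / 3 by rewrite divr_gt0// normr_gt0 subr_eq0.
have [d d0 dP] := tracking_gap_continuous (ltW t0) q0.
pose m := Num.min (d / 2) (Num.min t (`|q| / 3)).
have m0 : 0 < m by rewrite !lt_min t0 divr_gt0.
have [md mt mq] : [/\ m <= d / 2, m <= t & m <= `|q| / 3].
  by rewrite /m !ge_min !lexx !orbT.
have gap s s' : 0 <= s -> s <= s' -> `|s - t| < m / 2 -> `|s' - t| < m / 2 ->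
    tracking_path s' - tracking_path s = (if tracking_path t <= B t then 0 else th) * (s' - s).
  move=> s0 ss st s't; rewrite -subr_le0 -/q.
  have close u : 0 <= u -> s - m / 2 <= u <= s' -> `|tracking_path u - B u - q| < `|q| / 3.
    move=> u0 /andP[su us]; apply: dP => //; move: st s't.
    rewrite !ltr_norml => /andP[h1 h2] /andP[h3 h4]; apply/andP; split; lra.
  have m2 : 0 < m / 2 by exact: divr_gt0.
  case: ifPn => [ql|]; last rewrite -ltNge => ql.
    rewrite -(mulr0 th) -[X in th * X]/(false%:R); apply: tracking_path_constant => //.
    exists (m / 2) => // u u0 /(close u u0).
    by move: mq; rewrite (ler0_norm ql) ltr_norml => mq /andP[h1 h2]; lra.
  rewrite -[th]mulr1 -[X in th * X]/(true%:R); apply: tracking_path_constant => //.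
  exists (m / 2) => // u u0 /(close u u0).
  by move: mq; rewrite (gtr0_norm ql) ltr_norml => mq /andP[h1 h2]; lra.
apply: (@derive1_local_affine _ _ _ (m / 2)); first exact: divr_gt0.
move=> s st; have m2 : `|t - t| < m / 2 by rewrite subrr normr0 divr_gt0.
have [ts|/ltW ts] := leP t s; first by apply: gap => //; exact: ltW.
have s0 : 0 <= s by move: st; rewrite ltr_norml => /andP[h1 h2]; lra.
have := gap s t s0 ts st m2; rewrite -opprB => /(congr1 -%R); rewrite opprK => ->; ring.
Qed.

End EulerScheme.

(** * Small-interval estimates for the Gaussian step *)

Section SmallBall.
Context {R : realType}.
Notation mu := (@lebesgue_measure R).
Local Open Scope ereal_scope.

Lemma normal_prob_itv_le (s lo hi : R) : (0 < s)%R -> (lo <= hi)%R ->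
  normal_prob 0 s `[lo, hi]%classic <= (normal_peak s * (hi - lo))%:E.
Proof.
move=> s0 lohi; have sn0 : s != 0%R by rewrite gt_eqF.
rewrite -[X in normal_prob 0 s X]setIT -integral_indic//.
rewrite ge0_integral_normal_prob//; last by apply/measurable_EFinP; exact: measurable_indic.
apply: (@le_trans _ _ (\int[mu]_(x in `[lo, hi]) (normal_peak s)%:E)).
  rewrite [leRHS]integral_mkcond; apply: ge0_le_integral => //.
  - by move=> x _; rewrite -EFinM lee_fin mulr_ge0// normal_pdf_ge0.
  - apply: emeasurable_funM; apply/measurable_EFinP; first exact: measurable_indic.
    exact: measurable_normal_pdf.
  - by apply/measurable_restrict => //; exact: measurable_cst.
  - move=> x _; rewrite patchE indicE; case: ifPn => _; rewrite ?mul1e ?mul0e//.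
    by rewrite lee_fin normal_pdf_ub.
rewrite integral_cst//= (lebesgue_measure_itv `[lo, hi])/= lte_fin.
case: ifPn => [_|]; first by rewrite -EFinB EFinM.
by rewrite mule0 lee_fin mulr_ge0 ?normal_peak_ge0// subr_ge0.
Qed.

End SmallBall.

Section LevelProbability.
Context {R : realType} {d : measure_display} {T : measurableType d}.
Variables (Pr : probability T R) (W : R -> T -> R).
Hypothesis hW : standard_brownian_motion Pr W.
Variables (sigma : R).
Hypothesis sigma0 : 0 < sigma.

(** Given the past, the event puts the increment into an interval of length len / sigma, and the
    Gaussian density is at most its peak. *)
Lemma step_small_ball (t h : R) (xi : T -> R) (lo len : R) : 0 <= t -> 0 < h -> 0 <= len ->
  (forall B : set R, measurable B -> natural_filtration W t (xi @^-1` B)) ->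
  (Pr [set w | (lo <= xi w - sigma * increment W t (t + h) w <= lo + len)%R]
    <= (normal_peak (Num.sqrt h) * (len / sigma))%:E)%E.
Proof.
move=> t0 h0 len0 xiF.
have th0 : 0 <= t + h by rewrite addr_ge0// ltW.
have r0 : 0 < Num.sqrt h by rewrite sqrtr_gt0.
have mxi := step_measurable hW xiF.
have meta := increment_measurable hW t0 th0.
pose A := [set z : measurableTypeR R * measurableTypeR R | lo <= z.1 - sigma * z.2 <= lo + len].
have mA : measurable A.
  have mf : measurable_fun setT (fun z : measurableTypeR R * measurableTypeR R => (z.1 - sigma
    * z.2 : R)).
    apply: measurable_funB; first exact: measurable_fst.
    by apply: measurable_funM => //; exact: measurable_snd.
  by rewrite -[A]setTI; exact: (mf measurableT `[lo, lo + len]%classic).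
have -> : [set w | lo <= xi w - sigma * increment W t (t + h) w <= lo + len]
  = [set w | A (xi w, increment W t (t + h) w)] by [].
have mS : measurable [set w | A (xi w, increment W t (t + h) w)].
  rewrite -[X in measurable X]setTI.
  exact: (measurable_fun_pair (mxi : measurable_fun setT (xi : T -> measurableTypeR R))
    (meta : measurable_fun setT (_ : T -> measurableTypeR R)) measurableT mA).
rewrite -[X in Pr X]setIT -integral_indic//.
have -> : (\int[Pr]_w (\1_[set w0 | A (xi w0, increment W t (t + h) w0)] w)%:E =
   \int[Pr]_w ((\1_A (xi w, increment W t (t + h) w))%:E))%E by [].
have := @indep_ge0_integral _ _ _ Pr xi (increment W t (t + h)) (normal_prob 0 (Num.sqrt h))
  mxi meta (step_indep hW t0 h0 xiF) (fun z => (\1_A z)%:E).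
move=> ->; last 2 first.
- by apply/measurable_EFinP; exact: measurable_indic.
- by move=> z; rewrite lee_fin.
rewrite -[leRHS]mule1 -(@probability_setT _ _ _ Pr) -integral_cst//.
apply: ge0_le_integral => //.
- by move=> w _; apply: integral_ge0 => y _; rewrite lee_fin.
- apply: (@measurableT_comp _ _ _ _ _ _ (fun x : measurableTypeR R =>
     (\int[normal_prob 0 (Num.sqrt h)]_y (\1_A (x, y))%:E)%E) _ xi) => //.
  apply: (@measurable_fun_fubini_tonelli_F _ _ (measurableTypeR R) (measurableTypeR R) R
    (normal_prob 0 (Num.sqrt h)) (EFin \o \1_A)).
    by apply/measurable_EFinP; exact: measurable_indic.
  by move=> z; rewrite lee_fin.
move=> w _; rewrite /cst.
have alg (x y : R) : lo <= x - sigma * y -> x - sigma * y <= lo + len ->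
    (x - lo - len) / sigma <= y <= (x - lo) / sigma.
  by move=> ? ?; rewrite ler_pdivrMr// ler_pdivlMr//; apply/andP; split; lra.
have := @normal_prob_itv_le _ (Num.sqrt h) ((xi w - lo - len) / sigma) ((xi w - lo) / sigma) r0.
rewrite ler_pM2r ?invr_gt0// gerBl len0 => /(_ isT).
have -> : (xi w - lo) / sigma - (xi w - lo - len) / sigma = len / sigma by field; rewrite gt_eqF.
apply: le_trans.
rewrite [leRHS](_ : _ = normal_prob 0 (Num.sqrt h) (`[(xi w - lo - len) / sigma, (xi w - lo) /
  sigma] `&` setT)%classic); last by rewrite setIT.
rewrite -integral_indic//; apply: ge0_le_integral => //.
- apply/measurable_EFinP; apply: (@section_measurable _ _ (measurableTypeR R) (\1_A)).
  exact: measurable_indic.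
- by apply/measurable_EFinP; exact: measurable_indic.
- move=> y _; rewrite lee_fin !indicE; case: (boolP ((xi w, y) \in A)) => //.
  rewrite inE => /= /andP[h1 h2]; rewrite (@mem_set _ `[_, _]%classic)//= in_itv/=.
  by apply: alg.
Qed.

End LevelProbability.

(** * The tracking path driven by demand is an admissible threshold policy *)

Section ThresholdPolicy.
Context {R : realType} {d : measure_display} {T : measurableType d}.
Variables (Pr : probability T R) (W : R -> T -> R).
Hypothesis hW : standard_brownian_motion Pr W.
Variables (b sigma d0 p0 thl thu U : R).
Hypotheses (sigma0 : 0 < sigma) (thl0 : thl < 0) (thu0 : 0 < thu).
Notation mu := (@lebesgue_measure R).
Let D := demand b sigma d0 W.
Let barrier w s := D s w + U.

Definition threshold_path (t : R) (w : T) : R := tracking_path thl p0 (barrier w) t.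

Let X t w := threshold_path t w - D t w.

Lemma demand_continuous w : {within `[0, +oo[, continuous (D^~ w)}.
Proof.
move=> x; apply: (@continuousD _ _ _ ((fun t => d0 + b * t) : subspace _ -> R)).
  apply: continuousD; first exact: cst_continuous.
  by apply: continuousM; [exact: cst_continuous|apply: continuous_subspaceT => ?; exact: cvg_id].
by apply: continuousM; [exact: cst_continuous|exact: (bm_continuous hW)].
Qed.

Lemma barrier_continuous w : {within `[0, +oo[, continuous (barrier w)}.
Proof.
move=> x; apply: (@continuousD _ _ _ ((D^~ w) : subspace _ -> R)); last exact: cst_continuous.
exact: demand_continuous.
Qed.

Lemma euler_adapted n k t : k%:R / 2 ^+ n <= t ->
  measurable_fun setT (fun w : filtration_type D t => euler thl p0 (barrier w) n k).
Proof.
elim: k => [_|k IH kt] /=; first exact: measurable_cst.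
have kt' : k%:R / 2 ^+ n <= t.
  by apply: le_trans kt; rewrite ler_pM2r ?invr_gt0 ?exprn_gt0// ler_nat.
have m1 := IH kt'.
have m2 : measurable_fun setT (fun w : filtration_type D t => barrier w (k%:R / 2 ^+ n)).
  apply: measurable_funD; last exact: measurable_cst.
  by apply: filtration_self => //; rewrite divr_ge0// exprn_ge0.
apply: measurable_funD => //; apply: measurable_funM; first exact: measurable_cst.
apply: (@eq_measurable_fun _ _ _ _ _ (fun w : filtration_type D t =>
  if barrier w (k%:R / 2 ^+ n) < euler thl p0 (barrier w) n k then 1 else 0 : R)).
  by move=> w _; case: ifP.
by apply: measurable_fun_ifT => //; exact: measurable_fun_ltr.
Qed.

Lemma threshold_path_adapted : adapted threshold_path (natural_filtration D).
Proof.
move=> t t0; apply/filtration_measurableP.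
apply: (@measurable_fun_cvg _ _ _ _ (fun n (w : filtration_type D t) => euler_path thl p0
  (barrier w) n t)).
  move=> n; apply: euler_adapted.
  by rewrite ler_pdivrMr ?exprn_gt0// truncn_le mulr_ge0// exprn_ge0.
move=> w _; apply: euler_path_cvg => //; exact: barrier_continuous.
Qed.

Lemma threshold_path_adaptedW t : 0 <= t -> forall B : set R, measurable B ->
  natural_filtration W t (threshold_path t @^-1` B).
Proof.
by move=> t0 B mB; apply: (@demand_filtration _ _ _ b sigma d0); exact: threshold_path_adapted.
Qed.

Lemma threshold_path_lipschitz w s t :
  `|threshold_path t w - threshold_path s w| <= - thl * `|t - s|.
Proof. by apply: tracking_path_lipschitz => //; exact: barrier_continuous. Qed.

Lemma threshold_path_continuous w : {within `[0, +oo[, continuous (threshold_path^~ w)}.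
Proof.
apply/within_continuousP => t t0 e e0.
have th1 : 0 < - thl by rewrite oppr_gt0.
exists (e / - thl); first exact: divr_gt0.
move=> s s0; rewrite ltr_pdivlMr// mulrC; apply: le_lt_trans.
exact: threshold_path_lipschitz.
Qed.

(** Over [t - h, t] the capacity moves by at most |thl| h, so X_t = U forces the state with capacity
    frozen at t - h into an interval of length 2 |thl| h. Its probability is O(h / sqrt h), which
    tends to 0. *)
Lemma threshold_level_null t : 0 < t -> Pr [set w | X t w = U] = 0%E.
Proof.
move=> t0; apply/eqP; rewrite eq_le measure_ge0 andbT.
pose c := 2 * - thl / sigma * (Num.sqrt (pi *+ 2))^-1.
have c0 : 0 < c.
  rewrite mulr_gt0 ?divr_gt0 ?mulr_gt0 ?oppr_gt0//.
  by rewrite invr_gt0 sqrtr_gt0 pmulrn_rgt0// pi_gt0.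
apply/lee_addgt0Pr => e e0; rewrite add0e.
pose h := Num.min t ((e / c) ^+ 2).
have h0 : 0 < h by rewrite lt_min t0 exprn_gt0// divr_gt0.
have ht : h <= t by rewrite ge_min lexx.
have th0 : 0 <= t - h by rewrite subr_ge0.
(* The state at t without the noise of the last h and without the control's reaction to it, hence
   known at time t - h. *)
pose xi w := threshold_path (t - h) w - (d0 + b * t + sigma * W (t - h) w).
have xiF B : measurable B -> natural_filtration W (t - h) (xi @^-1` B).
  move: B; apply/filtration_measurableP; apply: measurable_funB.
    apply/filtration_measurableP => B mB; apply: (@demand_filtration _ _ _ b sigma d0).
    exact: threshold_path_adapted.
  apply: measurable_funD; first exact: measurable_cst.
  by apply: measurable_funM; [exact: measurable_cst|exact: filtration_self].
have len0 : 0 <= 2 * - thl * h by rewrite !mulr_ge0// ?oppr_ge0 ltW.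
have := step_small_ball hW sigma0 (U + thl * h) th0 h0 len0 xiF; rewrite subrK => H.
apply: (@le_trans _ _ (Num.sqrt h * c)%:E); last first.
  rewrite lee_fin -ler_pdivlMr//; apply: (@le_trans _ _ (Num.sqrt ((e / c) ^+ 2))).
    by apply: ler_wsqrtr; rewrite ge_min lexx orbT.
  by rewrite sqrtr_sqr ger0_norm// divr_ge0 ?(ltW e0)// ltW.
rewrite (_ : Num.sqrt h * c = normal_peak (Num.sqrt h) * (2 * - thl * h / sigma)); last first.
  rewrite /normal_peak sqr_sqrtr ?(ltW h0)// -mulrnAr sqrtrM ?(ltW h0)// /c.
  have alg (x y : R) : 0 < x -> 0 < y ->
      x * (2 * - thl / sigma / y) = (x * y)^-1 * (2 * - thl * x ^+ 2 / sigma).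
    by move=> x0 y0; field; rewrite !gt_eqF.
  rewrite alg ?sqrtr_gt0//; last by rewrite pmulrn_rgt0// pi_gt0.
  by rewrite sqr_sqrtr// ltW.
apply: le_trans H; apply: le_measure; rewrite ?inE.
- by rewrite -[X in measurable X]setTI; exact: (state_measurable hW b sigma d0
  threshold_path_adaptedW (ltW t0) measurableT (measurable_set1 U)).
- have m : measurable_fun setT (fun w => xi w - sigma * increment W (t - h) t w).
    apply: measurable_funB; first (have := step_measurable hW xiF; exact).
    by apply: measurable_funM => //; have := increment_measurable hW th0 (ltW t0); exact.
  by rewrite -[X in measurable X]setTI; exact: (m measurableT `[_, _]%classic).
move=> w /= XU; have := threshold_path_lipschitz w (t - h) t.
rewrite (_ : t - (t - h) = h); last by ring.
rewrite (gtr0_norm h0) ler_norml => /andP[h1 h2].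
move: XU; rewrite /X /D /demand /xi /increment => XU; apply/andP; split; lra.
Qed.

(** Tonelli's theorem exchanges the quantifiers. Time 0 is excluded from the set, since the initial
    state is deterministic and may equal U. *)
Lemma threshold_level_ae : {ae Pr, forall w, {ae mu, forall t, 0 <= t -> X t w != U}}.
Proof.
have mXt t : 0 <= t -> measurable_fun setT (X t).
  by move=> t0; have := state_measurable hW b sigma d0 threshold_path_adaptedW t0; exact.
have cX w : {within `[0, +oo[, continuous (X^~ w)}.
  have := @state_continuous _ _ _ _ _ hW b sigma d0 _ threshold_path_continuous w; exact.
have mX := measurable_fun_caratheodory mXt cX.
pose A := [set z : measurableTypeR R * T | 0 < z.1 /\ X (Num.max z.1 0) z.2 = U].
have mA : measurable A.
  have -> : A = (fst @^-1` `]0, +oo[%classic) `&`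
      (fun z : measurableTypeR R * T => X (Num.max z.1 0) z.2) @^-1` [set U].
    by apply/seteqP; split => z /=; rewrite in_itv/= andbT.
  apply: measurableI; rewrite -[X in measurable X]setTI.
    by apply: (@measurable_fst _ _ (measurableTypeR R) T) => //; exact: measurable_itv.
  by apply: mX; [exact: measurableT|exact: measurable_set1].
have := indic_fubini_tonelli mu Pr mA.
rewrite [LHS](_ : _ = 0%E); last first.
  apply: integral0_eq => s _; rewrite indic_fubini_tonelli_FE//=.
  have [s0|s0] := ltP 0 s; last first.
    rewrite [X in Pr X](_ : _ = set0) ?measure0//; apply/seteqP; split => // w.
    by rewrite xsectionP => -[/=]; rewrite ltNge s0.
  rewrite [X in Pr X](_ : _ = [set w | X s w = U]) ?threshold_level_null//.
  apply/seteqP; split => w; rewrite xsectionP /A/= (max_idPl (ltW s0)).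
    by case.
  by split.
rewrite indic_fubini_tonelli_GE// => /esym H.
have mG := @measurable_fun_ysection _ _ _ _ R mu A mA.
have /(ae_eq_integral_abs _ measurableT mG) : (\int[Pr]_w `|(mu \o ysection A) w| = 0)%E.
  by rewrite -[RHS]H; apply: eq_integral => w _; rewrite gee0_abs.
move/ae_imp; apply => w /(_ Logic.I) /= Aw.
have : {ae mu, forall t, ~ ysection A w t}.
  exists (ysection A w); split => //; first exact: measurable_ysection.
  by move=> t /= /contrapT.
move=> h; apply: (ae_imp2 h (ae_neq 0)) => t At tn0 t0.
have {}t0 : 0 < t by rewrite lt_neqAle eq_sym tn0.
by apply/eqP => XU; apply: At; rewrite ysectionP /A/= (max_idPl (ltW t0)).
Qed.

Lemma threshold_path_ac w t : absolutely_continuous_on 0 t (threshold_path^~ w).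
Proof.
apply: (@lipschitz_absolutely_continuous _ _ _ _ (- thl)); first by rewrite oppr_ge0 ltW.
move=> x y _ xy _; apply: (le_trans (threshold_path_lipschitz w x y)).
by rewrite ger0_norm// subr_ge0.
Qed.

Lemma threshold_path_ae : ae_rate Pr threshold_path (fun w t =>
  rate threshold_path w t = if threshold_path t w - D t w <= U then 0 else thl).
Proof.
apply: (ae_imp threshold_level_ae) => w XU.
apply: (ae_imp2 XU (ae_neq 0)) => t + t0 tge => /(_ tge) {}XU.
have tgt : 0 < t by rewrite lt_neqAle eq_sym t0.
rewrite lerBlDl; apply: tracking_path_derive => //; first exact: barrier_continuous.
by apply: contra XU => /eqP XB; rewrite /X /threshold_path XB /barrier addrAC subrr add0r.
Qed.

Lemma threshold_path_policy : control_policy Pr thl thu p0 D threshold_path /\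
  threshold_rule Pr thl U D threshold_path.
Proof.
split; last exact: threshold_path_ae.
split.
- by move=> w; apply: tracking_path_le0.
- exact: threshold_path_adapted.
- by move=> w t _; exact: threshold_path_ac.
apply: (ae_imp threshold_path_ae) => w; move/ae_imp; apply => t h t0.
have [df ->] := h t0; split => //.
by case: ifP => _; rewrite ?lexx ?(ltW thl0) ?(ltW thu0)//= (le_trans _ (ltW thu0))// ltW.
Qed.

End ThresholdPolicy.

(** * Cost of an arbitrary policy *)

Section PathRegularity.
Context {R : realType}.
Notation mu := (@lebesgue_measure R).

Lemma absolutely_continuous_within (f : R -> R) :
  (forall t, 0 <= t -> absolutely_continuous_on 0 t f) -> {within `[0, +oo[, continuous f}.
Proof.
move=> acf; apply/within_continuousP => t t0 e e0.
have t1 : 0 <= t + 1 by rewrite addr_ge0.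
have [dl dl0 H] := acf _ t1 e e0.
have main x y : 0 <= x -> x <= y -> y <= t + 1 -> y - x < dl -> `|f y - f x| < e.
  move=> x0 xy yt yx; have := H 1%N (fun=> x) (fun=> y).
  rewrite !big_ord1; apply => //.
  by move=> i j _ _ _; rewrite !ord1.
exists (Num.min dl 1); first by rewrite lt_min dl0 ltr01.
move=> s s0; rewrite lt_min => /andP[]; have [st|/ltW ts] := leP t s.
  rewrite ger0_norm ?subr_ge0// => sd s1; apply: main => //.
  by move: s1; rewrite ltrBlDl => /ltW.
rewrite distrC (distrC (f s)) ger0_norm ?subr_ge0// => sd s1; apply: main => //.
by rewrite lerDl.
Qed.

Lemma lipschitz_measurable (f : R -> R) (K : R) :
  (forall x y, `|f y - f x| <= K * `|y - x|) -> measurable_fun setT f.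
Proof.
move=> lf; apply: continuous_measurable_fun => x; apply/cvgrPdist_lt => e e0.
have K0 : 0 <= K.
  by have := lf 0 1; rewrite subr0 normr1 mulr1; exact: le_trans.
have K1 : 0 < K + 1 by rewrite ltr_wpDl.
near=> y; apply: (@le_lt_trans _ _ (K * `|x - y|)) => //.
apply: (@le_lt_trans _ _ ((K + 1) * `|x - y|)); first by rewrite ler_wpM2r// lerDl.
rewrite mulrC -ltr_pdivlMr//; near: y.
by apply: cvgr_dist_lt; rewrite ?divr_gt0//; exact: cvg_id.
Unshelve. all: by end_near. Qed.

End PathRegularity.

(** * A jointly measurable version of the rate *)

Section RateDensity.
Context {R : realType} {d : measure_display} {T : measurableType d}.
Variable Pr : probability T R.
Variables (Q : R -> T -> R) (thl thu : R).
Hypothesis th : thl <= thu.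
Hypothesis mQ : forall t, 0 <= t -> measurable_fun setT (Q t).
Hypothesis cQ : forall w, {within `[0, +oo[, continuous (Q^~ w)}.

Definition difference_quotient (n : nat) (z : measurableTypeR R * T) : R :=
  n.+1%:R * (Q (Num.max z.1 0 + n.+1%:R^-1) z.2 - Q (Num.max z.1 0) z.2).

(** An upper limit of right difference quotients is jointly measurable for continuous measurable
    processes, and equals the derivative where there is one. Clamping makes the rate bounds hold
    everywhere, also where the upper limit is infinite. *)
Definition rate_density (z : measurableTypeR R * T) : R :=
  Num.max thl (Num.min thu (fine (limn_esup (fun n => (difference_quotient n z)%:E)))).

Lemma rate_density_bounds z : thl <= rate_density z <= thu.
Proof. by rewrite /rate_density le_max lexx/= ge_max th ge_min lexx. Qed.

Lemma rate_density_measurable : measurable_fun setT rate_density.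
Proof.
apply: measurable_maxr => //; apply: measurable_minr => //.
apply: (measurableT_comp (fine_measurable measurableT)) => //.
apply: measurable_fun_limn_esup => n; apply/measurable_EFinP.
apply: measurable_funM => //; apply: measurable_funB; last exact: measurable_fun_caratheodory.
have n0 : 0 <= n.+1%:R^-1 :> R by rewrite invr_ge0.
apply: (@measurable_fun_caratheodory _ _ _ (fun t => Q (t + n.+1%:R^-1))).
  by move=> t t0; apply: mQ; rewrite addr_ge0.
move=> w; apply/within_continuousP => t t0 e e0.
have [dl dl0 H] := (within_continuousP (Q^~ w)).1 (@cQ w) (t + n.+1%:R^-1) (addr_ge0 t0 n0) e e0.
exists dl => // s s0 st; apply: H; first exact: addr_ge0.
by rewrite opprD addrACA subrr addr0.
Qed.

Lemma rate_density_rate w t : 0 <= t -> derivable (Q^~ w) t 1 ->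
  thl <= derive1 (Q^~ w) t <= thu -> rate_density (t, w) = derive1 (Q^~ w) t.
Proof.
move=> t0 df /andP[l u].
have c : difference_quotient n (t, w) @[n --> \oo] --> derive1 (Q^~ w) t.
  have := df; rewrite /derivable => /cvg_ex[/= l' fl'].
  have -> : derive1 (Q^~ w) t = l'.
    by rewrite derive1E /derive; exact: cvg_lim fl'.
  apply/cvgrPdist_lt => e e0; move/cvgrPdist_lt: fl' => /(_ e e0) [dl /= dl0 H].
  have [N _ NP] := near_infty_natSinv_lt (PosNum dl0).
  exists N => // n /NP /= ndl; rewrite /difference_quotient/= (max_idPl t0).
  have := H (n.+1%:R^-1); rewrite /ball_/= sub0r normrN ger0_norm ?invr_ge0//.
  move=> /(_ ndl); rewrite /GRing.scale/= mulr1 invrK [n.+1%:R^-1 + t]addrC; apply.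
  by rewrite invr_neq0.
rewrite /rate_density (_ : fine _ = derive1 (Q^~ w) t); last first.
  have : (difference_quotient n (t, w))%:E @[n --> \oo] --> (derive1 (Q^~ w) t)%:E.
    by apply/fine_cvgP; split; [exact: nearW|exact: c].
  by move/cvg_limn_einf_sup => [_ ->].
by rewrite (min_idPr u) (max_idPr l).
Qed.

End RateDensity.

(** * Exchanging expectation and time integral in the cost *)

Section DiscountedCost.
Context {R : realType} {d : measure_display} {T : measurableType d}.
Variable Pr : probability T R.
Notation mu := (@lebesgue_measure R).
Variables (alpha : R) (g : measurableTypeR R * T -> R).
Hypotheses (mg : measurable_fun setT g) (g0 : forall z, 0 <= g z).
Hypothesis ig : forall t, 0 <= t -> Pr.-integrable setT (fun w => (g (t, w))%:E).

Let disc (t : R) := expR (- alpha * t).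

Lemma discount_measurable : measurable_fun setT disc.
Proof. by apply: measurableT_comp => //; exact: measurable_funM. Qed.

(** F is the cost integrand as defined, containing the pathwise derivative. It is replaced by the
    measurable g under both integral signs by [ae_eq_lower_integral], and only then does Tonelli's
    theorem apply. *)
Lemma discounted_cost_swap (F : R -> T -> R) : (forall t w, 0 <= F t w) ->
  {ae Pr, forall w, {ae mu, forall t, 0 <= t -> F t w = disc t * g (t, w)}} ->
  (\int[Pr]_w \int[mu]_(t in `[0%R, +oo[) (F t w)%:E =
   \int[mu]_(t in `[0%R, +oo[) (disc t * (\int[Pr]_w g (t, w))%R)%:E)%E.
Proof.
move=> F0 aeF.
pose f (z : measurableTypeR R * T) : R := \1_(`[0, +oo[%classic) z.1 * (disc z.1 * g z).
have mf : measurable_fun setT f.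
  apply: measurable_funM.
    apply: (@measurableT_comp _ _ _ _ _ _ (\1_(`[0, +oo[%classic) : measurableTypeR R -> R) _
      fst) => //.
  apply: measurable_funM => //.
  by apply: (@measurableT_comp _ _ _ _ _ _ (disc : measurableTypeR R -> R) _ fst) => //;
    exact: discount_measurable.
have f0 z : 0 <= f z by rewrite !mulr_ge0// ?expR_ge0// indicE.
have -> : (\int[Pr]_w \int[mu]_(t in `[0%R, +oo[) (F t w)%:E = \int[Pr]_w \int[mu]_t (f (t,
  w))%:E)%E.
  apply: ae_eq_lower_integral => [w _|w _|].
  - by apply: integral_ge0 => t _; rewrite lee_fin.
  - by apply: integral_ge0 => t _; rewrite lee_fin.
  apply: (ae_imp aeF) => w Fw _.
  rewrite (_ : (\int[mu]_(t in `[0%R, +oo[) (F t w)%:E)%E = (\int[mu]_(t in `[0%R, +oo[) (disc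
    t * g (t, w))%:E)%E); last first.
    apply: ae_eq_lower_integral => [t _|t _|].
    - by rewrite lee_fin.
    - by rewrite lee_fin mulr_ge0// expR_ge0.
    by apply: (ae_imp Fw) => t h; rewrite /= in_itv/= andbT => t0; rewrite h.
  rewrite [LHS]integral_mkcond; apply: eq_integral => t _.
  by rewrite patchE /f/= indicE; case: ifPn => _; rewrite ?mul1r ?mul0r.
have /= <- := @fubini_tonelli _ _ _ _ R mu Pr (EFin \o f) _ _; last 2 first.
- exact/measurable_EFinP.
- by move=> z; rewrite lee_fin.
rewrite [RHS]integral_mkcond; apply: eq_integral => t _; rewrite patchE.
case: ifPn => [|tn]; last first.
  by apply: integral0_eq => w _; rewrite /f/= indicE (negbTE tn) mul0r.
rewrite inE/= in_itv/= andbT => t0.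
under eq_integral => w _.
  rewrite /f/= indicE mem_set ?mul1r; last by rewrite /= in_itv/= t0.
  over.
rewrite EFinM; under eq_integral do rewrite EFinM.
rewrite ge0_integralZl//; last 3 first.
- by apply/measurable_EFinP; exact: section_measurable.
- by move=> w _; rewrite lee_fin.
- by rewrite lee_fin expR_ge0.
by rewrite fineK//; apply: integrable_fin_num => //; exact: ig.
Qed.

End DiscountedCost.

(** * Passage to the infinite horizon *)

Section InfiniteHorizon.
Context {R : realType}.
Notation mu := (@lebesgue_measure R).
Variables (phi kap : R -> R) (alpha C A : R).
Hypotheses (alpha0 : 0 < alpha) (C0 : 0 <= C) (A0 : 0 <= A).
Hypothesis mkap : measurable_fun setT kap.
Hypothesis kap0 : forall s, 0 <= kap s.
Hypothesis kapA : forall s, 0 <= s -> kap s <= A * (1 + s).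
Hypothesis phiA : forall s, 0 <= s -> `|phi s| <= A * (1 + s).

Let disc s := expR (- alpha * s).
Let I := (\int[mu]_(s in `[0%R, +oo[) (disc s * kap s)%:E)%E.

Let mdk : measurable_fun setT (fun s => disc s * kap s).
Proof. by apply: measurable_funM => //; exact: discount_measurable. Qed.

Let dk0 s : 0 <= disc s * kap s. Proof. by rewrite mulr_ge0// expR_ge0. Qed.

(** Discounting beats linear growth: exp (alpha n) >= (alpha n)^2 / 2 and 1 + n <= 2 n, so n >= 4 A
    / (alpha^2 e) suffices. *)
Let tail_le (e : R) : 0 < e -> exists N, forall n, (N <= n)%N -> `|disc n%:R * phi n%:R| <= e.
Proof.
move=> e0; pose N := (Num.truncn (4 * A / (alpha ^+ 2 * e))).+1.
have a2 : 0 < alpha ^+ 2 * e by rewrite mulr_gt0// exprn_gt0.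
exists N => n Nn; have n0 : (0 : R) < n%:R by rewrite ltr0n; exact: leq_trans Nn.
have n1 : (1 : R) <= n%:R by rewrite ler1n; exact: leq_trans Nn.
have An : 4 * A <= n%:R * (alpha ^+ 2 * e).
  rewrite -ler_pdivrMr//; apply: (le_trans (ltW (truncnS_gt _))); by rewrite ler_nat.
have E : (alpha * n%:R) ^+ 2 / 2 <= expR (alpha * n%:R).
  apply: le_trans (expR_ge1Dxn 1 _); last by rewrite mulr_ge0// ltW.
  by rewrite lerDr.
rewrite normrM ger0_norm ?expR_ge0// /disc mulNr expRN mulrC ler_pdivrMr ?expR_gt0//.
apply: (le_trans (phiA (ltW n0))); apply: le_trans (ler_wpM2l (ltW e0) E).
apply: (@le_trans _ _ (A * (2 * n%:R))); first by apply: ler_wpM2l => //; lra.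
have -> : e * ((alpha * n%:R) ^+ 2 / 2) = n%:R * (alpha ^+ 2 * e) * (n%:R / 2) by field.
have -> : A * (2 * n%:R) = 4 * A * (n%:R / 2) by field.
by apply: ler_wpM2r => //; rewrite divr_ge0// ltW.
Qed.

Let partial_integral n : (\int[mu]_(s in `[0%R, n%:R]) (disc s * kap s)%:E =
  (\int[mu]_(s in `[0%R, n%:R]) (disc s * kap s))%R%:E)%E.
Proof.
rewrite fineK//; apply: integrable_fin_num => //.
apply: (@itv_integrable _ _ _ _ (A * (1 + n%:R))) => // u u0 un.
rewrite ger0_norm// -[leRHS]mul1r; apply: ler_pM => //.
- exact: expR_ge0.
- by rewrite -(@expR0 R) ler_expR mulNr oppr_le0 mulr_ge0// ltW.
- by apply: (le_trans (kapA u0)); rewrite ler_wpM2l// lerD2l.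
Qed.

Lemma infinite_horizon_ge : (forall t h, 0 <= t -> 0 < h -> h <= 1 ->
  - (C * (h * Num.sqrt h)) <=
  phi (t + h) - phi t - alpha * h * phi t + (\int[mu]_(s in `[t, t + h]) kap s)%R) ->
  ((phi 0)%:E <= I)%E.
Proof.
move=> step; apply/lee_addgt0Pr => e e0.
have [N NP] := tail_le e0; pose n := N.+1.
have n0 : (0 : R) < n%:R by [].
have B0 : 0 <= A * (1 + n%:R) by rewrite mulr_ge0// addr_ge0.
have := @discounted_telescope _ phi kap alpha C (A * (1 + n%:R)) n%:R (ltW alpha0) C0 B0 n0 mkap.
move=> H; have {}H : phi 0 <= disc n%:R * phi n%:R + (\int[mu]_(s in `[0%R, n%:R]) (disc s *
  kap s))%R.
  apply: H.
  - by move=> s s0 sn; rewrite ger0_norm//; apply: (le_trans (kapA s0)); rewrite ler_wpM2l// lerD2l.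
  - by move=> s s0 sn; apply: (le_trans (phiA s0)); rewrite ler_wpM2l// lerD2l.
  - by move=> t h t0 h0 h1 _; exact: step.
apply: (@le_trans _ _ ((\int[mu]_(s in `[0%R, n%:R]) (disc s * kap s))%R%:E + e%:E)%E).
  rewrite -EFinD lee_fin; have := NP n (leqnSn N); rewrite ler_norml => /andP[_ h].
  by apply: (le_trans H); rewrite addrC lerD2l.
rewrite leeD2r// -partial_integral; apply: ge0_subset_integral => //.
- by apply/measurable_EFinP; exact: measurable_funTS.
- by move=> s _; rewrite lee_fin.
- by move=> s /=; rewrite !in_itv/= => /andP[->].
Qed.

(** [discounted_telescope] is applied to - phi and - kap; this is why it is stated for signed
    functions bounded in absolute value. *)
Lemma infinite_horizon_le : (forall t h, 0 <= t -> 0 < h -> h <= 1 ->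
  phi (t + h) - phi t - alpha * h * phi t + (\int[mu]_(s in `[t, t + h]) kap s)%R
  <= C * (h * Num.sqrt h)) ->
  (I <= (phi 0)%:E)%E.
Proof.
move=> step; apply/lee_addgt0Pr => e e0.
have [N NP] := tail_le e0.
have c : (\int[mu]_(s in `[0%R, n%:R]) (disc s * kap s)%:E)%E @[n --> \oo] --> I.
  by apply: ge0_cvgn_integral.
rewrite -(cvg_lim (@ereal_hausdorff R) c); apply: lime_le; first exact: (cvgP _ c).
exists N.+1 => // n /= Nn; rewrite partial_integral -EFinD lee_fin.
have n0 : (0 : R) < n%:R by rewrite ltr0n; exact: leq_trans Nn.
have B0 : 0 <= A * (1 + n%:R) by rewrite mulr_ge0// addr_ge0.
have ik a c' : 0 <= a -> c' <= n%:R -> mu.-integrable `[a, c'] (EFin \o kap).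
  move=> a0 cn; apply: (@itv_integrable _ _ _ _ (A * (1 + n%:R))) => // u au uc.
  have u0 := le_trans a0 au.
  rewrite ger0_norm//; apply: (le_trans (kapA u0)); rewrite ler_wpM2l// lerD2l.
  exact: le_trans cn.
have := @discounted_telescope _ (fun s => - phi s) (fun s => - kap s) alpha C (A * (1 + n%:R))
  n%:R (ltW alpha0) C0 B0 n0.
move=> H; have {}H : - phi 0 <= disc n%:R * (- phi n%:R)
    + (\int[mu]_(s in `[0%R, n%:R]) (disc s * - kap s))%R.
  apply: H.
  - exact: measurableT_comp.
  - by move=> s s0 sn; rewrite normrN ger0_norm//; apply: (le_trans (kapA s0)); rewrite
    ler_wpM2l// lerD2l.
  - by move=> s s0 sn; rewrite normrN; apply: (le_trans (phiA s0)); rewrite ler_wpM2l// lerD2l.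
  - move=> t h t0 h0 h1 thn; have := step t h t0 h0 h1.
    have -> : (\int[mu]_(s in `[t, t + h]) (- kap s))%R = - (\int[mu]_(s in `[t, t + h]) kap s)%R.
      under eq_Rintegral do rewrite -mulN1r.
      by rewrite RintegralZl ?mulN1r//; exact: ik.
    by rewrite mulrN; lra.
have EN : (\int[mu]_(s in `[0%R, n%:R]) (disc s * - kap s))%R
    = - (\int[mu]_(s in `[0%R, n%:R]) (disc s * kap s))%R.
  under eq_Rintegral do rewrite mulrN -mulN1r.
  rewrite RintegralZl ?mulN1r//.
  apply: (@itv_integrable _ _ _ _ (A * (1 + n%:R))) => // u u0 un.
  rewrite ger0_norm// -[leRHS]mul1r; apply: ler_pM => //.
  - exact: expR_ge0.
  - by rewrite -(@expR0 R) ler_expR mulNr oppr_le0 mulr_ge0// ltW.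
  - by apply: (le_trans (kapA u0)); rewrite ler_wpM2l// lerD2l.
have := NP n (ltnW Nn); rewrite ler_norml => /andP[h _].
by move: H; rewrite EN mulrN; lra.
Qed.

End InfiniteHorizon.

Ltac nonneg := repeat first
  [ assumption | exact: normr_ge0 | exact: ler0n | apply: addr_ge0 | apply: mulr_ge0
  | apply: exprn_ge0 ].

(** * Verification: lower bound for all policies, equality for the threshold rule *)

Section Verification.
Context {R : realType} {d : measure_display} {T : measurableType d}.
Variables (Pr : probability T R) (W : R -> T -> R).
Hypothesis hW : standard_brownian_motion Pr W.
Variables (alpha b sigma thl thu C M Ip Dp U : R).
Hypotheses (alpha0 : 0 < alpha) (sigma0 : 0 < sigma) (thl0 : thl < 0) (thu0 : 0 < thu).
Hypotheses (C0 : 0 <= C) (M0 : 0 <= M) (Ip0 : 0 <= Ip) (Dp0 : 0 <= Dp).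
Variables (V v w : R -> R).
Hypothesis VF : value_function alpha b sigma thl C M Ip Dp U V v w.
Notation mu := (@lebesgue_measure R).

Definition adjustment_cost (r : R) : R := (Ip * (0 < r)%R%:R - Dp * (r < 0)%R%:R) * r.

Lemma adjustment_costE r : adjustment_cost r = Ip * Num.max r 0 - Dp * Num.min r 0.
Proof.
rewrite /adjustment_cost; have [r0|r0|->] := ltgtP r 0; rewrite /=; ring.
Qed.

Lemma adjustment_cost_ge0 r : 0 <= adjustment_cost r.
Proof.
rewrite adjustment_costE addr_ge0//; first by rewrite mulr_ge0// le_max lexx orbT.
by rewrite -mulrN mulr_ge0// oppr_ge0 ge_min lexx orbT.
Qed.

Lemma adjustment_cost_le r : thl <= r <= thu -> adjustment_cost r <= Ip * thu + Dp * - thl.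
Proof.
move=> /andP[lr ru]; rewrite adjustment_costE -mulrN; apply: lerD; apply: ler_wpM2l => //.
  by rewrite ge_max ru ltW.
by rewrite lerN2 le_min lr ltW.
Qed.

Lemma max0_lipschitz (x y : R) : `|Num.max y 0 - Num.max x 0| <= `|y - x|.
Proof.
have [y0|y0] := leP y 0; have [x0|x0] := leP x 0; rewrite ?subr0 ?sub0r ?subrr ?normr0 ?normrN//.
- by rewrite (gtr0_norm x0) ler0_norm; lra.
- by rewrite (gtr0_norm y0) ger0_norm; lra.
Qed.

Lemma min0E (x : R) : - Num.min x 0 = Num.max (- x) 0.
Proof. by rewrite oppr_min oppr0. Qed.

Lemma holding_cost_lipschitz x y :
  `|holding_cost C M y - holding_cost C M x| <= (C + M) * `|y - x|.
Proof.
rewrite /holding_cost !min0E.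
have -> : C * Num.max y 0 + M * Num.max (- y) 0 - (C * Num.max x 0 + M * Num.max (- x) 0)
  = C * (Num.max y 0 - Num.max x 0) + M * (Num.max (- y) 0 - Num.max (- x) 0) by ring.
apply: (le_trans (ler_normD _ _)); rewrite (normrM C) (normrM M) (ger0_norm C0) (ger0_norm M0)
  mulrDl.
apply: lerD; apply: ler_wpM2l => //; first exact: max0_lipschitz.
apply: (le_trans (max0_lipschitz _ _)); rewrite (_ : - y - - x = - (y - x)) ?normrN//.
by rewrite opprB opprK addrC.
Qed.

Lemma holding_cost_ge0 x : 0 <= holding_cost C M x.
Proof.
rewrite /holding_cost min0E addr_ge0// mulr_ge0// le_max lexx orbT//.
Qed.

Lemma hamiltonian_lipschitz p q : `|hamiltonian thl Dp q - hamiltonian thl Dp p| <= - thl * `|q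
  - p|.
Proof.
rewrite /hamiltonian -mulrBr normrM ltr0_norm// ler_wpM2l ?oppr_ge0 ?(ltW thl0)//.
by apply: (le_trans (max0_lipschitz _ _)); rewrite opprB addrA subrK.
Qed.

Lemma hamiltonian_le0 q : hamiltonian thl Dp q <= 0.
Proof. by rewrite /hamiltonian mulr_le0_ge0 ?(ltW thl0)// le_max lexx orbT. Qed.

(** For r > 0 the right side is (p + Ip) r >= 0; for r <= 0 it is (p - Dp) r, least at r = thl if p
    > Dp and at r = 0 otherwise. *)
Lemma hamiltonian_bound (p r : R) : - Ip <= p -> thl <= r <= thu ->
  hamiltonian thl Dp p <= p * r + adjustment_cost r.
Proof.
move=> Ipp /andP[lr ru]; rewrite adjustment_costE.
have [r0|r0] := leP r 0; last first.
  rewrite mulr0 subr0 -mulrDl; apply: (le_trans (hamiltonian_le0 p)).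
  by rewrite mulr_ge0 ?(ltW r0)// -lerBlDr sub0r.
rewrite mulr0 add0r -mulrBl /hamiltonian.
have [pD|pD] := leP (p - Dp) 0; first by rewrite mulr0 mulr_le0.
by rewrite mulrC ler_wpM2l// ltW.
Qed.

Lemma adjustment_cost_thl (p : R) : Dp <= p ->
  p * thl + adjustment_cost thl = hamiltonian thl Dp p.
Proof.
move=> Dpp; rewrite hamiltonian_ge// adjustment_costE (min_idPl (ltW thl0)) (max_idPr (ltW
  thl0)); ring.
Qed.

Let h := holding_cost C M.
Let G x := hamiltonian thl Dp (v x).

Record verification_bounds (L : R) : Prop := VerificationBounds {
  vb_ge0 : 0 <= L ;
  vb_v : forall x, `|v x| <= L ;
  vb_w : forall x, `|w x| <= L ;
  vb_V1 : forall x y, `|V y - V x| <= L * `|y - x| ;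
  vb_v1 : forall x y, `|v y - v x| <= L * `|y - x| ;
  vb_w1 : forall x y, `|w y - w x| <= L * `|y - x| ;
  vb_V3 : forall x y, `|V y - V x - v x * (y - x) - w x / 2 * (y - x) ^+ 2| <= L * `|y - x| ^+ 3 ;
  vb_h : forall x y, `|h y - h x| <= L * `|y - x| ;
  vb_G : forall x, `|G x| <= L ;
  vb_G1 : forall x y, `|G y - G x| <= L * `|y - x| ;
  vb_c : forall r, thl <= r <= thu -> adjustment_cost r <= L }.

Lemma verification_bounds_exist : exists L, verification_bounds L.
Proof.
have [[[L0 j] _] _ _ _] := VF.
have L00 : 0 <= L0 by apply: le_trans (jet_v j (Logic.I : setT 0)).
have nthl : 0 <= - thl by rewrite oppr_ge0 ltW.
pose L := L0 + (C + M) + - thl * (L0 + Dp) + (Ip * thu + Dp * - thl).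
have q1 : 0 <= C + M by exact: addr_ge0.
have q2 : 0 <= - thl * (L0 + Dp) by rewrite mulr_ge0// addr_ge0.
have q3 : 0 <= Ip * thu + Dp * - thl by rewrite addr_ge0// mulr_ge0// ltW.
have [l1 l2 l3 l4] : [/\ L0 <= L, C + M <= L, - thl * (L0 + Dp) <= L & Ip * thu + Dp * - thl <= L].
  rewrite /L; move: L00 q1 q2 q3; generalize (C + M) (- thl * (L0 + Dp)) (Ip * thu + Dp * - thl).
  by move=> a a' a'' ? ? ? ?; split; lra.
have [j1 j2 j3 j4 j5 _ j7] := jet_le l1 j.
have G1 x y : `|G y - G x| <= - thl * L0 * `|y - x|.
  apply: (le_trans (hamiltonian_lipschitz _ _)); rewrite -mulrA ler_wpM2l//.
  exact: (jet_v1 j).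
exists L; split => //; try by [move=> x; exact: j1|move=> x; exact: j2|move=> x y; exact:
  j3|move=> x y; exact: j4|move=> x y; exact: j5|move=> x y; exact: j7].
- exact: le_trans l1.
- by move=> x y; apply: (le_trans (holding_cost_lipschitz _ _)); exact: ler_wpM2r.
- move=> x; apply: le_trans l3; have := hamiltonian_lipschitz Dp (v x).
  rewrite {2}/hamiltonian subrr (max_idPl (lexx 0)) mulr0 subr0 => /le_trans; apply.
  apply: ler_wpM2l => //; apply: (le_trans (ler_normB _ _)); rewrite (ger0_norm Dp0) lerD2r.
  exact: (jet_v j).
- move=> x y; apply: (le_trans (G1 x y)); apply: ler_wpM2r => //; apply: le_trans l3.
  by apply: ler_wpM2l => //; rewrite lerDl.
- by move=> r rth; apply: le_trans l4; exact: adjustment_cost_le.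
Qed.

Section Policy.
Variables (d0 p0 : R) (P : R -> T -> R) (p : measurableTypeR R * T -> R).
Let D := demand b sigma d0 W.
Hypothesis P0 : forall w, P 0 w = p0.
Hypothesis adP : adapted P (natural_filtration D).
Hypothesis acP : forall w t, 0 <= t -> absolutely_continuous_on 0 t (P^~ w).
Hypothesis mp : measurable_fun setT p.
Hypothesis pth : forall z, thl <= p z <= thu.
Hypothesis aep : ae_rate Pr P (fun w t => rate P w t = p (t, w)).
Variable L : R.
Hypothesis vb : verification_bounds L.

Let adPW t : 0 <= t -> forall B : set R, measurable B -> natural_filtration W t (P t @^-1` B).
Proof. by move=> t0 B mB; apply: (@demand_filtration _ _ _ b sigma d0); exact: adP. Qed.

Let cP w' : {within `[0, +oo[, continuous (P^~ w')}.
Proof. exact/absolutely_continuous_within/acP. Qed.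

Let K0 := thu - thl.
Let K00 : 0 <= K0. Proof. by rewrite subr_ge0 ltW// (lt_trans thl0). Qed.

Let pK z : `|p z| <= K0.
Proof.
have /andP[l u] := pth z; rewrite ler_norml /K0 opprB.
by rewrite (le_trans _ l) ?gerBl ?(ltW thu0)//= (le_trans u)// lerDl oppr_ge0 ltW.
Qed.

Let Pp : {ae Pr, forall w, forall s t, 0 <= s -> s <= t ->
  P t w - P s w = (\int[mu]_(u in `[s, t]) p (u, w))%R}.
Proof.
apply: (ae_imp aep) => w' h' s t s0 st.
apply: (@absolutely_continuous_FTC _ (P^~ w') (fun u => p (u, w')) K0) => //.
- exact: acP.
- by apply: (measurableT_comp mp); exact: measurable_fun_pair.
Qed.

Let mV : measurable_fun setT V. Proof. exact: lipschitz_measurable (vb_V1 vb). Qed.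
Let mv : measurable_fun setT v. Proof. exact: lipschitz_measurable (vb_v1 vb). Qed.
Let mw : measurable_fun setT w. Proof. exact: lipschitz_measurable (vb_w1 vb). Qed.
Let mh : measurable_fun setT h. Proof. exact: lipschitz_measurable (vb_h vb). Qed.
Let mG : measurable_fun setT G. Proof. exact: lipschitz_measurable (vb_G1 vb). Qed.

Let mc : measurable_fun setT adjustment_cost.
Proof.
rewrite (_ : adjustment_cost = fun r => Ip * Num.max r 0 - Dp * Num.min r 0).
  by apply: measurable_funB; apply: measurable_funM => //;
    [exact: measurable_maxr|exact: measurable_minr].
by apply/funext => r; rewrite adjustment_costE.
Qed.

Let cL z : adjustment_cost (p z) <= L. Proof. exact: vb_c. Qed.

Let HJB x : sigma ^+ 2 / 2 * w x - b * v x - alpha * V x + h x + G x = 0.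
Proof. by have [[_ hjb] _ _ _] := VF; exact: hjb. Qed.

Let phi := expected_value Pr W b sigma d0 P V.
Let kap := expected_rate Pr W b sigma d0 P p h adjustment_cost.

Let phi0 : phi 0 = V (p0 - d0).
Proof.
rewrite /phi /expected_value; under eq_Rintegral => w' _.
  rewrite P0 /demand (bm_start hW) !mulr0 !addr0; over.
by rewrite Rintegral_probability_cst.
Qed.

Let K := K0 + `|b|.

Let A := `|V (p0 - d0)| + `|h (p0 - d0)| + L * (K + sigma) + L.

Let A0 : 0 <= A.
Proof. by have L0 := vb_ge0 vb; have s0 := ltW sigma0; rewrite /A /K; nonneg. Qed.

Let grow (a s : R) : 0 <= s -> 0 <= a -> a + L * (K * s + sigma * Num.sqrt s) + L <=
  (a + L * (K + sigma) + L) * (1 + s).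
Proof.
move=> s0 a0; have L0 := vb_ge0 vb.
have K0' : 0 <= K by rewrite addr_ge0.
(* The diffusive growth sqrt s is absorbed into the linear growth that the discount factor can
   beat. *)
have r : Num.sqrt s <= 1 + s.
  have := sqr_ge0 (Num.sqrt s - 1); rewrite sqrrB1 sqr_sqrtr//.
  by have := sqrtr_ge0 s; lra.
have e1 : L * (K * s + sigma * Num.sqrt s) <= L * (K + sigma) * (1 + s).
  rewrite -mulrA; apply: ler_wpM2l => //; rewrite [(K + sigma) * _]mulrDl; apply: lerD; apply:
    ler_wpM2l => //.
    by rewrite lerDr.
  exact: ltW.
rewrite (mulrDl _ L) (mulrDl a); apply: lerD; first apply: lerD => //.
  by rewrite ler_peMr// lerDl.
by rewrite ler_peMr// lerDl.
Qed.

Let kapA s : 0 <= s -> kap s <= A * (1 + s).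
Proof.
move=> s0; apply: (le_trans (@expected_rate_le _ _ _ _ _ hW _ _ _ _ _ sigma0 _ _ P0 adPW mp pK
  Pp _ _ _ mh mc adjustment_cost_ge0 (vb_h vb) cL _ s0)).
apply: (le_trans (grow s0 (normr_ge0 _))); apply: ler_wpM2r; first exact: addr_ge0.
by rewrite /A !lerD2r lerDr.
Qed.

Let phiA s : 0 <= s -> `|phi s| <= A * (1 + s).
Proof.
move=> s0; have [_] := @lipschitz_state_integrable _ _ _ _ _ hW b sigma d0 _ _ sigma0 _ _ P0
  adPW mp pK Pp _ _ _ mV (vb_V1 vb) s0.
move=> /le_trans; apply; have := grow s0 (normr_ge0 (V (p0 - d0))) => H.
apply: (@le_trans _ _ ((`|V (p0 - d0)| + L * (K + sigma) + L) * (1 + s))).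
  by apply: le_trans H; rewrite lerDl (vb_ge0 vb).
apply: ler_wpM2r; first exact: addr_ge0.
by rewrite /A !lerD2r lerDl.
Qed.

Let mkap : measurable_fun setT (kap : R -> R).
Proof.
exact: (@expected_rate_measurable _ _ _ _ _ hW b sigma d0 P p adPW cP mp h adjustment_cost mh
  mc holding_cost_ge0 adjustment_cost_ge0).
Qed.

Let kap0 s : 0 <= kap s.
Proof. exact: expected_rate_ge0 holding_cost_ge0 adjustment_cost_ge0 _. Qed.

Lemma expected_costE : expected_cost Pr alpha C M Ip Dp D P =
  (\int[mu]_(s in `[0%R, +oo[) (expR (- alpha * s) * kap s)%:E)%E.
Proof.
pose g := running_cost W b sigma d0 P p h adjustment_cost.
have mg : measurable_fun setT g.
  exact: (@running_cost_measurable _ _ _ _ _ hW b sigma d0 P p adPW cP mp h adjustment_cost mh mc).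
have g0 z : 0 <= g z by exact: running_cost_ge0 holding_cost_ge0 adjustment_cost_ge0 _.
apply: (discounted_cost_swap mg g0).
- move=> t t0; rewrite /g /running_cost/= (max_idPl t0).
  apply: integrableD_EFin => //.
    by have [] := @lipschitz_state_integrable _ _ _ _ _ hW b sigma d0 _ _ sigma0 _ _ P0 adPW mp
      pK Pp _ _ _ mh (vb_h vb) t0.
  apply: (@bounded_probability_integrable _ _ _ _ _ L) => [|w'].
    by apply: (measurableT_comp mc); exact: section_measurable.
  by rewrite ger0_norm ?cL// adjustment_cost_ge0.
- move=> t w'; rewrite mulr_ge0 ?expR_ge0// addr_ge0//; first exact: holding_cost_ge0.
  exact: adjustment_cost_ge0.
apply: (ae_imp aep) => w'; move/ae_imp; apply => t h' t0; have [_ rE] := h' t0.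
by rewrite rE /g /running_cost/= (max_idPl t0).
Qed.

Lemma cost_ge : ((V (p0 - d0))%:E <= expected_cost Pr alpha C M Ip Dp D P)%E.
Proof.
rewrite expected_costE -phi0; have L0 := vb_ge0 vb.
have K0' : 0 <= K by rewrite addr_ge0.
have s0 := ltW sigma0.
apply: (@infinite_horizon_ge _ phi kap alpha (taylor_const b sigma K0 L + L * (K + sigma)) A) => //.
  by rewrite /taylor_const /= -/K; nonneg.
move=> t k t0 k0 k1.
apply: (@step_ge _ _ _ _ _ hW _ _ _ _ _ sigma0 K00 _ _ P0 adPW cP mp pK Pp _ _ _ _ L0 mV mv mw
  (vb_v vb) (vb_w vb) (vb_V1 vb) (vb_V3 vb) _ _ _ _ mh mG mc holding_cost_ge0
  adjustment_cost_ge0 (vb_h vb) (vb_G vb) cL HJB) => //.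
by move=> x z; apply: hamiltonian_bound => //; have [_ +  _ _] := VF.
Qed.

Lemma cost_le : (forall s w, 0 <= s ->
    p (s, w) = if P s w - D s w <= U then 0 else thl) ->
  (expected_cost Pr alpha C M Ip Dp D P <= (V (p0 - d0))%:E)%E.
Proof.
move=> pE; rewrite expected_costE -phi0; have L0 := vb_ge0 vb.
have K0' : 0 <= K by rewrite addr_ge0.
have s0 := ltW sigma0.
apply: (@infinite_horizon_le _ phi kap alpha (taylor_const b sigma K0 L + L * (2 + K0) * (K +
  sigma)) A) => //.
  by rewrite /taylor_const /= -/K; nonneg.
move=> t k t0 k0 k1.
apply: (@step_le _ _ _ _ _ hW _ _ _ _ _ sigma0 K00 _ _ P0 adPW cP mp pK Pp _ _ _ _ L0 mV mv mw
  (vb_v vb) (vb_w vb) (vb_V1 vb) (vb_V3 vb) _ _ _ _ mh mG mc holding_cost_ge0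
  adjustment_cost_ge0 (vb_h vb) (vb_G vb) cL HJB) => //.
- exact: vb_v1.
- exact: vb_G1.
move=> s w' s0'; rewrite pE//; have [_ _ vl vr] := VF.
case: ifPn => [xU|]; last by rewrite -ltNge => /ltW Ux; apply: adjustment_cost_thl; exact: vr.
by rewrite mulr0 /adjustment_cost mulr0 addr0 /G hamiltonian_le//; exact: vl.
Qed.

End Policy.

Section Optimality.
Variables (d0 p0 : R).
Let D := demand b sigma d0 W.

Let policy_measurable (Q : R -> T -> R) : adapted Q (natural_filtration D) ->
  forall t, 0 <= t -> measurable_fun setT (Q t).
Proof.
move=> adQ t t0 _ B mB; rewrite setTI.
have mW s : 0 <= s -> measurable_fun setT (W s) by exact: bm_measurable hW _.
apply: (natural_filtration_measurable mW (t := t)).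
by apply: (@demand_filtration _ _ _ b sigma d0); exact: adQ.
Qed.

Lemma policy_cost_ge Q : control_policy Pr thl thu p0 D Q ->
  ((V (p0 - d0))%:E <= expected_cost Pr alpha C M Ip Dp D Q)%E.
Proof.
move=> [Q0 adQ acQ aeQ]; have [L vb] := verification_bounds_exist.
have th : thl <= thu by exact: ltW (lt_trans thl0 thu0).
have mQ := policy_measurable adQ.
have cQ w' : {within `[0, +oo[, continuous (Q^~ w')}.
  exact/absolutely_continuous_within/acQ.
apply: (@cost_ge _ _ Q (rate_density Q thl thu) Q0 adQ acQ _ _ _ L vb).
- exact: rate_density_measurable.
- exact: rate_density_bounds.
apply: (ae_imp aeQ) => w'; move/ae_imp; apply => t h' t0; have [df hr] := h' t0.
by split => //; rewrite rate_density_rate.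
Qed.

(** Optimality holds for every policy obeying the rule, without uniqueness of such a policy: its
    cost is at most V (p0 - d0), and any other policy costs at least that. *)
Lemma threshold_optimal P : control_policy Pr thl thu p0 D P ->
  threshold_rule Pr thl U D P -> optimal_policy Pr alpha C M Ip Dp thl thu p0 D P.
Proof.
move=> cpP tr; split; first exact: cpP.
move=> Q cpQ; apply: le_trans (policy_cost_ge cpQ).
have [P0 adP acP aeP] := cpP; have [L vb] := verification_bounds_exist.
have mP := policy_measurable adP.
have cP w' : {within `[0, +oo[, continuous (P^~ w')}.
  exact/absolutely_continuous_within/acP.
pose X t w' := P t w' - D t w'.
have mX : measurable_fun setT (fun z : measurableTypeR R * T => X (Num.max z.1 0) z.2).
  apply: measurable_fun_caratheodory => [t t0|w'].
    apply: measurable_funB; first exact: mP.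
    apply: measurable_funD => //; apply: measurable_funM => //.
    exact: bm_measurable hW _ t0.
  by have := @state_continuous _ _ _ _ _ hW b sigma d0 _ cP w'; exact.
(* The feedback itself is the measurable version of the rate, so that the minimising identity holds
   at every time and outcome. *)
pose p (z : measurableTypeR R * T) := if X (Num.max z.1 0) z.2 <= U then 0 else thl.
apply: (@cost_le _ _ P p P0 adP acP _ _ _ L vb).
- apply: measurable_fun_ifT => //; exact: measurable_fun_ler.
- move=> z; rewrite /p; case: ifP => _; first by rewrite (ltW thl0) (ltW thu0).
  by rewrite lexx (ltW (lt_trans thl0 thu0)).
- apply: (ae_imp tr) => w'; move/ae_imp; apply => t h' t0; have [df hr] := h' t0.
  by split => //; rewrite hr /p/= (max_idPl t0).
- by move=> s w' s0; rewrite /p/= (max_idPl s0).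
Qed.

End Optimality.

End Verification.

Theorem theorem4 (R : realType) (d : measure_display) (T : measurableType d)
    (Pr : probability T R) (W : R -> T -> R)
    (alpha b sigma thl thu Ip Dp Rp Cp Rs Cs : R)
    (hW : standard_brownian_motion Pr W)
    (halpha : 0 < alpha) (hsigma : 0 < sigma)
    (hthl : thl < 0) (hthu : 0 < thu)
    (hIp : 0 <= Ip) (hDp : 0 <= Dp)
    (hCp : 0 <= Cp) (hRp : Cp < Rp) (hCs : 0 <= Cs) (hRs : Cs < Rs) :
  let Np := Rp - Cp in
  let Ns := Rs - Cs in
  let Cplus := Cp in
  let Cminus := Np - Ns in
  let r1 := pos_root alpha b sigma in
  let r2 := neg_root alpha b sigma in
  let t1 := pos_root alpha (b - thl) sigma in
  let t2 := neg_root alpha (b - thl) sigma in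
  let J1 := (Cplus - alpha * Dp) * (r1 - t2) in
  let J3 := (Cplus + Cminus) * r1 in
  Ns < Np ->
  Dp < Cplus / alpha ->
  Cminus / alpha <= Ip ->
  exists U : R,
    [/\ forall p0 d0 : R,
          let D := demand b sigma d0 W in
          (exists P, control_policy Pr thl thu p0 D P
                     /\ threshold_rule Pr thl U D P)
          /\ (forall P, control_policy Pr thl thu p0 D P ->
                threshold_rule Pr thl U D P ->
                optimal_policy Pr alpha Cplus Cminus Ip Dp thl thu p0 D P),
        J1 <= J3 ->
          U = 1 / (- r2) * ln (((Cplus + Cminus) * r1)
                               / ((Cplus - alpha * Dp) * (r1 - t2)))
          /\ 0 <= U
      & J3 < J1 ->
          U = 1 / t1 * ln (((alpha * Dp + Cminus) * (r1 - t2))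
                           / ((Cplus + Cminus) * (- t2)))
          /\ U < 0].
Proof.
move=> Np Ns Cplus Cminus r1 r2 t1 t2 J1 J3 NsNp DC CI.
have M0 : 0 < Cminus by rewrite subr_gt0.
have C0 : 0 < Cplus.
  (* Strict positivity of C_+ is not among the hypotheses; it follows from 0 <= D_p < C_+ /
     alpha. *)
  have : 0 < Cplus / alpha := le_lt_trans hDp DC.
  by rewrite pmulr_lgt0// invr_gt0.
have r1_gt0 : 0 < r1 := pos_root_gt0 halpha hsigma b.
have r2_lt0 : r2 < 0 := neg_root_lt0 halpha hsigma b.
have t1_gt0 : 0 < t1 := pos_root_gt0 halpha hsigma (b - thl).
have t2_lt0 : t2 < 0 := neg_root_lt0 halpha hsigma (b - thl).
have bthl : b < b - thl by rewrite ltrDl oppr_gt0.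
have r1t1 : r1 < t1 := pos_root_lt halpha hsigma bthl.
have r2t2 : r2 < t2 := neg_root_lt halpha hsigma bthl.
have chr1 := charpoly_pos halpha hsigma b : charpoly alpha sigma b r1 = 0.
have chr2 := charpoly_neg halpha hsigma b : charpoly alpha sigma b r2 = 0.
have cht1 := charpoly_pos halpha hsigma (b - thl) : charpoly alpha sigma (b - thl) t1 = 0.
have cht2 := charpoly_neg halpha hsigma (b - thl) : charpoly alpha sigma (b - thl) t2 = 0.
have sol U : (exists V v w, value_function alpha b sigma thl Cplus Cminus Ip Dp U V v w) ->
    forall p0 d0 : R, let D := demand b sigma d0 W in
      (exists P, control_policy Pr thl thu p0 D P /\ threshold_rule Pr thl U D P)
      /\ (forall P, control_policy Pr thl thu p0 D P -> threshold_rule Pr thl U D P ->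
            optimal_policy Pr alpha Cplus Cminus Ip Dp thl thu p0 D P).
  move=> [V [v [w VF]]] p0 d0 D; split.
    exists (threshold_path W b sigma d0 p0 thl U); exact: threshold_path_policy.
  by move=> P; apply: (threshold_optimal hW halpha hsigma hthl hthu _ _ hIp hDp VF) => //; exact: ltW.
have [J13|J31] := leP J1 J3.
  have U0 := threshold_right_ge0 halpha DC r1_gt0 r2_lt0 t2_lt0 J13.
  exists (1 / (- r2) * ln (J3 / J1)); split; [|by move=> _; split|by []].
  exact: sol (value_function_right halpha C0 M0 DC CI r1_gt0 r2_lt0 t2_lt0 r2t2 chr1 chr2 cht2 J13 erefl U0).
have U0 := threshold_left_lt0 halpha C0 M0 hDp r1_gt0 t1_gt0 t2_lt0 J31.
exists (1 / t1 * ln ((alpha * Dp + Cminus) * (r1 - t2) / ((Cplus + Cminus) * (- t2)))); split; [|by []|by move=> _; split].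
exact: sol (value_function_left halpha C0 M0 hDp CI r1_gt0 t1_gt0 t2_lt0 r1t1 chr1 cht1 cht2 erefl U0).
Qed.
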